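(* The following hold for the class $\mathcal{S}^*_R$: (i) $R_{\mathcal{S}_R^*}(\mathcal{T}_1)=\dfrac{11-4\sqrt{2}-\sqrt{57-24\sqrt{2}}}{8}$ $(\approx 0.0676475)$; (ii) $R_{\mathcal{S}_R^*}(\mathcal{T}_2)=\dfrac{5-2\sqrt{2}-\sqrt{21-12\sqrt{2}}}{2}$ $(\approx 0.0821135)$; (iii) $R_{\mathcal{S}_R^*}(\mathcal{T}_3)=\dfrac{\sqrt{-38+27\sqrt{2}}}{2\sqrt{14}}$ $(\approx 0.0572847)$.
   Context: Let $\mathbb{D}=\{z\in\mathbb{C}:|z|<1\}$ and let $\mathcal{A}$ be the class of analytic functions $f:\mathbb{D}\to\mathbb{C}$ with $f(0)=0$, $f'(0)=1$. For analytic $f,g$ on $\mathbb{D}$, $f\prec g$ ($f$ is subordinate to $g$) means $f=g\circ w$ for some analytic $w:\mathbb{D}\to\mathbb{D}$ with $w(0)=0$. Square roots are principal branches, and quotients such as $f/g$, $g/(zp)$, $zf'/f$ are understood with removable singularities at $0$ filled in. Define $\mathcal{T}_1$: all $f\in\mathcal{A}$ such that $f/g\prec e^z$ and $g/(zp)\prec e^z$ for some $g\in\mathcal{A}$ and some $p\prec\sqrt{1+z}$; $\mathcal{T}_2$: all $f\in\mathcal{A}$ such that $f/g\prec \sqrt{1+z}$ and $g/(zp)\prec \sqrt{1+z}$ for some $g\in\mathcal{A}$ and some $p\prec e^z$; $\mathcal{T}_3$: all $f\in\mathcal{A}$ such that $f/g\prec z+\sqrt{1+z^2}$ and $g/(zp)\prec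 z+\sqrt{1+z^2}$ for some $g\in\mathcal{A}$ and some $p\prec z+\sqrt{1+z^2}$. $\mathcal{S}^*_R$ is the class of $f\in\mathcal{A}$ with $zf'(z)/f(z)\prec \psi(z):=1+\dfrac{zk+z^2}{k^2-kz}$, where $k=\sqrt2+1$. For classes $\mathcal{G},\mathcal{M}\subset\mathcal{A}$, the $\mathcal{G}$-radius $R_{\mathcal{G}}(\mathcal{M})$ is $\inf\{\rho_f: f\in\mathcal{M}\}$, where $\rho_f$ is the largest number in $(0,1]$ such that for every $0<r\le\rho_f$ the function $f$ has the property defining $\mathcal{G}$ in the disk $|z|<r$, i.e. $z\mapsto f(rz)/r$ belongs to $\mathcal{G}$. *)

(* Defs.v *)
From Stdlib Require Import Reals Lra.
From Coquelicot Require Import Coquelicot.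

Open Scope C_scope.

Definition Cexp (z : C) : C := (exp (Re z) * cos (Im z), exp (Re z) * sin (Im z))%R.

(* Half-angle formulas; on the cut (-oo, 0) the argument is taken to be PI. *)
Definition Csqrt (z : C) : C :=
  (sqrt ((Cmod z + Re z) / 2),
   (if Rlt_dec (Im z) 0 then -1 else 1) * sqrt ((Cmod z - Re z) / 2))%R.

Lemma Csqrt_principal (z : C) :
  Csqrt z * Csqrt z = z /\
  (0 < Re (Csqrt z) \/ Re (Csqrt z) = 0 /\ 0 <= Im (Csqrt z))%R.
Proof.
destruct z as [x y]; unfold Csqrt, Cmult; cbn [fst snd Re Im].
set (m := Cmod (x, y)).
assert (Hm : (m * m = x * x + y * y)%R).
{ unfold m, Cmod; cbn [fst snd]; rewrite sqrt_sqrt; nra. }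
assert (Hm0 : (0 <= m)%R) by apply Cmod_ge_0.
assert (H1 : (0 <= (m + x) / 2)%R) by nra.
assert (H2 : (0 <= (m - x) / 2)%R) by nra.
assert (E1 := sqrt_sqrt _ H1); assert (E2 := sqrt_sqrt _ H2).
assert (P1 := sqrt_pos ((m + x) / 2)); assert (P2 := sqrt_pos ((m - x) / 2)).
set (a := sqrt ((m + x) / 2)) in *; set (b := sqrt ((m - x) / 2)) in *.
assert (E : ((a * b) * (a * b) = y * y / 4)%R).
{ replace ((a * b) * (a * b))%R with (a * a * (b * b))%R by ring.
  rewrite E1, E2; nra. }
assert (P := Rmult_le_pos _ _ P1 P2).
destruct (Rlt_dec y 0) as [Hy | Hy]; split.
- assert (a * b = - y / 2)%R by (apply Rsqr_inj; unfold Rsqr; lra).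
  f_equal; lra.
- left; destruct P1 as [P1 | P1]; [exact P1 | rewrite <- P1 in E; nra].
- assert (a * b = y / 2)%R by (apply Rsqr_inj; unfold Rsqr; lra).
  f_equal; lra.
- destruct P1 as [P1 | P1]; [now left | right; split; [easy | lra]].
Qed.

Definition disk (z : C) : Prop := (Cmod z < 1)%R.

(* Functions on the unit disk are represented by total functions C -> C, only
   the values on the disk being relevant; differentiability is complex. *)
Definition analytic (f : C -> C) : Prop :=
  forall z, disk z -> ex_derive (K := C_AbsRing) (V := C_NormedModule) f z.

Definition class_A (f : C -> C) : Prop :=
  analytic f /\ f 0 = 0 /\ C_derive f 0 = 1.

Definition subordinate (f g : C -> C) : Prop :=
  exists w : C -> C,
    analytic w /\ (forall z, disk z -> disk (w z)) /\ w 0 = 0 /\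
    (forall z, disk z -> f z = g (w z)).

(* q is F / G with the removable singularity at 0 filled in: G has no zero
   off 0, and analyticity of q forces q 0 to be the limit of F / G at 0. *)
Definition is_quotient (F G q : C -> C) : Prop :=
  analytic q /\
  (forall z, disk z -> z <> 0 -> G z <> 0 /\ q z = F z / G z).

Definition quotient_subordinate (F G h : C -> C) : Prop :=
  exists q, is_quotient F G q /\ subordinate q h.

Definition class_T (h u : C -> C) (f : C -> C) : Prop :=
  class_A f /\
  exists g p : C -> C,
    class_A g /\ analytic p /\ subordinate p u /\
    quotient_subordinate f g h /\
    quotient_subordinate g (fun z => z * p z) h.

Definition sqrt_1p (z : C) : C := Csqrt (1 + z).
Definition crescent (z : C) : C := z + Csqrt (1 + z * z).

Definition class_T1 : (C -> C) -> Prop := class_T Cexp sqrt_1p.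
Definition class_T2 : (C -> C) -> Prop := class_T sqrt_1p Cexp.
Definition class_T3 : (C -> C) -> Prop := class_T crescent crescent.

Definition psi (z : C) : C :=
  let k : C := RtoC (sqrt 2 + 1) in 1 + (z * k + z * z) / (k * k - k * z).

Definition class_SR (f : C -> C) : Prop :=
  class_A f /\ quotient_subordinate (fun z => z * C_derive f z) f psi.

Definition property_up_to (G : (C -> C) -> Prop) (f : C -> C) (rho : R) : Prop :=
  (0 < rho <= 1)%R /\
  forall r : R, (0 < r <= rho)%R -> G (fun z => f (r * z) / r).

Definition is_largest_radius (G : (C -> C) -> Prop) (f : C -> C) (rho : R) : Prop :=
  property_up_to G f rho /\ forall s, property_up_to G f s -> (s <= rho)%R.

(* The first conjunct says that rho_f is defined for every f in M, so that no
   f is left out of the infimum. *)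
Definition is_class_radius (G M : (C -> C) -> Prop) (rad : R) : Prop :=
  (forall f, M f -> exists rho, is_largest_radius G f rho) /\
  is_glb_Rbar (fun rho => exists f, M f /\ is_largest_radius G f rho) rad.

(* Main.v *)
Require Import Defs.
From Stdlib Require Import Reals Lra Lia Psatz Classical IndefiniteDescription.
From Coquelicot Require Import Coquelicot.

Open Scope C_scope.

(* Write f = z p q1 q2, where p and the q_i are compositions of the given functions with Schwarz
   functions w_i. Then z f'/f = 1 + sum of z w_i' L(w_i), L being the logarithmic
   derivative of the outer function, and Dieudonne's inequality
   |z w' - w| <= (|z|^2 - |w|^2) / (1 - |z|^2) confines each term, hence z f'/f, to the
   disc |om - sqrt 2| < 2 - sqrt 2 when |z| is less than the asserted radius. This disc lies in
   psi(D), and psi is univalent on D, with the explicit inverse [psi_inv]; so z f'/f is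
   subordinate to psi. For w_i(z) = z the value of z f'/f at minus the radius is
   2 sqrt 2 - 2 = psi(-1), a point not in psi(D).

   Dieudonne's inequality, and the holomorphy of f', rest on Cauchy's formula. Its usual
   proof needs Goursat's theorem for a function with an exceptional point; here the
   formula is first proved for a primitive F of f, whose slope at any point is
   differentiable everywhere, and the smoothness of F gives that of f. *)

(** * Complex differentiation *)

(** The centre sqrt 2 is chosen because psi(-1) = 2 sqrt 2 - 2 and psi(1) = 2 lie at the same
    distance 2 - sqrt 2 from it, so the disc is the largest one about sqrt 2 inside psi(D), and its
    boundary contains the point psi(-1) at which the extremal functions leave psi(D). For the
    exponential and for sqrt(1+z), the sharp bound of |z w' L(w)| is attained by w(z) = z at
    negative z; there a disc about 1 with psi(-1) on its boundary would already do. For the crescent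
    function this fails: |L(z)| = 1/|sqrt(1+z^2)| is larger near the imaginary axis than on the real
    one, and moduli measured from 1 would lose the sharp constant. The disc about sqrt 2 contains
    the one about 1, is tangent to it at psi(-1), and leaves the room for this excess. The radii
    themselves are questions about the values of z f'/f alone: f(rz)/r lies in the class exactly
    when z f'/f maps |z| < r into psi(D). This is why an exact description of psi(D) is wanted, and
    why a largest radius exists for each f. *)

Notation is_Cderive f z l :=
  (is_derive (K := C_AbsRing) (V := C_NormedModule) f (z : C) (l : C)).
Notation Ccont := (continuous (U := C_UniformSpace)).

(** C carries two uniform structures: the product one, whose balls are squares, and that of the
    modulus. [locally_C] identifies their neighbourhoods, and from here on only the modulus is
    used. *)
Lemma Ccont_iff {U : UniformSpace} (f : U -> C) (x : U) :
  Ccont f x <->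
  forall eps : R, (0 < eps)%R -> locally x (fun y => (Cmod (f y - f x) < eps)%R).
Proof.
split.
- intros H eps He.
  apply (H (fun w => (Cmod (w - f x) < eps)%R)).
  apply (proj2 (locally_C (f x) _)).
  exists (mkposreal eps He). intros y Hy. exact Hy.
- intros H P HP.
  destruct (proj1 (locally_C (f x) P) HP) as [e He].
  unfold filtermap. generalize (H e (cond_pos e)). apply filter_imp.
  intros y Hy. apply He. exact Hy.
Qed.

Lemma locally_Cmod (z : C) (P : C -> Prop) :
  locally (T := C_UniformSpace) z P <->
  exists d : R, (0 < d)%R /\ forall y : C, (Cmod (y - z) < d)%R -> P y.
Proof.
split.
- intros H. destruct (proj1 (locally_C z P) H) as [d Hd].
  exists d. split; [apply cond_pos | exact Hd].
- intros [d [H0 Hd]]. apply (proj2 (locally_C z P)). now exists (mkposreal d H0).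
Qed.

(** Caratheodory's form of the derivative, as the value of a slope function continuous at [z]. It
    turns the product and chain rules into algebra of slopes. *)
Lemma is_Cderive_slope (f : C -> C) (z l : C) :
  is_Cderive f z l <->
  exists phi : C -> C, Ccont phi z /\ phi z = l /\
    forall y, f y = f z + (y - z) * phi y.
Proof.
split.
- intros [_ H].
  assert (Hz : is_filter_lim (locally (T := AbsRing_UniformSpace C_AbsRing) z) z)
    by (intros P HP; exact HP).
  specialize (H z Hz).
  exists (fun y => if Ceq_dec y z then l else (f y - f z) / (y - z)).
  assert (E : (if Ceq_dec z z then l else (f z - f z) / (z - z)) = l)
    by (destruct (Ceq_dec z z); [reflexivity | congruence]).
  split; [| split].
  + apply Ccont_iff. intros eps He. rewrite E.
    (* Halving [eps] turns the non-strict bound of the differential into a strict one. *)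
    assert (He2 : (0 < eps / 2)%R) by lra.
    specialize (H (mkposreal _ He2)).
    apply (proj2 (locally_C z _)). revert H. apply filter_imp.
    intros y Hy. destruct (Ceq_dec y z) as [-> | Hn].
    * replace (l - l) with (RtoC 0) by ring. now rewrite Cmod_0.
    * assert (Hyz : y - z <> 0) by (now apply Cminus_eq_contra).
      replace ((f y - f z) / (y - z) - l) with ((f y - f z - (y - z) * l) / (y - z))
        by (field; exact Hyz).
      rewrite Cmod_div by exact Hyz.
      assert (P := proj1 (Cmod_gt_0 _) Hyz).
      apply Rmult_lt_reg_r with (Cmod (y - z)); [exact P |].
      unfold Rdiv. rewrite Rmult_assoc, Rinv_l, Rmult_1_r by lra.
      change (Cmod (f y - f z - (y - z) * l) <= eps / 2 * Cmod (y - z))%R in Hy.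
      nra.
  + exact E.
  + intros y. destruct (Ceq_dec y z) as [-> | Hn].
    * ring.
    * field. now apply Cminus_eq_contra.
- intros [phi [Hc [Hz Hf]]]. split.
  + apply is_linear_scal_l.
  + intros x Hx.
    assert (x = z) as ->.
    { symmetry. apply (is_filter_lim_locally_unique (K := C_AbsRing)
        (V := AbsRing_NormedModule C_AbsRing)). exact Hx. }
    intros eps.
    apply (proj1 (locally_C z _)).
    generalize (proj1 (Ccont_iff phi z) Hc eps (cond_pos eps)).
    apply filter_imp. intros y Hy.
    change (Cmod (f y - f z - (y - z) * l) <= eps * Cmod (y - z))%R.
    rewrite Hf, <- Hz.
    replace (f z + (y - z) * phi y - f z - (y - z) * phi z)
      with ((phi y - phi z) * (y - z)) by ring.
    rewrite Cmod_mult. apply Rmult_le_compat_r; [apply Cmod_ge_0 | lra].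
Qed.

Lemma Ccont_const {U : UniformSpace} (c : C) (x : U) : Ccont (fun _ : U => c) x.
Proof. apply continuous_const. Qed.

Lemma Ccont_plus {U : UniformSpace} (f g : U -> C) (x : U) :
  Ccont f x -> Ccont g x -> Ccont (fun y => f y + g y) x.
Proof. exact (continuous_plus (V := C_R_NormedModule) f g x). Qed.

Lemma Ccont_mult {U : UniformSpace} (f g : U -> C) (x : U) :
  Ccont f x -> Ccont g x -> Ccont (fun y => f y * g y) x.
Proof.
intros Hf Hg P HP.
apply (continuous_mult (K := C_AbsRing) f g x).
- intros Q HQ. apply Hf. now apply (proj2 (locally_C _ _)).
- intros Q HQ. apply Hg. now apply (proj2 (locally_C _ _)).
- now apply (proj1 (locally_C _ _)).
Qed.

Lemma Ccont_inv {U : UniformSpace} (f : U -> C) (x : U) :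
  f x <> 0 -> Ccont f x -> Ccont (fun y => / f y) x.
Proof.
intros H0 Hf. apply Ccont_iff. intros eps He.
assert (P := proj1 (Cmod_gt_0 _) H0).
set (m := Cmod (f x)) in *.
assert (Hd : (0 < Rmin (m / 2) (eps * m * m / 2))%R)
  by (apply Rmin_pos; [lra | assert (Q := Rmult_lt_0_compat _ _ He (Rmult_lt_0_compat _ _ P P)); lra]).
generalize (proj1 (Ccont_iff f x) Hf _ Hd). apply filter_imp. intros y Hy.
assert (Hy1 := Rlt_le_trans _ _ _ Hy (Rmin_l _ _)).
assert (Hy2 := Rlt_le_trans _ _ _ Hy (Rmin_r _ _)).
assert (Hm : (m / 2 < Cmod (f y))%R).
{ assert (T := Cmod_triangle (f y) (f x - f y)).
  replace (f y + (f x - f y)) with (f x) in T by ring. fold m in T.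
  replace (f x - f y) with (- (f y - f x)) in T by ring. rewrite Cmod_opp in T. lra. }
assert (Hn : f y <> 0) by (apply Cmod_gt_0; lra).
replace (/ f y - / f x) with (- ((f y - f x) / (f x * f y))) by (field; now split).
rewrite Cmod_opp, Cmod_div, Cmod_mult by (now apply Cmult_neq_0). fold m.
set (a := Cmod (f y)) in *.
assert (Q : (0 < m * a)%R) by (apply Rmult_lt_0_compat; lra).
apply Rmult_lt_reg_r with (m * a)%R; [exact Q |].
unfold Rdiv. rewrite Rmult_assoc, Rinv_l, Rmult_1_r by lra.
apply (Rlt_trans _ _ _ Hy2).
assert (Q2 := Rmult_lt_0_compat _ _ He (Rmult_lt_0_compat m (a - m / 2) P ltac:(lra))). lra.
Qed.

Lemma Ccont_comp {U : UniformSpace} (f : U -> C) (g : C -> C) (x : U) :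
  Ccont f x -> Ccont (g : C_UniformSpace -> C) (f x) -> Ccont (fun y => g (f y)) x.
Proof. intros Hf Hg. exact (continuous_comp f g x Hf Hg). Qed.

Lemma is_Cderive_cont (f : C -> C) (z l : C) : is_Cderive f z l -> Ccont f z.
Proof.
intros H. apply is_Cderive_slope in H. destruct H as [phi [Hc [_ Hf]]].
apply (continuous_ext (fun y => f z + (y + - z) * phi y)).
{ intros y. symmetry. apply Hf. }
apply Ccont_plus; [apply Ccont_const |].
apply Ccont_mult; [| exact Hc].
apply Ccont_plus; [apply continuous_id | apply Ccont_const].
Qed.

Lemma is_Cderive_const (c z : C) : is_Cderive (fun _ => c) z 0.
Proof. apply (is_derive_const (K := C_AbsRing) (V := C_NormedModule)). Qed.

Lemma is_Cderive_id (z : C) : is_Cderive (fun y => y) z 1.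
Proof.
apply is_Cderive_slope. exists (fun _ => RtoC 1). repeat split.
- apply Ccont_const.
- intros; ring.
Qed.

Lemma is_Cderive_plus (f g : C -> C) (z l m : C) :
  is_Cderive f z l -> is_Cderive g z m -> is_Cderive (fun y => f y + g y) z (l + m).
Proof. apply (is_derive_plus (K := C_AbsRing) (V := C_NormedModule)). Qed.

Lemma is_Cderive_mult (f g : C -> C) (z l m : C) :
  is_Cderive f z l -> is_Cderive g z m ->
  is_Cderive (fun y => f y * g y) z (l * g z + f z * m).
Proof.
intros Hf Hg. assert (Cg := is_Cderive_cont _ _ _ Hg).
apply is_Cderive_slope in Hf; destruct Hf as [u [Hu [Hul Ef]]].
apply is_Cderive_slope in Hg; destruct Hg as [v [Hv [Hvm Eg]]].
apply is_Cderive_slope.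
exists (fun y => u y * g y + f z * v y). split; [| split].
- apply Ccont_plus; apply Ccont_mult; auto; apply Ccont_const.
- now rewrite Hul, Hvm.
- intros y. rewrite Ef, (Eg y). ring.
Qed.

Lemma is_Cderive_inv (f : C -> C) (z l : C) :
  f z <> 0 -> is_Cderive f z l -> is_Cderive (fun y => / f y) z (- l / (f z * f z)).
Proof.
intros H0 Hf. assert (Cf := is_Cderive_cont _ _ _ Hf).
apply is_Cderive_slope in Hf; destruct Hf as [u [Hu [Hul Ef]]].
apply is_Cderive_slope.
(* On the zeros of [f], where the slope formula fails, the slope is corrected by hand. *)
exists (fun y => if Ceq_dec (f y) 0 then (/ f y - / f z) / (y - z)
                 else - u y / (f y * f z)). split; [| split].
- assert (N : locally (T := C_UniformSpace) z (fun y => f y <> 0)).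
  { assert (P := proj1 (Cmod_gt_0 _) H0).
    generalize (proj1 (Ccont_iff f z) Cf _ P). apply filter_imp.
    intros y Hy E. rewrite E in Hy.
    replace (0 - f z) with (- f z) in Hy by ring. rewrite Cmod_opp in Hy. lra. }
  apply (continuous_ext_loc _ (fun y : C_UniformSpace => - u y / (f y * f z))).
  { revert N. apply filter_imp. intros y Hy.
    destruct (Ceq_dec (f y) 0); [contradiction | reflexivity]. }
  apply Ccont_mult.
  + apply (continuous_opp (V := C_R_NormedModule)); exact Hu.
  + apply Ccont_inv; [now apply Cmult_neq_0 |].
    apply Ccont_mult; [exact Cf | apply Ccont_const].
- destruct (Ceq_dec (f z) 0); [contradiction | now rewrite Hul].
- intros y. destruct (Ceq_dec (f y) 0) as [E | E].
  + assert (y - z <> 0) by (apply Cminus_eq_contra; congruence).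
    rewrite (Cmult_comm (y - z)). unfold Cdiv. rewrite <- Cmult_assoc, Cinv_l by assumption. ring.
  + assert (Q : f y - f z = (y - z) * u y) by (rewrite Ef; ring).
    replace (/ f y) with (/ f z - (f y - f z) / (f y * f z)) at 1 by (field; now split).
    rewrite Q. field. now split.
Qed.

Lemma is_Cderive_comp (f g : C -> C) (z l m : C) :
  is_Cderive f z l -> is_Cderive g (f z) m -> is_Cderive (fun y => g (f y)) z (l * m).
Proof.
intros Hf Hg. assert (Cf := is_Cderive_cont _ _ _ Hf).
apply is_Cderive_slope in Hf; destruct Hf as [u [Hu [Hul Ef]]].
apply is_Cderive_slope in Hg; destruct Hg as [v [Hv [Hvm Eg]]].
apply is_Cderive_slope.
exists (fun y => u y * v (f y)). split; [| split].
- apply Ccont_mult; [exact Hu |]. now apply Ccont_comp.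
- now rewrite Hul, Hvm.
- intros y. rewrite (Eg (f y)).
  replace (f y - f z) with ((y - z) * u y) by (rewrite Ef; ring). ring.
Qed.

Lemma is_Cderive_ext_loc (f g : C -> C) (z l : C) (r : R) :
  (0 < r)%R -> (forall y, (Cmod (y - z) < r)%R -> f y = g y) ->
  is_Cderive f z l -> is_Cderive g z l.
Proof.
intros Hr H. apply is_derive_ext_loc.
exists (mkposreal r Hr). intros y Hy. apply H. exact Hy.
Qed.

(** The differentiation rules fix the derivative as an existential variable; this brings it to the
    desired form afterwards. *)
Lemma is_Cderive_eq (f : C -> C) (z l m : C) :
  is_Cderive f z l -> l = m -> is_Cderive f z m.
Proof. now intros H <-. Qed.

(* Coquelicot's rules leave equations in structure types that unfold to [C], which [ring]
   does not recognize. *)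
Ltac Cring := match goal with |- @eq _ ?a ?b => change (@eq C a b); cbv beta; ring end.
Ltac Cfield := match goal with |- @eq _ ?a ?b => change (@eq C a b); cbv beta; field end.

Lemma is_Cderive_eps (f : C -> C) (z l : C) :
  (forall eps, (0 < eps)%R -> exists d, (0 < d)%R /\ forall y, (Cmod (y - z) < d)%R ->
    (Cmod (f y - f z - (y - z) * l) <= eps * Cmod (y - z))%R) ->
  is_Cderive f z l.
Proof.
intros H. split; [apply is_linear_scal_l |].
intros x Hx.
assert (x = z) as ->.
{ symmetry. apply (is_filter_lim_locally_unique (K := C_AbsRing)
    (V := AbsRing_NormedModule C_AbsRing)). exact Hx. }
intros eps. destruct (H eps (cond_pos eps)) as [d [Hd0 Hd]].
apply (proj1 (locally_C z _)). apply locally_Cmod.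
exists d. split; [exact Hd0 | exact Hd].
Qed.

(** A second-order bound replaces the choice of [d] for each [eps]; the square root and the Cauchy
    integrals both come with one. *)
Lemma is_Cderive_quadratic (f : C -> C) (z l : C) (K d : R) :
  (0 < d)%R ->
  (forall y, (Cmod (y - z) < d)%R ->
    (Cmod (f y - f z - (y - z) * l) <= K * (Cmod (y - z) * Cmod (y - z)))%R) ->
  is_Cderive f z l.
Proof.
intros Hd H. apply is_Cderive_eps. intros eps He.
assert (Q : (0 < eps / (Rabs K + 1))%R).
{ apply Rdiv_lt_0_compat; [exact He |]. assert (P := Rabs_pos K). lra. }
exists (Rmin d (eps / (Rabs K + 1))). split; [now apply Rmin_pos |].
intros y Hy.
assert (Hy1 := Rlt_le_trans _ _ _ Hy (Rmin_l _ _)).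
assert (Hy2 := Rlt_le_trans _ _ _ Hy (Rmin_r _ _)).
apply (Rle_trans _ _ _ (H y Hy1)).
rewrite <- Rmult_assoc. assert (P := Cmod_ge_0 (y - z)).
apply Rmult_le_compat_r; [exact P |].
assert (P' := Rabs_pos K). assert (P'' := Rle_abs K).
apply (Rmult_lt_compat_r (Rabs K + 1)) in Hy2; [| lra].
unfold Rdiv in Hy2. rewrite Rmult_assoc, Rinv_l, Rmult_1_r in Hy2 by lra.
nra.
Qed.

Lemma is_Cderive_minus (f g : C -> C) (z l m : C) :
  is_Cderive f z l -> is_Cderive g z m -> is_Cderive (fun y => f y - g y) z (l - m).
Proof. apply (is_derive_minus (K := C_AbsRing) (V := C_NormedModule)). Qed.

(** * Integrals along segments *)

Notation is_CInt f a b l :=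
  (is_RInt (V := C_R_NormedModule) (f : R -> C) (a : R) (b : R) (l : C)).
Notation CInt := (RInt (V := C_R_CompleteNormedModule)).
Notation is_Rderive g t l :=
  (is_derive (K := R_AbsRing) (V := C_R_NormedModule) (g : R -> C) (t : R) (l : C)).

Lemma scal_RtoC (r : R) (z : C) : scal (V := C_R_NormedModule) r z = RtoC r * z.
Proof.
destruct z as [x y]. unfold scal; cbn. unfold prod_scal, Cmult, scal; cbn.
unfold mult; cbn. f_equal; ring.
Qed.

(** The same criterion for curves, with C as a normed space over R. Both kinds of derivative become
    slopes in C, and the mixed chain rule [is_Rderive_comp] multiplies them. *)
Lemma is_Rderive_slope (g : R -> C) (t : R) (l : C) :
  is_Rderive g t l <->
  exists phi : R -> C, Ccont phi t /\ phi t = l /\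
    forall s, g s = g t + RtoC (s - t) * phi s.
Proof.
split.
- intros [_ H].
  assert (Ht : is_filter_lim (locally t) t) by (intros P HP; exact HP).
  specialize (H t Ht).
  exists (fun s => if Req_EM_T s t then l else (g s - g t) / RtoC (s - t)).
  assert (E : (if Req_EM_T t t then l else (g t - g t) / RtoC (t - t)) = l)
    by (destruct (Req_EM_T t t); [reflexivity | congruence]).
  split; [| split].
  + apply Ccont_iff. intros eps He. rewrite E.
    assert (He2 : (0 < eps / 2)%R) by lra.
    specialize (H (mkposreal _ He2)).
    revert H. apply filter_imp.
    intros s Hs. destruct (Req_EM_T s t) as [-> | Hn].
    * replace (l - l) with (RtoC 0) by ring. now rewrite Cmod_0.
    * assert (Hst : (s - t <> 0)%R) by lra.
      assert (Hst' : RtoC (s - t) <> 0) by (intros Q; apply Hst; now injection Q).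
      replace ((g s - g t) / RtoC (s - t) - l)
        with ((g s - g t - RtoC (s - t) * l) / RtoC (s - t))
        by (field; exact Hst').
      rewrite Cmod_div, Cmod_R by exact Hst'.
      assert (P := Rabs_pos_lt _ Hst).
      apply Rmult_lt_reg_r with (Rabs (s - t)); [exact P |].
      unfold Rdiv. rewrite Rmult_assoc, Rinv_l, Rmult_1_r by lra.
      rewrite <- Cmod_norm in Hs.
      change (Cmod (g s - g t - scal (V := C_R_NormedModule) (s - t)%R l)
        <= eps / 2 * Rabs (s - t))%R in Hs.
      rewrite scal_RtoC in Hs. nra.
  + exact E.
  + intros s. destruct (Req_EM_T s t) as [-> | Hn].
    * replace (t - t)%R with 0%R by ring. ring.
    * field. intros Q. apply Hn. injection Q. lra.
- intros [phi [Hc [Ht Hf]]]. split.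
  + apply is_linear_scal_l.
  + intros x Hx.
    assert (x = t) as ->.
    { symmetry. apply (is_filter_lim_locally_unique (K := R_AbsRing)
        (V := R_NormedModule)). exact Hx. }
    intros eps.
    generalize (proj1 (Ccont_iff phi t) Hc eps (cond_pos eps)).
    apply filter_imp. intros s Hs. rewrite <- Cmod_norm.
    change (Cmod (g s - g t - scal (V := C_R_NormedModule) (s - t)%R l)
      <= eps * Rabs (s - t))%R.
    rewrite scal_RtoC, Hf, <- Ht.
    replace (g t + RtoC (s - t) * phi s - g t - RtoC (s - t) * phi t)
      with ((phi s - phi t) * RtoC (s - t)) by ring.
    rewrite Cmod_mult, Cmod_R. apply Rmult_le_compat_r; [apply Rabs_pos | lra].
Qed.

Lemma is_Rderive_comp (g : R -> C) (F : C -> C) (t : R) (l m : C) :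
  is_Rderive g t l -> is_Cderive F (g t) m -> is_Rderive (fun s => F (g s)) t (m * l).
Proof.
intros Hg HF.
assert (Cg : Ccont g t) by (apply (ex_derive_continuous (V := C_R_NormedModule)); now exists l).
apply is_Rderive_slope in Hg; destruct Hg as [u [Hu [Hul Eg]]].
apply is_Cderive_slope in HF; destruct HF as [v [Hv [Hvm EF]]].
apply is_Rderive_slope.
exists (fun s => v (g s) * u s). split; [| split].
- apply Ccont_mult; [| exact Hu]. now apply Ccont_comp.
- now rewrite Hul, Hvm.
- intros s. rewrite (EF (g s)).
  replace (g s - g t) with (RtoC (s - t) * u s) by (rewrite Eg; ring). ring.
Qed.

Lemma is_CInt_unique (f : R -> C) (a b : R) (l : C) : is_CInt f a b l -> CInt f a b = l.
Proof. apply (is_RInt_unique (V := C_R_CompleteNormedModule)). Qed.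

Lemma is_CInt_ext (f g : R -> C) (a b : R) (l : C) :
  (forall t, f t = g t) -> is_CInt f a b l -> is_CInt g a b l.
Proof. intros H. apply is_RInt_ext. intros t _. apply H. Qed.

Lemma is_CInt_cont (f : R -> C) (a b : R) :
  (forall t, (Rmin a b <= t <= Rmax a b)%R -> Ccont f t) -> is_CInt f a b (CInt f a b).
Proof.
intros H. apply (RInt_correct (V := C_R_CompleteNormedModule)).
now apply (ex_RInt_continuous (V := C_R_CompleteNormedModule)).
Qed.

(** A complex constant is no scalar of the real normed space C, so real and imaginary parts are
    integrated separately. *)
Lemma is_CInt_mult_l (c : C) (f : R -> C) (a b : R) (l : C) :
  is_CInt f a b l -> is_CInt (fun t => c * f t) a b (c * l).
Proof.
intros H.
assert (H1 := is_RInt_fct_extend_fst (U := R_NormedModule) (V := R_NormedModule) _ _ _ _ H).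
assert (H2 := is_RInt_fct_extend_snd (U := R_NormedModule) (V := R_NormedModule) _ _ _ _ H).
destruct c as [c1 c2], l as [l1 l2].
apply (is_RInt_fct_extend_pair (U := R_NormedModule) (V := R_NormedModule)).
- exact (is_RInt_minus (V := R_NormedModule) _ _ _ _ _ _ (is_RInt_scal _ _ _ c1 _ H1) (is_RInt_scal _ _ _ c2 _ H2)).
- exact (is_RInt_plus (V := R_NormedModule) _ _ _ _ _ _ (is_RInt_scal _ _ _ c1 _ H2) (is_RInt_scal _ _ _ c2 _ H1)).
Qed.

Lemma is_CInt_plus (f g : R -> C) (a b : R) (l m : C) :
  is_CInt f a b l -> is_CInt g a b m -> is_CInt (fun t => f t + g t) a b (l + m).
Proof. apply (is_RInt_plus (V := C_R_NormedModule)). Qed.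

Lemma is_CInt_minus (f g : R -> C) (a b : R) (l m : C) :
  is_CInt f a b l -> is_CInt g a b m -> is_CInt (fun t => f t - g t) a b (l - m).
Proof. apply (is_RInt_minus (V := C_R_NormedModule)). Qed.

Lemma is_CInt_const (c : C) (a b : R) : is_CInt (fun _ => c) a b (RtoC (b - a) * c).
Proof. rewrite <- scal_RtoC. apply (is_RInt_const (V := C_R_NormedModule)). Qed.

Lemma Cmod_is_CInt_le (f : R -> C) (a b : R) (l : C) (M : R) :
  (a <= b)%R -> (forall t, (a <= t <= b)%R -> (Cmod (f t) <= M)%R) ->
  is_CInt f a b l -> (Cmod l <= (b - a) * M)%R.
Proof.
intros Hab H Hl. rewrite Cmod_norm.
apply (norm_RInt_le_const (V := C_R_NormedModule) f a b l M Hab); [| exact Hl].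
intros t Ht. rewrite <- Cmod_norm. now apply H.
Qed.

Lemma is_CInt_curve (F f : C -> C) (g g' : R -> C) (a b : R) :
  (a <= b)%R ->
  (forall t, (a <= t <= b)%R -> is_Rderive g t (g' t)) ->
  (forall t, (a <= t <= b)%R -> Ccont g' t) ->
  (forall t, (a <= t <= b)%R -> is_Cderive F (g t) (f (g t))) ->
  (forall t, (a <= t <= b)%R -> Ccont f (g t)) ->
  is_CInt (fun t => f (g t) * g' t) a b (F (g b) - F (g a)).
Proof.
intros Hab Hg Hg' HF Hf.
apply (is_RInt_derive (V := C_R_CompleteNormedModule) (fun t => F (g t)) (fun t => f (g t) * g' t));
  rewrite Rmin_left, Rmax_right by exact Hab; intros t Ht.
- apply is_Rderive_comp; auto.
- apply Ccont_mult; [| now apply Hg'].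
  apply Ccont_comp; [| now apply Hf].
  apply (ex_derive_continuous (V := C_R_NormedModule)). exists (g' t). now apply Hg.
Qed.

Definition segment (a b : C) (t : R) : C := a + RtoC t * (b - a).

Definition seg_int (f : C -> C) (a b : C) : C :=
  (b - a) * CInt (fun t => f (segment a b t)) 0 1.

(** [analytic] unfolds to [holo 1]. Other radii serve [circle_int_kernel], whose integrand is
    holomorphic beyond the closed unit disc. *)
Definition holo (r : R) (f : C -> C) : Prop :=
  forall z, (Cmod z < r)%R -> exists l, is_Cderive f z l.

Lemma is_Rderive_segment (a b : C) (t : R) : is_Rderive (segment a b) t (b - a).
Proof.
apply is_Rderive_slope. exists (fun _ => b - a). repeat split.
- apply Ccont_const.
- intros s. unfold segment. rewrite RtoC_minus. ring.
Qed.

Lemma Ccont_segment (a b : C) (t : R) : Ccont (segment a b) t.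
Proof.
apply (ex_derive_continuous (V := C_R_NormedModule)).
exists (b - a). apply is_Rderive_segment.
Qed.

Lemma Cmod_segment_le (a b c : C) (t M : R) :
  (0 <= t <= 1)%R -> (Cmod (a - c) <= M)%R -> (Cmod (b - c) <= M)%R ->
  (Cmod (segment a b t - c) <= M)%R.
Proof.
intros Ht Ha Hb.
replace (segment a b t - c) with (RtoC (1 - t) * (a - c) + RtoC t * (b - c))
  by (unfold segment; rewrite RtoC_minus; ring).
apply (Rle_trans _ _ _ (Cmod_triangle _ _)).
rewrite !Cmod_mult, !Cmod_R, !Rabs_pos_eq by lra. nra.
Qed.

Lemma Cmod_segment_lt (a b : C) (t M : R) :
  (0 <= t <= 1)%R -> (Cmod a < M)%R -> (Cmod b < M)%R -> (Cmod (segment a b t) < M)%R.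
Proof.
intros Ht Ha Hb.
apply Rle_lt_trans with (Rmax (Cmod a) (Cmod b)); [| now apply Rmax_lub_lt].
replace (segment a b t) with (segment a b t - 0) by ring.
apply Cmod_segment_le; [exact Ht | |];
  [replace (a - 0) with a by ring; apply Rmax_l | replace (b - 0) with b by ring; apply Rmax_r].
Qed.

Lemma holo_cont (r : R) (f : C -> C) (z : C) :
  holo r f -> (Cmod z < r)%R -> Ccont f z.
Proof. intros H Hz. destruct (H z Hz) as [l Hl]. exact (is_Cderive_cont _ _ _ Hl). Qed.

Lemma Ccont_on_segment (r : R) (f : C -> C) (a b : C) (t : R) :
  (forall z, (Cmod z < r)%R -> Ccont f z) -> (Cmod a < r)%R -> (Cmod b < r)%R ->
  (0 <= t <= 1)%R -> Ccont (fun s => f (segment a b s)) t.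
Proof.
intros Hf Ha Hb Ht. apply Ccont_comp; [apply Ccont_segment |].
apply Hf. now apply Cmod_segment_lt.
Qed.

Lemma is_CInt_segment (r : R) (f : C -> C) (a b : C) :
  (forall z, (Cmod z < r)%R -> Ccont f z) -> (Cmod a < r)%R -> (Cmod b < r)%R ->
  is_CInt (fun t => f (segment a b t) * (b - a)) 0 1 (seg_int f a b).
Proof.
intros Hf Ha Hb. unfold seg_int.
apply (is_CInt_ext (fun t => (b - a) * f (segment a b t))).
{ intros; apply Cmult_comm. }
apply is_CInt_mult_l. apply is_CInt_cont.
rewrite Rmin_left, Rmax_right by lra. intros t Ht. now apply (Ccont_on_segment r).
Qed.

Lemma seg_int_unique (r : R) (f : C -> C) (a b l : C) :
  (forall z, (Cmod z < r)%R -> Ccont f z) -> (Cmod a < r)%R -> (Cmod b < r)%R ->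
  is_CInt (fun t => f (segment a b t) * (b - a)) 0 1 l -> seg_int f a b = l.
Proof.
intros Hf Ha Hb Hl.
rewrite <- (is_CInt_unique _ _ _ _ Hl). symmetry.
apply is_CInt_unique. now apply (is_CInt_segment r).
Qed.

Lemma seg_int_primitive (r : R) (F f : C -> C) (a b : C) :
  (forall z, (Cmod z < r)%R -> Ccont f z) ->
  (forall z, (Cmod z < r)%R -> is_Cderive F z (f z)) ->
  (Cmod a < r)%R -> (Cmod b < r)%R ->
  seg_int f a b = F b - F a.
Proof.
intros Hf HF Ha Hb. apply (seg_int_unique r); auto.
replace (F b - F a) with (F (segment a b 1) - F (segment a b 0)).
2: { unfold segment. f_equal; [f_equal | do 2 f_equal]; ring. }
apply (is_CInt_curve F f (segment a b) (fun _ => b - a)); intros; try lra.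
- apply is_Rderive_segment.
- apply Ccont_const.
- apply HF. now apply Cmod_segment_lt.
- apply Hf. now apply Cmod_segment_lt.
Qed.

Lemma seg_int_rev (r : R) (f : C -> C) (a b : C) :
  (forall z, (Cmod z < r)%R -> Ccont f z) -> (Cmod a < r)%R -> (Cmod b < r)%R ->
  seg_int f b a = - seg_int f a b.
Proof.
assert (Em1 : RtoC (-1) = - (1)) by apply (RtoC_opp 1).
intros Hf Ha Hb. apply (seg_int_unique r); auto.
assert (H := is_CInt_segment r f a b Hf Ha Hb).
apply (is_RInt_swap (V := C_R_NormedModule)) in H.
(* The substitution t -> 1 - t; the endpoints must literally have this affine form. *)
replace 1%R with (-1 * 0 + 1)%R in H at 1 by ring.
replace 0%R with (-1 * 1 + 1)%R in H at 2 by ring.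
apply (is_RInt_comp_lin (V := C_R_NormedModule)) in H.
apply is_CInt_ext with (2 := H).
intros t. rewrite scal_RtoC, Em1.
replace (segment a b (-1 * t + 1)) with (segment b a t); [ring |].
unfold segment. rewrite RtoC_plus, RtoC_mult, Em1. ring.
Qed.

(** Midpoints suffice for the bisection of triangles. The substitutions t -> 2 t and t -> 2 t - 1
    reparametrize the two halves. *)
Lemma seg_int_Chasles_mid (r : R) (f : C -> C) (a b : C) :
  (forall z, (Cmod z < r)%R -> Ccont f z) -> (Cmod a < r)%R -> (Cmod b < r)%R ->
  seg_int f a b = seg_int f a ((a + b) / 2) + seg_int f ((a + b) / 2) b.
Proof.
intros Hf Ha Hb.
assert (Em1 : RtoC (-1) = - (1)) by apply (RtoC_opp 1).
assert (Em : (a + b) / 2 = segment a b (1 / 2)).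
{ unfold segment. rewrite RtoC_div by lra. field. }
assert (Hm : (Cmod ((a + b) / 2) < r)%R).
{ rewrite Em. apply Cmod_segment_lt; auto; lra. }
set (m := (a + b) / 2) in *.
assert (H1 := is_CInt_segment r f a m Hf Ha Hm).
assert (H2 := is_CInt_segment r f m b Hf Hm Hb).
apply (seg_int_unique r); auto.
apply (is_RInt_Chasles (V := C_R_NormedModule)) with (1 / 2)%R.
- replace 0%R with (2 * 0 + 0)%R in H1 by ring.
  replace 1%R with (2 * (1 / 2) + 0)%R in H1 by field.
  apply (is_RInt_comp_lin (V := C_R_NormedModule)) in H1.
  apply is_CInt_ext with (2 := H1).
  intros t. rewrite scal_RtoC.
  replace (segment a m (2 * t + 0)) with (segment a b t);
    [unfold m; field |].
  unfold segment, m. rewrite RtoC_plus, RtoC_mult. field.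
- replace 0%R with (2 * (1 / 2) + -1)%R in H2 by field.
  replace 1%R with (2 * 1 + -1)%R in H2 at 2 by ring.
  apply (is_RInt_comp_lin (V := C_R_NormedModule)) in H2.
  apply is_CInt_ext with (2 := H2).
  intros t. rewrite scal_RtoC.
  replace (segment m b (2 * t + -1)) with (segment a b t);
    [unfold m; field |].
  unfold segment, m. rewrite RtoC_plus, RtoC_mult, Em1. field.
Qed.

(** * Goursat's theorem *)

Lemma Cmod_seg_int_le (r : R) (f : C -> C) (a b : C) (M : R) :
  (forall z, (Cmod z < r)%R -> Ccont f z) -> (Cmod a < r)%R -> (Cmod b < r)%R ->
  (forall t, (0 <= t <= 1)%R -> (Cmod (f (segment a b t)) <= M)%R) ->
  (Cmod (seg_int f a b) <= M * Cmod (b - a))%R.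
Proof.
intros Hf Ha Hb HM.
replace (M * Cmod (b - a))%R with ((1 - 0) * (M * Cmod (b - a)))%R by ring.
apply (Cmod_is_CInt_le (fun t => f (segment a b t) * (b - a)) 0 1); [lra | |].
- intros t Ht. rewrite Cmod_mult.
  apply Rmult_le_compat_r; [apply Cmod_ge_0 | now apply HM].
- now apply (is_CInt_segment r).
Qed.

Lemma seg_int_minus (r : R) (f g : C -> C) (a b : C) :
  (forall z, (Cmod z < r)%R -> Ccont f z) -> (forall z, (Cmod z < r)%R -> Ccont g z) ->
  (Cmod a < r)%R -> (Cmod b < r)%R ->
  seg_int (fun z => f z - g z) a b = seg_int f a b - seg_int g a b.
Proof.
intros Hf Hg Ha Hb. apply (seg_int_unique r); auto.
- intros z Hz. apply (continuous_minus (V := C_R_NormedModule)); auto.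
- apply (is_CInt_ext (fun t => f (segment a b t) * (b - a) - g (segment a b t) * (b - a))).
  { intros t. ring. }
  apply is_CInt_minus; now apply (is_CInt_segment r).
Qed.

Definition tri_int (f : C -> C) (a b c : C) : C :=
  seg_int f a b + seg_int f b c + seg_int f c a.

Definition perimeter (a b c : C) : R := (Cmod (b - a) + Cmod (c - b) + Cmod (a - c))%R.

(** The edges of the medial triangle occur twice, in opposite directions. *)
Lemma tri_int_split (r : R) (f : C -> C) (a b c : C) :
  (forall z, (Cmod z < r)%R -> Ccont f z) ->
  (Cmod a < r)%R -> (Cmod b < r)%R -> (Cmod c < r)%R ->
  let x := (a + b) / 2 in let y := (b + c) / 2 in let z := (c + a) / 2 in
  tri_int f a b c = tri_int f a x z + tri_int f x b y + tri_int f z y c + tri_int f y z x.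
Proof.
intros Hf Ha Hb Hc x y z.
assert (M : forall u v, (Cmod u < r)%R -> (Cmod v < r)%R -> (Cmod ((u + v) / 2) < r)%R).
{ intros u v Hu Hv. replace ((u + v) / 2) with (segment u v (1 / 2)).
  - apply Cmod_segment_lt; auto; lra.
  - unfold segment. rewrite RtoC_div by lra. field. }
assert (Hx : (Cmod x < r)%R) by now apply M.
assert (Hy : (Cmod y < r)%R) by now apply M.
assert (Hz : (Cmod z < r)%R) by now apply M.
unfold tri_int.
rewrite (seg_int_Chasles_mid r f a b), (seg_int_Chasles_mid r f b c),
  (seg_int_Chasles_mid r f c a) by auto.
fold x y z.
rewrite (seg_int_rev r f z x), (seg_int_rev r f x y), (seg_int_rev r f y z) by auto.
ring.
Qed.

Lemma Cmod_half (z : C) : Cmod (z / 2) = (Cmod z / 2)%R.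
Proof.
rewrite Cmod_div by (intros Q; injection Q; lra).
now rewrite Cmod_R, Rabs_pos_eq by lra.
Qed.

(** One step of Goursat's bisection, as a total relation on triples, so that a choice function
    yields the whole sequence; this is why the hypotheses stand behind the existential quantifier.
    The clause on [p] and [M] keeps the new vertices in every closed disc that contains the old
    ones. *)
Lemma tri_int_step (r : R) (f : C -> C) (T : C * C * C) :
  exists T' : C * C * C,
  (forall z, (Cmod z < r)%R -> Ccont f z) ->
  let '(a, b, c) := T in let '(a', b', c') := T' in
  (Cmod a < r)%R -> (Cmod b < r)%R -> (Cmod c < r)%R ->
  (Cmod (tri_int f a b c) <= 4 * Cmod (tri_int f a' b' c'))%R /\
  perimeter a' b' c' = (perimeter a b c / 2)%R /\
  (forall p M, (Cmod (a - p) <= M -> Cmod (b - p) <= M -> Cmod (c - p) <= M ->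
     Cmod (a' - p) <= M /\ Cmod (b' - p) <= M /\ Cmod (c' - p) <= M)%R).
Proof.
destruct T as [[a b] c].
assert (Hh : forall u v p M, (Cmod (u - p) <= M -> Cmod (v - p) <= M ->
  Cmod ((u + v) / 2 - p) <= M)%R).
{ intros u v p M Hu Hv. replace ((u + v) / 2) with (segment u v (1 / 2)).
  - apply Cmod_segment_le; auto; lra.
  - unfold segment. rewrite RtoC_div by lra. field. }
pose (x := (a + b) / 2); pose (y := (b + c) / 2); pose (z := (c + a) / 2).
assert (K : forall a' b' c' : C,
   (a', b', c') = (a, x, z) \/ (a', b', c') = (x, b, y) \/
   (a', b', c') = (z, y, c) \/ (a', b', c') = (y, z, x) ->
  perimeter a' b' c' = (perimeter a b c / 2)%R /\
  (forall p M, (Cmod (a - p) <= M -> Cmod (b - p) <= M -> Cmod (c - p) <= M ->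
     Cmod (a' - p) <= M /\ Cmod (b' - p) <= M /\ Cmod (c' - p) <= M)%R)).
{ intros a' b' c' H. split.
  2: { intros p M H1 H2 H3.
    destruct H as [H | [H | [H | H]]]; injection H as -> -> ->; unfold x, y, z; auto. }
  unfold perimeter.
  assert (E : forall u v, Cmod (u - v) = Cmod (v - u)).
  { intros u v. rewrite <- Cmod_opp. f_equal. ring. }
  destruct H as [H | [H | [H | H]]]; injection H as -> -> ->; unfold x, y, z.
  - replace ((a + b) / 2 - a) with ((b - a) / 2) by field.
    replace ((c + a) / 2 - (a + b) / 2) with ((c - b) / 2) by field.
    replace (a - (c + a) / 2) with ((a - c) / 2) by field.
    rewrite !Cmod_half. field.
  - replace (b - (a + b) / 2) with ((b - a) / 2) by field.
    replace ((b + c) / 2 - b) with ((c - b) / 2) by field.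
    replace ((a + b) / 2 - (b + c) / 2) with ((a - c) / 2) by field.
    rewrite !Cmod_half. field.
  - replace ((b + c) / 2 - (c + a) / 2) with ((b - a) / 2) by field.
    replace (c - (b + c) / 2) with ((c - b) / 2) by field.
    replace ((c + a) / 2 - c) with ((a - c) / 2) by field.
    rewrite !Cmod_half. field.
  - replace ((c + a) / 2 - (b + c) / 2) with ((a - b) / 2) by field.
    replace ((a + b) / 2 - (c + a) / 2) with ((b - c) / 2) by field.
    replace ((b + c) / 2 - (a + b) / 2) with ((c - a) / 2) by field.
    rewrite !Cmod_half, (E a b), (E b c), (E c a). field. }
pose (t := Cmod (tri_int f a b c)).
destruct (Rle_dec t (4 * Cmod (tri_int f a x z))) as [H1 | H1].
{ exists (a, x, z). intros _ _ _ _. split; [exact H1 | apply K; auto]. }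
destruct (Rle_dec t (4 * Cmod (tri_int f x b y))) as [H2 | H2].
{ exists (x, b, y). intros _ _ _ _. split; [exact H2 | apply K; auto]. }
destruct (Rle_dec t (4 * Cmod (tri_int f z y c))) as [H3 | H3].
{ exists (z, y, c). intros _ _ _ _. split; [exact H3 | apply K; auto]. }
(* If no corner triangle carries a quarter of the integral, the medial one does. *)
exists (y, z, x). intros Hf Ha Hb Hc. split; [| apply K; auto].
assert (E := tri_int_split r f a b c Hf Ha Hb Hc). cbv zeta in E. fold x y z in E.
assert (Q : (t <= Cmod (tri_int f a x z) + Cmod (tri_int f x b y)
  + Cmod (tri_int f z y c) + Cmod (tri_int f y z x))%R).
{ unfold t. rewrite E.
  eapply Rle_trans; [apply Cmod_triangle |]. apply Rplus_le_compat_r.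
  eapply Rle_trans; [apply Cmod_triangle |]. apply Rplus_le_compat_r.
  apply Cmod_triangle. }
fold t. lra.
Qed.

(** Completeness of C with the rate that Goursat's theorem needs, the tail of a geometric series. *)
Lemma Cseq_geometric_limit (u : nat -> C) (K : R) :
  (forall n, (Cmod (u (S n) - u n) <= K * (1 / 2) ^ n)%R) ->
  exists p, forall n, (Cmod (u n - p) <= 2 * K * (1 / 2) ^ n)%R.
Proof.
intros Hu.
assert (K0 : (0 <= K)%R).
{ specialize (Hu 0%nat). simpl in Hu. assert (P := Cmod_ge_0 (u 1%nat - u 0%nat)). lra. }
assert (Hpow : forall n, (0 < (1 / 2) ^ n)%R) by (intros; apply pow_lt; lra).
(* A difference of two tails, unlike the plain bound [Dle], can be carried through the induction on
   [k]. *)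
assert (D : forall k n, (Cmod (u (n + k)%nat - u n) <= 2 * K * (1 / 2) ^ n - 2 * K * (1 / 2) ^ (n + k))%R).
{ induction k as [| k IH]; intros n.
  - rewrite Nat.add_0_r. replace (u n - u n) with (RtoC 0) by ring. rewrite Cmod_0. lra.
  - rewrite Nat.add_succ_r.
    replace (u (S (n + k)) - u n) with ((u (S (n + k)) - u (n + k)%nat) + (u (n + k)%nat - u n)) by ring.
    eapply Rle_trans; [apply Cmod_triangle |].
    specialize (IH n). specialize (Hu (n + k)%nat).
    replace ((1 / 2) ^ S (n + k))%R with (1 / 2 * (1 / 2) ^ (n + k))%R by reflexivity. lra. }
assert (Dle : forall k n, (Cmod (u (n + k)%nat - u n) <= 2 * K * (1 / 2) ^ n)%R).
{ intros k n. specialize (D k n). specialize (Hpow (n + k)%nat). nra. }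
assert (Small : forall eps, (0 < eps)%R -> exists N, (2 * K * (1 / 2) ^ N < eps)%R).
{ intros eps He.
  destruct (pow_lt_1_zero (1 / 2) ltac:(rewrite Rabs_pos_eq; lra) (eps / (2 * K + 1)))
    as [N HN]; [apply Rdiv_lt_0_compat; lra |].
  exists N. specialize (HN N (le_n N)). rewrite Rabs_pos_eq in HN by (left; apply Hpow).
  apply (Rmult_lt_compat_r (2 * K + 1)) in HN; [| lra].
  unfold Rdiv in HN at 2. rewrite Rmult_assoc, Rinv_l, Rmult_1_r in HN by lra.
  specialize (Hpow N). nra. }
assert (Cau : forall g : C -> R, (forall x y, Rabs (g x - g y) <= Cmod (x - y))%R ->
  exists l, is_lim_seq (fun n => g (u n)) (Finite l)).
{ intros g Hg.
  assert (E : ex_finite_lim_seq (fun n => g (u n))).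
  2: { destruct E as [l Hl]. now exists l. }
  apply ex_lim_seq_cauchy_corr. intros eps.
  destruct (Small (eps / 2)%R) as [N HN]; [destruct eps; simpl; lra |].
  exists N. intros n m Hn Hm.
  replace n with (N + (n - N))%nat by lia. replace m with (N + (m - N))%nat by lia.
  assert (H1 := Dle (n - N)%nat N). assert (H2 := Dle (m - N)%nat N).
  eapply Rle_lt_trans; [apply Hg |].
  replace (u (N + (n - N))%nat - u (N + (m - N))%nat)
    with ((u (N + (n - N))%nat - u N) + - (u (N + (m - N))%nat - u N)) by ring.
  eapply Rle_lt_trans; [apply Cmod_triangle |]. rewrite Cmod_opp. lra. }
destruct (Cau Re) as [x Hx].
{ intros z w. exact (re_le_Cmod (z - w)). }
destruct (Cau Im) as [y Hy].
{ intros z w. eapply Rle_trans; [| apply Rmax_Cmod]. apply Rmax_r. }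
exists (x, y). intros n.
apply Rnot_lt_le. intros Hc.
(* [e] is the supposed excess over the bound. Far along the sequence both coordinates are within e/4
   of the limit, so the modulus is within sqrt 2 e/4 < e, a contradiction. *)
set (e := (Cmod (u n - (x, y)) - 2 * K * (1 / 2) ^ n)%R) in *.
assert (He : (0 < e / 4)%R) by (unfold e; lra).
apply is_lim_seq_spec in Hx. apply is_lim_seq_spec in Hy.
destruct (Hx (mkposreal _ He)) as [N1 H1]. destruct (Hy (mkposreal _ He)) as [N2 H2].
set (k := (N1 + N2)%nat).
specialize (H1 (n + k)%nat ltac:(lia)). specialize (H2 (n + k)%nat ltac:(lia)). simpl in H1, H2.
specialize (Dle k n).
assert (T : (Cmod (u n - (x, y)) <= Cmod (u (n + k)%nat - u n) + Cmod (u (n + k)%nat - (x, y)))%R).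
{ rewrite <- (Cmod_opp (u (n + k)%nat - u n)).
  eapply Rle_trans; [| apply Cmod_triangle]. right. f_equal. ring. }
assert (B := Cmod_2Rmax (u (n + k)%nat - (x, y))).
assert (M : (Rmax (Rabs (fst (u (n + k)%nat - (x, y))%C)) (Rabs (snd (u (n + k)%nat - (x, y))%C)) < e / 4)%R).
{ apply Rmax_lub_lt; [exact H1 | exact H2]. }
assert (S2 : (0 <= sqrt 2 <= 2)%R).
{ split; [apply sqrt_pos |]. rewrite <- (sqrt_square 2) at 2 by lra. apply sqrt_le_1_alt. lra. }
assert (P0 : (0 <= Rmax (Rabs (fst (u (n + k)%nat - (x, y))%C)) (Rabs (snd (u (n + k)%nat - (x, y))%C)))%R).
{ eapply Rle_trans; [apply Rabs_pos | apply Rmax_l]. }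
unfold e in *. nra.
Qed.

Lemma perimeter_le (a b c : C) :
  (Cmod (a - a) <= perimeter a b c /\ Cmod (b - a) <= perimeter a b c /\
   Cmod (c - a) <= perimeter a b c)%R.
Proof.
unfold perimeter.
assert (H1 := Cmod_ge_0 (b - a)). assert (H2 := Cmod_ge_0 (c - b)). assert (H3 := Cmod_ge_0 (a - c)).
replace (a - a) with (RtoC 0) by ring. rewrite Cmod_0.
replace (c - a) with (- (a - c)) by ring. rewrite Cmod_opp. lra.
Qed.

Theorem goursat (r : R) (f : C -> C) (a b c : C) :
  holo r f -> (Cmod a < r)%R -> (Cmod b < r)%R -> (Cmod c < r)%R ->
  tri_int f a b c = 0.
Proof.
intros Hf Ha Hb Hc.
assert (Cf : forall z, (Cmod z < r)%R -> Ccont f z) by (intros; now apply (holo_cont r)).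
destruct (functional_choice _ (tri_int_step r f)) as [next Hnext].
pose (T := fun n => Nat.iter n next (a, b, c)).
pose (A n := fst (fst (T n))). pose (B n := snd (fst (T n))). pose (D n := snd (T n)).
(* All triangles stay in the closed disc of radius [M] < [r], so their limit point lies in the
   domain. *)
set (M := Rmax (Cmod a) (Rmax (Cmod b) (Cmod c))).
assert (HM : (M < r)%R) by (repeat apply Rmax_lub_lt; assumption).
set (P := perimeter a b c). set (t := Cmod (tri_int f a b c)).
assert (Inv : forall n,
  (Cmod (A n) <= M /\ Cmod (B n) <= M /\ Cmod (D n) <= M)%R /\
  perimeter (A n) (B n) (D n) = (P * (1 / 2) ^ n)%R /\
  (t * (1 / 4) ^ n <= Cmod (tri_int f (A n) (B n) (D n)))%R /\
  (Cmod (A (S n) - A n) <= P * (1 / 2) ^ n)%R).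
{ assert (Step : forall n,
    (Cmod (A n) < r)%R -> (Cmod (B n) < r)%R -> (Cmod (D n) < r)%R ->
    (Cmod (tri_int f (A n) (B n) (D n)) <= 4 * Cmod (tri_int f (A (S n)) (B (S n)) (D (S n))))%R /\
    perimeter (A (S n)) (B (S n)) (D (S n)) = (perimeter (A n) (B n) (D n) / 2)%R /\
    (forall p M, (Cmod (A n - p) <= M -> Cmod (B n - p) <= M -> Cmod (D n - p) <= M ->
     Cmod (A (S n) - p) <= M /\ Cmod (B (S n) - p) <= M /\ Cmod (D (S n) - p) <= M)%R)).
  { intros n. generalize (Hnext (T n) Cf).
    change (next (T n)) with (T (S n)). unfold A, B, D.
    destruct (T n) as [[a1 b1] c1]. destruct (T (S n)) as [[a2 b2] c2].
    intros H; exact H. }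
  assert (J : forall n,
    (Cmod (A n) <= M /\ Cmod (B n) <= M /\ Cmod (D n) <= M)%R /\
    perimeter (A n) (B n) (D n) = (P * (1 / 2) ^ n)%R /\
    (t * (1 / 4) ^ n <= Cmod (tri_int f (A n) (B n) (D n)))%R).
  { induction n as [| n [[I1 [I2 I3]] [I4 I5]]].
    - unfold A, B, D, T; simpl. split; [| split].
      + repeat split; unfold M; [apply Rmax_l | |];
          (eapply Rle_trans; [| apply Rmax_r]); [apply Rmax_l | apply Rmax_r].
      + fold P. ring.
      + fold t. lra.
    - destruct (Step n) as [S1 [S2 S3]]; try lra.
      split; [| split].
      + specialize (S3 0 M).
        assert (Z : forall w : C, w - 0 = w) by (intros; ring). rewrite !Z in S3. auto.
      + rewrite S2, I4. simpl. field.
      + simpl. lra. }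
  intros n. destruct (J n) as [[I1 [I2 I3]] [I4 I5]]. repeat split; auto.
  destruct (Step n) as [S1 [S2 S3]]; try lra.
  rewrite <- I4. apply S3; apply perimeter_le. }
destruct (Cseq_geometric_limit A P) as [p Hp]; [apply Inv |].
assert (P0 : (0 <= P)%R).
{ unfold P, perimeter. assert (H1 := Cmod_ge_0 (b - a)). assert (H2 := Cmod_ge_0 (c - b)).
  assert (H3 := Cmod_ge_0 (a - c)). lra. }
assert (Hpow : forall n, (0 < (1 / 2) ^ n)%R) by (intros; apply pow_lt; lra).
assert (Small : forall eps, (0 < eps)%R -> exists n, (3 * P * (1 / 2) ^ n < eps)%R).
{ intros eps He.
  destruct (pow_lt_1_zero (1 / 2) ltac:(rewrite Rabs_pos_eq; lra) (eps / (3 * P + 1)))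
    as [N HN]; [apply Rdiv_lt_0_compat; lra |].
  exists N. specialize (HN N (le_n N)). rewrite Rabs_pos_eq in HN by (left; apply Hpow).
  apply (Rmult_lt_compat_r (3 * P + 1)) in HN; [| lra].
  unfold Rdiv in HN at 2. rewrite Rmult_assoc, Rinv_l, Rmult_1_r in HN by lra.
  specialize (Hpow N). nra. }
assert (Hpr : (Cmod p < r)%R).
{ destruct (Small (r - M)%R) as [n Hn]; [lra |].
  destruct (Inv n) as [[I1 _] _].
  assert (H := Cmod_triangle (A n) (- (A n - p))).
  replace (A n + - (A n - p)) with p in H by ring. rewrite Cmod_opp in H.
  specialize (Hp n). specialize (Hpow n). nra. }
apply Cmod_eq_0. fold t.
apply Rle_antisym; [| apply Cmod_ge_0].
apply Rnot_lt_le. intros Ht.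
destruct (Hf p Hpr) as [l Hl]. apply is_Cderive_slope in Hl.
destruct Hl as [phi [Cphi [Ephi Hphi]]].
(* Chosen so that t = eps (3 P^2 + 1), against the final bound t <= 3 eps P^2. *)
set (eps := (t / (3 * P * P + 1))%R).
assert (He : (0 < eps)%R) by (apply Rdiv_lt_0_compat; [exact Ht | nra]).
destruct (proj1 (locally_Cmod p _) (proj1 (Ccont_iff phi p) Cphi eps He)) as [d' [Hd'0 Hd']].
destruct (Small d' Hd'0) as [n Hn].
destruct (Inv n) as [[I1 [I2 I3]] [I4 [I5 _]]].
assert (Q1 : (Cmod (A n) < r)%R) by lra. assert (Q2 : (Cmod (B n) < r)%R) by lra.
assert (Q3 : (Cmod (D n) < r)%R) by lra.
set (q := (P * (1 / 2) ^ n)%R) in *.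
assert (q0 : (0 <= q)%R) by (apply Rmult_le_pos; [exact P0 | left; apply Hpow]).
(* The affine part of [f] at [p] has the primitive [Faff], so it contributes nothing around a
   triangle; only a remainder of size eps |z - p| is left. *)
pose (aff := fun z => f p + l * (z - p)).
pose (Faff := fun z => (f p - l * p) * z + l / 2 * (z * z)).
assert (Daff : forall z, is_Cderive Faff z (aff z)).
{ intros z. unfold Faff.
  eapply is_Cderive_eq.
  - apply is_Cderive_plus; (apply is_Cderive_mult; [apply is_Cderive_const |]);
      [apply is_Cderive_id | apply is_Cderive_mult; apply is_Cderive_id].
  - unfold aff. field. }
assert (Caff : forall z, (Cmod z < r)%R -> Ccont aff z).
{ intros z _. unfold aff. apply Ccont_plus; [apply Ccont_const |].
  apply Ccont_mult; [apply Ccont_const |].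
  apply Ccont_plus; [apply continuous_id | apply Ccont_const]. }
assert (Taff : tri_int aff (A n) (B n) (D n) = 0).
{ unfold tri_int. rewrite !(seg_int_primitive r Faff aff) by auto. ring. }
assert (Bnd : forall u v, (Cmod u < r)%R -> (Cmod v < r)%R ->
   (Cmod (u - A n) <= q)%R -> (Cmod (v - A n) <= q)%R ->
   (Cmod (seg_int (fun z => f z - aff z)%C u v) <= eps * (3 * q) * Cmod (v - u))%R).
{ intros u v Hu Hv Hua Hva.
  apply (Cmod_seg_int_le r); auto.
  { intros z Hz. apply (continuous_minus (V := C_R_NormedModule)); auto. }
  intros s Hs.
  assert (Hw := Cmod_segment_le u v (A n) s q Hs Hua Hva).
  set (w := segment u v s) in *.
  (* At most q from [w] to [A n], and 2 q from [A n] to [p] by the geometric rate. *)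
  assert (Hwp : (Cmod (w - p) <= 3 * q)%R).
  { replace (w - p) with ((w - A n) + (A n - p)) by ring.
    eapply Rle_trans; [apply Cmod_triangle |].
    specialize (Hp n). unfold q in *. lra. }
  replace (f w - aff w) with ((phi w - phi p) * (w - p)).
  2: { unfold aff. rewrite (Hphi w), Ephi. ring. }
  rewrite Cmod_mult. apply Rmult_le_compat; try apply Cmod_ge_0; [| exact Hwp].
  left. apply Hd'. change (Cmod (w - p) < d')%R. unfold q in *. lra. }
assert (E : tri_int f (A n) (B n) (D n) =
  seg_int (fun z => f z - aff z) (A n) (B n) + seg_int (fun z => f z - aff z) (B n) (D n)
  + seg_int (fun z => f z - aff z) (D n) (A n)).
{ rewrite !(seg_int_minus r) by auto.
  replace (tri_int f (A n) (B n) (D n)) with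
    (tri_int f (A n) (B n) (D n) - tri_int aff (A n) (B n) (D n)) by (rewrite Taff; ring).
  unfold tri_int. ring. }
destruct (perimeter_le (A n) (B n) (D n)) as [R1 [R2 R3]]. rewrite I4 in R1, R2, R3.
assert (F : (Cmod (tri_int f (A n) (B n) (D n)) <= eps * (3 * q) * q)%R).
{ rewrite E. rewrite <- I4 at 2. unfold perimeter.
  rewrite !Rmult_plus_distr_l.
  eapply Rle_trans; [apply Cmod_triangle |]. apply Rplus_le_compat; [| now apply Bnd].
  eapply Rle_trans; [apply Cmod_triangle |]. apply Rplus_le_compat; now apply Bnd. }
assert (G : (t * (1 / 4) ^ n <= 3 * eps * P * P * (1 / 4) ^ n)%R).
{ eapply Rle_trans; [exact I5 |]. eapply Rle_trans; [exact F |]. right. unfold q.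
  replace (1 / 4)%R with (1 / 2 * (1 / 2))%R by field. rewrite Rpow_mult_distr. ring. }
apply Rmult_le_reg_r in G; [| apply pow_lt; lra].
assert (Et : t = (eps * (3 * P * P + 1))%R).
{ unfold eps. field. nra. }
rewrite Et in G. nra.
Qed.

(** Goursat's theorem on the triangle 0, z, y turns the increment of the integral from 0 into the
    integral of [f] from z to y, which is f(z) (y - z) up to the oscillation of [f]. *)
Theorem holo_primitive (r : R) (f : C -> C) :
  holo r f -> exists F : C -> C, forall z, (Cmod z < r)%R -> is_Cderive F z (f z).
Proof.
intros Hf.
assert (Cf : forall z, (Cmod z < r)%R -> Ccont f z) by (intros; now apply (holo_cont r)).
exists (seg_int f 0). intros z Hz.
assert (Hr : (0 < r)%R) by (assert (P := Cmod_ge_0 z); lra).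
assert (H0 : (Cmod 0 < r)%R) by (rewrite Cmod_0; lra).
set (phi := fun y => if Ceq_dec y z then f z else (seg_int f 0 y - seg_int f 0 z) / (y - z)).
apply is_Cderive_slope. exists phi.
assert (Ez : phi z = f z) by (unfold phi; destruct (Ceq_dec z z); congruence).
split; [| split; [exact Ez |]].
- apply Ccont_iff. intros eps He. rewrite Ez.
  assert (He2 : (0 < eps / 2)%R) by lra.
  destruct (proj1 (locally_Cmod z _) (proj1 (Ccont_iff f z) (Cf z Hz) _ He2)) as [d [Hd0 Hd]].
  apply locally_Cmod.
  assert (Hd2 : (0 < Rmin d (r - Cmod z))%R) by (apply Rmin_pos; lra).
  exists (Rmin d (r - Cmod z)). split; [exact Hd2 |]. intros y Hy.
  assert (Hy1 := Rlt_le_trans _ _ _ Hy (Rmin_l _ _)).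
  assert (Hy2 := Rlt_le_trans _ _ _ Hy (Rmin_r _ _)).
  unfold phi. destruct (Ceq_dec y z) as [-> | Hn].
  { replace (f z - f z) with (RtoC 0) by ring. now rewrite Cmod_0. }
  assert (Hyr : (Cmod y < r)%R).
  { assert (T := Cmod_triangle (y - z) z). replace (y - z + z) with y in T by ring. lra. }
  assert (Hyz : y - z <> 0) by now apply Cminus_eq_contra.
  assert (G := goursat r f 0 z y Hf H0 Hz Hyr). unfold tri_int in G.
  rewrite (seg_int_rev r f 0 y) in G by auto.
  assert (E : seg_int f 0 y - seg_int f 0 z = seg_int f z y).
  { replace (seg_int f z y) with (seg_int f 0 y - seg_int f 0 z
      + (seg_int f 0 z + seg_int f z y + - seg_int f 0 y)) by ring.
    rewrite G. ring. }
  rewrite E.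
  assert (K : seg_int (fun w => f w - f z) z y = seg_int f z y - f z * (y - z)).
  { rewrite (seg_int_minus r f (fun _ => f z)) by (auto; intros; apply Ccont_const).
    f_equal.
    rewrite (seg_int_primitive r (fun w => f z * w) (fun _ => f z)); auto.
    - ring.
    - intros; apply Ccont_const.
    - intros w _. eapply is_Cderive_eq; [apply is_Cderive_mult; [apply is_Cderive_const | apply is_Cderive_id] | Cring]. }
  replace (seg_int f z y / (y - z) - f z) with (seg_int (fun w => f w - f z) z y / (y - z))
    by (rewrite K; field; exact Hyz).
  rewrite Cmod_div by exact Hyz.
  assert (P := proj1 (Cmod_gt_0 _) Hyz).
  apply Rmult_lt_reg_r with (Cmod (y - z)); [exact P |].
  unfold Rdiv at 1. rewrite Rmult_assoc, Rinv_l, Rmult_1_r by lra.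
  apply Rle_lt_trans with (eps / 2 * Cmod (y - z))%R; [| nra].
  apply (Cmod_seg_int_le r); auto.
  { intros w Hw. apply (continuous_minus (V := C_R_NormedModule)); [now apply Cf | apply continuous_const]. }
  intros t Ht. left. apply Hd.
  change (Cmod (segment z y t - z) < d)%R.
  apply Rle_lt_trans with (Cmod (y - z)); [| exact Hy1].
  apply Cmod_segment_le; [exact Ht | | lra].
  replace (z - z) with (RtoC 0) by ring. rewrite Cmod_0. lra.
- intros y. unfold phi. destruct (Ceq_dec y z) as [-> | Hn]; [ring |].
  field. now apply Cminus_eq_contra.
Qed.

(** * Cauchy's formula and the maximum principle *)

(* The slope of a primitive [F] of a holomorphic function is differentiable even
   at the base point, because [F] has a second-order expansion there. *)
Lemma holo_slope_primitive (r : R) (F f : C -> C) (a : C) :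
  holo r f -> (forall z, (Cmod z < r)%R -> is_Cderive F z (f z)) -> (Cmod a < r)%R ->
  exists S : C -> C, holo r S /\ S a = f a /\ forall y, F y = F a + (y - a) * S y.
Proof.
intros Hf HF Ha.
assert (Cf : forall z, (Cmod z < r)%R -> Ccont f z) by (intros; now apply (holo_cont r)).
pose (S := fun y => if Ceq_dec y a then f a else (F y - F a) / (y - a)).
assert (Sa : S a = f a) by (unfold S; destruct (Ceq_dec a a); congruence).
assert (Sn : forall y, y <> a -> S y = (F y - F a) / (y - a))
  by (intros y Hy; unfold S; destruct (Ceq_dec y a); congruence).
assert (FS : forall y, F y = F a + (y - a) * S y).
{ intros y. destruct (Ceq_dec y a) as [-> | Hy]; [ring |].
  rewrite (Sn y Hy). field. now apply Cminus_eq_contra. }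
exists S. split; [| split; [exact Sa | exact FS]].
intros z Hz. destruct (Ceq_dec z a) as [-> | Hn].
(* Integrating f(a) + l (y - a) gives the quadratic coefficient l/2 of [F], which is the derivative
   of its slope at [a]. *)
- destruct (Hf a Ha) as [l Hl]. exists (l / 2).
  apply is_Cderive_slope in Hl. destruct Hl as [phi [Cphi [Ephi Hphi]]].
  apply is_Cderive_eps. intros eps He.
  destruct (proj1 (locally_Cmod a _) (proj1 (Ccont_iff phi a) Cphi eps He)) as [d [Hd0 Hd]].
  exists (Rmin d (r - Cmod a)). split; [apply Rmin_pos; lra |].
  intros y Hy.
  assert (Hy1 := Rlt_le_trans _ _ _ Hy (Rmin_l _ _)).
  assert (Hy2 := Rlt_le_trans _ _ _ Hy (Rmin_r _ _)).
  destruct (Ceq_dec y a) as [-> | Hy0].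
  { replace (S a - S a - (a - a) * (l / 2)) with (RtoC 0) by ring.
    replace (a - a) with (RtoC 0) by ring. rewrite Cmod_0. lra. }
  assert (Hya : y - a <> 0) by now apply Cminus_eq_contra.
  assert (Hyr : (Cmod y < r)%R).
  { assert (T := Cmod_triangle (y - a) a). replace (y - a + a) with y in T by ring. lra. }
  pose (aff := fun w => f a + l * (w - a)).
  pose (Faff := fun w => (f a - l * a) * w + l / 2 * (w * w)).
  assert (Daff : forall w, is_Cderive Faff w (aff w)).
  { intros w. unfold Faff. eapply is_Cderive_eq.
    - apply is_Cderive_plus; (apply is_Cderive_mult; [apply is_Cderive_const |]);
        [apply is_Cderive_id | apply is_Cderive_mult; apply is_Cderive_id].
    - unfold aff. Cfield. }
  assert (Caff : forall w, Ccont aff w).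
  { intros w. unfold aff. apply Ccont_plus; [apply Ccont_const |].
    apply Ccont_mult; [apply Ccont_const |].
    apply Ccont_plus; [apply continuous_id | apply Ccont_const]. }
  assert (E : seg_int (fun w => f w - aff w) a y
    = (y - a) * (S y - S a - (y - a) * (l / 2))).
  { rewrite (seg_int_minus r) by auto.
    rewrite (seg_int_primitive r F f), (seg_int_primitive r Faff aff) by auto.
    rewrite (Sn y Hy0), Sa. unfold Faff. field. exact Hya. }
  assert (P := proj1 (Cmod_gt_0 _) Hya).
  apply Rmult_le_reg_l with (Cmod (y - a)); [exact P |].
  rewrite <- Cmod_mult, <- E.
  replace (Cmod (y - a) * (eps * Cmod (y - a)))%R
    with ((eps * Cmod (y - a)) * Cmod (y - a))%R by ring.
  apply (Cmod_seg_int_le r); auto.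
  { intros w Hw. apply (continuous_minus (V := C_R_NormedModule)); auto. }
  intros t Ht.
  assert (Hw : (Cmod (segment a y t - a) <= Cmod (y - a))%R).
  { apply Cmod_segment_le; [exact Ht | | lra].
    replace (a - a) with (RtoC 0) by ring. rewrite Cmod_0. lra. }
  set (w := segment a y t) in *.
  replace (f w - aff w) with ((phi w - phi a) * (w - a)).
  2: { unfold aff. rewrite (Hphi w), Ephi. ring. }
  rewrite Cmod_mult. apply Rmult_le_compat; try apply Cmod_ge_0; [| exact Hw].
  left. apply Hd. lra.
- assert (Hza : z - a <> 0) by now apply Cminus_eq_contra.
  eexists.
  apply (is_Cderive_ext_loc (fun y => (F y - F a) * / (y - a)) S z _ (Cmod (z - a)));
    [now apply Cmod_gt_0 | |].
  + intros y Hy. symmetry. apply Sn. intros ->.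
    rewrite <- Cmod_opp in Hy. replace (- (a - z)) with (z - a) in Hy by ring. lra.
  + apply is_Cderive_mult.
    * apply is_Cderive_minus; [now apply HF | apply is_Cderive_const].
    * apply is_Cderive_inv; [exact Hza |].
      apply is_Cderive_minus; [apply is_Cderive_id | apply is_Cderive_const].
Qed.

(** * Circle integrals and Cauchy's formula for a primitive *)

Definition circle (rho : R) (t : R) : C := (rho * cos t, rho * sin t)%R.

Lemma Cmod_circle (rho t : R) : (0 <= rho)%R -> Cmod (circle rho t) = rho.
Proof.
intros H. unfold Cmod, circle. cbn [fst snd].
replace ((rho * cos t) ^ 2 + (rho * sin t) ^ 2)%R with (rho * rho)%R.
- now apply sqrt_square.
- assert (E := sin2_cos2 t). unfold Rsqr in E. nra.
Qed.

Lemma circle_2PI (rho : R) : circle rho (2 * PI) = circle rho 0.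
Proof. unfold circle. now rewrite cos_2PI, sin_2PI, cos_0, sin_0. Qed.

Lemma is_Rderive_circle (rho t : R) : is_Rderive (circle rho) t (Ci * circle rho t).
Proof.
replace (Ci * circle rho t) with ((rho * - sin t, rho * cos t)%R : C).
2: { unfold circle, Ci, Cmult. cbn [fst snd]. f_equal; ring. }
assert (Hc : filterdiff (fun s => rho * cos s)%R (locally t) (fun y => scal y (rho * - sin t)%R))
  by (apply (is_derive_scal cos t rho (- sin t)); apply is_derive_cos).
assert (Hs : filterdiff (fun s => rho * sin s)%R (locally t) (fun y => scal y (rho * cos t)%R))
  by (apply (is_derive_scal sin t rho (cos t)); apply is_derive_sin).
refine (filterdiff_comp_2 (K := R_AbsRing) (T := R_NormedModule) (U := R_NormedModule)
  (V := R_NormedModule) (W := C_R_NormedModule) _ _ (fun x y => (x, y)) _ _ (fun x y => (x, y)) Hc Hs _).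
apply (filterdiff_ext_lin _ (fun p : C_R_NormedModule => p)).
2: { intros [x y]. reflexivity. }
apply (filterdiff_ext (fun p : C_R_NormedModule => p)).
{ intros [x y]. reflexivity. }
apply filterdiff_id.
Qed.

Lemma Ccont_circle (rho t : R) : Ccont (circle rho) t.
Proof.
apply (ex_derive_continuous (V := C_R_NormedModule)).
eexists. apply is_Rderive_circle.
Qed.

Lemma Ci_mul : Ci * Ci = - (1).
Proof. unfold Ci, Cmult, Copp, RtoC. cbn [fst snd]. f_equal; ring. Qed.

(* A holomorphic integrand has a primitive, so its integral over a circle vanishes. *)
Lemma circle_int_holo (r rho : R) (f : C -> C) :
  holo r f -> (0 <= rho < r)%R ->
  is_CInt (fun t => f (circle rho t) * circle rho t) 0 (2 * PI) 0.
Proof.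
intros Hf Hr. destruct (holo_primitive r f Hf) as [F HF].
assert (PI0 := PI_RGT_0).
assert (Hc : forall t, (Cmod (circle rho t) < r)%R) by (intros; rewrite Cmod_circle; lra).
assert (H := is_CInt_curve F f (circle rho) (fun t => Ci * circle rho t) 0 (2 * PI)
  ltac:(lra) (fun t _ => is_Rderive_circle rho t)
  (fun t _ => Ccont_mult _ _ t (Ccont_const Ci t) (Ccont_circle rho t))
  (fun t _ => HF _ (Hc t)) (fun t _ => holo_cont r f _ Hf (Hc t))).
(* On the circle dz = i z dt; the factor i is removed, and all circle integrals below are taken in
   t. *)
apply (is_CInt_mult_l (- Ci)) in H.
rewrite circle_2PI in H.
replace (- Ci * (F (circle rho 0) - F (circle rho 0))) with (RtoC 0) in H by ring.
apply is_CInt_ext with (2 := H). intros t. cbv beta.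
replace (- Ci * (f (circle rho t) * (Ci * circle rho t)))
  with (- (Ci * Ci) * (f (circle rho t) * circle rho t)) by ring.
rewrite Ci_mul. ring.
Qed.

Lemma circle_sub_neq0 (rho : R) (a : C) (t : R) :
  (Cmod a < rho)%R -> circle rho t - a <> 0.
Proof.
intros Ha E.
assert (P := Cmod_ge_0 a).
assert (H : circle rho t = a) by (replace a with (circle rho t - (circle rho t - a)) by ring; rewrite E; ring).
assert (Q := Cmod_circle rho t ltac:(lra)). rewrite H in Q. lra.
Qed.

Lemma circle_neq0 (rho t : R) : (0 < rho)%R -> circle rho t <> 0.
Proof.
intros H E. apply (circle_sub_neq0 rho 0 t); [now rewrite Cmod_0 |]. rewrite E. ring.
Qed.

Lemma circle_opp_mul (rho t : R) : circle rho t * circle 1 (- t) = rho.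
Proof.
unfold circle, Cmult, RtoC. cbn [fst snd]. rewrite cos_neg, sin_neg.
assert (E := sin2_cos2 t). unfold Rsqr in E. f_equal; [| ring].
transitivity (rho * (sin t * sin t + cos t * cos t))%R; [ring | rewrite E; ring].
Qed.

(** With z = [circle rho t], u = exp(-i t) and al = a/rho, z/(z - a) = 1 + al u/(1 - al u). The last
    summand is g(u) u with g holomorphic beyond the unit circle, so after t -> 2 pi - t its integral
    vanishes by [circle_int_holo]. *)
Lemma circle_int_kernel (rho : R) (a : C) :
  (Cmod a < rho)%R ->
  is_CInt (fun t => circle rho t / (circle rho t - a)) 0 (2 * PI) (RtoC (2 * PI)).
Proof.
intros Ha. assert (P := Cmod_ge_0 a). assert (Hrho : (0 < rho)%R) by lra.
assert (PI0 := PI_RGT_0).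
assert (Hrc : RtoC rho <> 0) by (intros Q; injection Q; lra).
set (al := a / rho).
assert (Hal : (Cmod al < 1)%R).
{ unfold al. rewrite Cmod_div, Cmod_R, Rabs_pos_eq by (assumption || lra).
  apply Rmult_lt_reg_r with rho; [lra |]. unfold Rdiv. rewrite Rmult_assoc, Rinv_l; lra. }
assert (Pal := Cmod_ge_0 al).
(* A radius above 1 that still has |al| R1 < 1, so that 1 - al u has no zero within it. *)
pose (R1 := (2 / (1 + Cmod al))%R).
assert (HR1 : (1 < R1)%R).
{ unfold R1. apply Rmult_lt_reg_r with (1 + Cmod al)%R; [lra |].
  unfold Rdiv. rewrite Rmult_assoc, Rinv_l; lra. }
assert (HR2 : (Cmod al * R1 < 1)%R).
{ unfold R1. apply Rmult_lt_reg_r with (1 + Cmod al)%R; [lra |].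
  unfold Rdiv. rewrite <- !Rmult_assoc, Rmult_assoc, Rinv_l; lra. }
assert (Hn : forall u, (Cmod u < R1)%R -> 1 - al * u <> 0).
{ intros u Hu E.
  assert (E1 : al * u = 1) by (replace (al * u) with (1 - (1 - al * u)) by ring; rewrite E; ring).
  apply (f_equal Cmod) in E1. rewrite Cmod_mult, Cmod_1 in E1.
  assert (Pu := Cmod_ge_0 u). nra. }
assert (Hh : holo R1 (fun u => al * / (1 - al * u))).
{ intros u Hu. eexists. apply is_Cderive_mult; [apply is_Cderive_const |].
  apply is_Cderive_inv; [now apply Hn |].
  apply is_Cderive_minus; [apply is_Cderive_const |].
  apply is_Cderive_mult; [apply is_Cderive_const | apply is_Cderive_id]. }
assert (H := circle_int_holo R1 1 _ Hh ltac:(lra)).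
assert (H0 : is_CInt (fun t => al * / (1 - al * circle 1 t) * circle 1 t) (-1 * 0 + 2 * PI) (-1 * (2 * PI) + 2 * PI) 0).
{ replace (-1 * 0 + 2 * PI)%R with (2 * PI)%R by ring.
  replace (-1 * (2 * PI) + 2 * PI)%R with 0%R by ring.
  replace (RtoC 0) with (opp (RtoC 0 : C_R_NormedModule)).
  - exact (is_RInt_swap _ _ _ _ H).
  - change (- (0) = (0 : C)). ring. }
apply (is_RInt_comp_lin (V := C_R_NormedModule)) in H0.
apply (is_CInt_mult_l (- (1))) in H0.
assert (H1 := is_CInt_plus _ _ _ _ _ _ (is_CInt_const 1 0 (2 * PI)) H0).
replace (RtoC (2 * PI)) with (RtoC (2 * PI - 0) * 1 + - (1) * 0).
2: { rewrite RtoC_minus. ring. }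
apply is_CInt_ext with (2 := H1). intros t. cbv beta.
assert (Em1 : RtoC (-1) = - (1)) by apply (RtoC_opp 1).
rewrite scal_RtoC, Em1.
replace (circle 1 (-1 * t + 2 * PI)) with (circle 1 (- t)).
2: { unfold circle. replace (-1 * t + 2 * PI)%R with (- t + 2 * INR 1 * PI)%R by (simpl; ring).
     now rewrite cos_period, sin_period. }
assert (Ep := circle_opp_mul rho t).
set (u := circle 1 (- t)) in *. set (g := circle rho t) in *.
assert (Hg : g <> 0) by now apply circle_neq0.
assert (Hga : g - a <> 0) by now apply circle_sub_neq0.
assert (Hu : (Cmod u < R1)%R) by (unfold u; rewrite Cmod_circle; lra).
assert (Hu1 := Hn u Hu).
assert (Eu : u = rho / g) by (rewrite <- Ep; field; exact Hg).
assert (Ea : al * u = a / g) by (rewrite Eu; unfold al; field; now split).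
replace (1 + - (1) * (- (1) * (al * / (1 - al * u) * u)))
  with (1 + (al * u) * / (1 - al * u)) by ring.
rewrite Ea in *. field. repeat split; auto.
Qed.

(** Divide F(z) = F(a) + (z - a) S(z) by z - a: the slope [S] is holomorphic, so only F(a) times the
    kernel integral survives. *)
Lemma cauchy_formula_primitive (r rho : R) (F f : C -> C) (a : C) :
  holo r f -> (forall z, (Cmod z < r)%R -> is_Cderive F z (f z)) -> (Cmod a < rho < r)%R ->
  is_CInt (fun t => F (circle rho t) * circle rho t * / (circle rho t - a)) 0 (2 * PI)
    (RtoC (2 * PI) * F a).
Proof.
intros Hf HF Ha. assert (P := Cmod_ge_0 a).
destruct (holo_slope_primitive r F f a Hf HF ltac:(lra)) as [S [HS [_ ES]]].
assert (H := is_CInt_plus _ _ _ _ _ _ (circle_int_holo r rho S HS ltac:(lra))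
  (is_CInt_mult_l (F a) _ _ _ _ (circle_int_kernel rho a ltac:(lra)))).
replace (RtoC (2 * PI) * F a) with (0 + F a * RtoC (2 * PI)) by ring.
apply is_CInt_ext with (2 := H). intros t. cbv beta.
rewrite (ES (circle rho t)). field. apply circle_sub_neq0. lra.
Qed.

(** For u = 1/(c - a), v = 1/(c - y) and d = y - a one has v - u = d u v, so this is the first-order
    expansion of (1/(c - y))^n in y. [K] does not depend on c, which makes the remainder uniform
    along the circle. *)
Lemma Cpow_expansion_bound (n : nat) (M : R) :
  (0 <= M)%R -> exists K, forall d u v : C,
    v - u = d * (u * v) -> (Cmod u <= M)%R -> (Cmod v <= M)%R ->
    (Cmod (v ^ n - u ^ n - d * (INR n * u ^ S n)) <= K * (Cmod d * Cmod d))%R.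
Proof.
intros HM.
assert (T : forall p q A B : R, (0 <= p -> 0 <= q -> p <= A -> q <= B -> p * q <= A * B)%R).
{ intros. now apply Rmult_le_compat. }
induction n as [| n [K IH]].
- exists 0%R. intros d u v _ _ _. simpl.
  replace (1 - 1 - d * (0 * (u * 1))) with (RtoC 0) by ring. rewrite Cmod_0. lra.
- exists (M * K + INR (S n) * (M ^ n * (M * M * M)))%R.
  intros d u v E Hu Hv. specialize (IH d u v E Hu Hv).
  assert (Pu := Cmod_ge_0 u). assert (Pv := Cmod_ge_0 v). assert (Pd := Cmod_ge_0 d).
  assert (Pn := pos_INR (S n)).
  replace (v ^ S n - u ^ S n - d * (INR (S n) * u ^ S (S n)))
    with (v * (v ^ n - u ^ n - d * (INR n * u ^ S n))
      + INR (S n) * (u ^ n * (u * u * v)) * (d * d)).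
  2: { rewrite S_INR, RtoC_plus. simpl.
       set (w := u ^ n). set (w' := v ^ n). set (k := RtoC (INR n)).
       replace (v * w' - u * w - d * ((k + 1) * (u * (u * w))))
         with (v * (w' - w - d * (k * (u * w))) + (k + 1) * (w * (u * u * v)) * (d * d)
           + (v - u - d * (u * v)) * (w + (k + 1) * d * u * w)) by ring.
       rewrite E. ring. }
  eapply Rle_trans; [apply Cmod_triangle |].
  rewrite Rmult_plus_distr_r. apply Rplus_le_compat.
  + rewrite Cmod_mult, Rmult_assoc. apply T; auto using Cmod_ge_0.
  + rewrite !Cmod_mult, !Cmod_pow, Cmod_R, Rabs_pos_eq by exact Pn.
    apply Rmult_le_compat_r; [nra |].
    apply Rmult_le_compat_l; [exact Pn |].
    assert (Pk : (0 <= Cmod u ^ n <= M ^ n)%R).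
    { split; [now apply pow_le | now apply pow_incr]. }
    apply T; [lra | repeat apply Rmult_le_pos; auto | lra |].
    apply T; auto using Rmult_le_pos.
Qed.

(** The Cauchy integral of the density [h]; with all powers of the kernel the family is closed under
    differentiation, up to constants. *)
Definition circle_kernel (h : R -> C) (rho : R) (n : nat) (z : C) : C :=
  CInt (fun t => h t * (/ (circle rho t - z)) ^ n) 0 (2 * PI).

Lemma Ccont_Cpow {U : UniformSpace} (f : U -> C) (n : nat) (x : U) :
  Ccont f x -> Ccont (fun y => f y ^ n) x.
Proof.
intros H. induction n as [| n IH]; simpl; [apply Ccont_const | now apply Ccont_mult].
Qed.

Lemma is_CInt_circle_kernel (h : R -> C) (rho : R) (n : nat) (z : C) :
  (forall t, Ccont h t) -> (Cmod z < rho)%R ->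
  is_CInt (fun t => h t * (/ (circle rho t - z)) ^ n) 0 (2 * PI) (circle_kernel h rho n z).
Proof.
intros Hh Hz. apply is_CInt_cont. intros t _.
apply Ccont_mult; [apply Hh |]. apply Ccont_Cpow.
apply Ccont_inv; [now apply circle_sub_neq0 |].
apply Ccont_plus; [apply Ccont_circle | apply Ccont_const].
Qed.

Lemma is_Cderive_circle_kernel (h : R -> C) (rho : R) (n : nat) (a : C) :
  (forall t, Ccont h t) -> (Cmod a < rho)%R ->
  is_Cderive (circle_kernel h rho n) a (INR n * circle_kernel h rho (S n) a).
Proof.
intros Hh Ha. assert (Pa := Cmod_ge_0 a). assert (PI0 := PI_RGT_0).
destruct (bounded_continuity (V := C_R_NormedModule) h 0 (2 * PI) (fun t _ => Hh t)) as [B HB].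
(* Bounds the kernel at all points of modulus at most (rho + |a|)/2, hence at every [y] of the
   neighbourhood. *)
set (M := (2 / (rho - Cmod a))%R).
assert (HM : (0 < M)%R) by (apply Rdiv_lt_0_compat; lra).
destruct (Cpow_expansion_bound n M ltac:(lra)) as [K HK].
apply (is_Cderive_quadratic _ _ _ (2 * PI * (B * K)) ((rho - Cmod a) / 2)); [lra |].
intros y Hy.
assert (Hyr : (Cmod y < (rho + Cmod a) / 2)%R).
{ assert (T := Cmod_triangle (y - a) a). replace (y - a + a) with y in T by ring. lra. }
assert (Hinv : forall z t, (Cmod z <= (rho + Cmod a) / 2)%R ->
   circle rho t - z <> 0 /\ (Cmod (/ (circle rho t - z)) <= M)%R).
{ intros z t Hz.
  assert (N : circle rho t - z <> 0) by (apply circle_sub_neq0; lra).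
  split; [exact N |]. rewrite Cmod_inv by exact N.
  assert (T := Cmod_triangle (circle rho t - z) z).
  replace (circle rho t - z + z) with (circle rho t) in T by ring.
  rewrite Cmod_circle in T by lra.
  unfold M. replace (2 / (rho - Cmod a))%R with (/ ((rho - Cmod a) / 2))%R by (field; lra).
  apply Rinv_le_contravar; lra. }
assert (H1 := is_CInt_circle_kernel h rho n y Hh ltac:(lra)).
assert (H2 := is_CInt_circle_kernel h rho n a Hh Ha).
assert (H3 := is_CInt_mult_l ((y - a) * INR n) _ _ _ _ (is_CInt_circle_kernel h rho (S n) a Hh Ha)).
assert (H := is_CInt_minus _ _ _ _ _ _ (is_CInt_minus _ _ _ _ _ _ H1 H2) H3).
replace ((y - a) * (INR n * circle_kernel h rho (S n) a))
  with ((y - a) * INR n * circle_kernel h rho (S n) a) by ring.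
replace (2 * PI * (B * K) * (Cmod (y - a) * Cmod (y - a)))%R
  with ((2 * PI - 0) * (B * (K * (Cmod (y - a) * Cmod (y - a)))))%R by ring.
apply (Cmod_is_CInt_le _ 0 (2 * PI) _ _ ltac:(lra)) with (2 := H).
intros t Ht.
destruct (Hinv a t ltac:(lra)) as [N1 B1]. destruct (Hinv y t ltac:(lra)) as [N2 B2].
set (u := / (circle rho t - a)) in *. set (v := / (circle rho t - y)) in *.
replace (h t * v ^ n - h t * u ^ n - (y - a) * INR n * (h t * u ^ S n))
  with (h t * (v ^ n - u ^ n - (y - a) * (INR n * u ^ S n))) by ring.
rewrite Cmod_mult.
apply Rmult_le_compat; try apply Cmod_ge_0.
- left. rewrite Cmod_norm. now apply HB.
- apply HK; auto. unfold u, v. field. now split.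
Qed.

Lemma is_Cderive_unique (f : C -> C) (z l m : C) :
  is_Cderive f z l -> is_Cderive f z m -> l = m.
Proof.
intros H1 H2. apply is_C_derive_unique in H1. apply is_C_derive_unique in H2. congruence.
Qed.

Lemma is_Cderive_C_derive (r : R) (f : C -> C) (z : C) :
  holo r f -> (Cmod z < r)%R -> is_Cderive f z (C_derive f z).
Proof. intros H Hz. apply C_derive_correct; [exact z | exact (H z Hz)]. Qed.

(** A primitive [F] of [f] is a Cauchy integral, so f = F' and f' = F'' are Cauchy integrals with
    the kernel squared and cubed, and the latter can be differentiated once more. *)
Theorem holo_C_derive (r : R) (f : C -> C) : holo r f -> holo r (C_derive f).
Proof.
intros Hf z Hz. assert (Pz := Cmod_ge_0 z). assert (PI0 := PI_RGT_0).
destruct (holo_primitive r f Hf) as [F HF].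
set (rho := ((Cmod z + r) / 2)%R).
assert (Hrho : (Cmod z < rho < r)%R) by (unfold rho; lra).
pose (h := fun t => F (circle rho t) * circle rho t).
assert (Hh : forall t, Ccont h t).
{ intros t. apply Ccont_mult; [| apply Ccont_circle].
  apply Ccont_comp; [apply Ccont_circle |].
  apply (is_Cderive_cont _ _ (f (circle rho t))). apply HF. rewrite Cmod_circle; lra. }
assert (Hc : RtoC (2 * PI) <> 0) by (intros Q; injection Q; lra).
set (c := / RtoC (2 * PI)).
assert (EF : forall y, (Cmod y < rho)%R -> F y = c * circle_kernel h rho 1 y).
{ intros y Hy.
  assert (H1 := cauchy_formula_primitive r rho F f y Hf HF ltac:(lra)).
  assert (H2 : circle_kernel h rho 1 y = RtoC (2 * PI) * F y).
  { apply is_CInt_unique. apply is_CInt_ext with (2 := H1).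
    intros t. unfold h. simpl. ring. }
  rewrite H2. unfold c. field. exact Hc. }
assert (Loc : forall y, (Cmod y < rho)%R -> forall w, (Cmod (w - y) < rho - Cmod y)%R -> (Cmod w < rho)%R).
{ intros y Hy w Hw. assert (T := Cmod_triangle (w - y) y).
  replace (w - y + y) with w in T by ring. lra. }
assert (Ef : forall y, (Cmod y < rho)%R -> f y = c * circle_kernel h rho 2 y).
{ intros y Hy. apply (is_Cderive_unique F y); [apply HF; lra |].
  apply (is_Cderive_ext_loc (fun w => c * circle_kernel h rho 1 w) _ _ _ (rho - Cmod y)); [lra | |].
  - intros w Hw. symmetry. apply EF. now apply (Loc y).
  - eapply is_Cderive_eq; [apply is_Cderive_mult; [apply is_Cderive_const | now apply is_Cderive_circle_kernel] |].
    simpl INR. Cring. }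
assert (Ef' : forall y, (Cmod y < rho)%R -> C_derive f y = c * (2 * circle_kernel h rho 3 y)).
{ intros y Hy. apply is_C_derive_unique.
  apply (is_Cderive_ext_loc (fun w => c * circle_kernel h rho 2 w) _ _ _ (rho - Cmod y)); [lra | |].
  - intros w Hw. symmetry. apply Ef. now apply (Loc y).
  - eapply is_Cderive_eq; [apply is_Cderive_mult; [apply is_Cderive_const | now apply is_Cderive_circle_kernel] |].
    replace (INR 2) with 2%R by (simpl; ring). Cring. }
eexists.
apply (is_Cderive_ext_loc (fun w => c * (2 * circle_kernel h rho 3 w)) _ _ _ (rho - Cmod z)); [lra | |].
- intros w Hw. symmetry. apply Ef'. apply (Loc z); lra.
- apply is_Cderive_mult; [apply is_Cderive_const |].
  apply is_Cderive_mult; [apply is_Cderive_const |].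
  apply is_Cderive_circle_kernel; [exact Hh | lra].
Qed.

(** The singularity of a difference quotient is removable: [f] is a primitive of [C_derive f], which
    is now known to be holomorphic. *)
Lemma holo_slope (r : R) (f : C -> C) (a : C) :
  holo r f -> (Cmod a < r)%R ->
  exists S : C -> C, holo r S /\ S a = C_derive f a /\ forall y, f y = f a + (y - a) * S y.
Proof.
intros Hf Ha. apply (holo_slope_primitive r f (C_derive f) a); auto.
- now apply holo_C_derive.
- intros z Hz. now apply (is_Cderive_C_derive r).
Qed.

Lemma holo_mult (r : R) (f g : C -> C) : holo r f -> holo r g -> holo r (fun z => f z * g z).
Proof.
intros Hf Hg z Hz. destruct (Hf z Hz) as [l Hl]. destruct (Hg z Hz) as [m Hm].
eexists. apply is_Cderive_mult; eassumption.
Qed.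

Lemma holo_const (r : R) (c : C) : holo r (fun _ => c).
Proof. intros z _. eexists. apply is_Cderive_const. Qed.

Lemma holo_Cpow (r : R) (f : C -> C) (n : nat) : holo r f -> holo r (fun z => f z ^ n).
Proof.
intros Hf. induction n as [| n IH]; simpl; [apply holo_const | now apply holo_mult].
Qed.

(** The factor rho/(rho - |a|) is harmless, because it stays fixed when [f] is replaced by its
    powers. *)
Lemma cauchy_bound (r rho : R) (f : C -> C) (a : C) (M : R) :
  holo r f -> (Cmod a < rho < r)%R ->
  (forall z, Cmod z = rho -> (Cmod (f z) <= M)%R) ->
  (Cmod (f a) <= M * (rho / (rho - Cmod a)))%R.
Proof.
intros Hf Ha HM. assert (Pa := Cmod_ge_0 a). assert (PI0 := PI_RGT_0).
assert (H := cauchy_formula_primitive r rho f (C_derive f) a (holo_C_derive r f Hf)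
  (fun z Hz => is_Cderive_C_derive r f z Hf Hz) Ha).
apply (Cmod_is_CInt_le _ 0 (2 * PI) _ (M * (rho / (rho - Cmod a))) ltac:(lra)) in H.
- rewrite Cmod_mult, Cmod_R, Rabs_pos_eq in H by lra.
  apply Rmult_le_reg_l with (2 * PI)%R; lra.
- intros t _.
  assert (N : circle rho t - a <> 0) by (apply circle_sub_neq0; lra).
  rewrite !Cmod_mult, Cmod_inv, Cmod_circle by (auto; lra).
  rewrite Rmult_assoc.
  assert (T := Cmod_triangle (circle rho t - a) a).
  replace (circle rho t - a + a) with (circle rho t) in T by ring.
  rewrite Cmod_circle in T by lra.
  assert (I0 : (0 < / Cmod (circle rho t - a))%R) by (apply Rinv_0_lt_compat; lra).
  apply Rmult_le_compat; [apply Cmod_ge_0 | nra | apply HM; rewrite Cmod_circle; lra |].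
  apply Rmult_le_compat_l; [lra |]. apply Rinv_le_contravar; lra.
Qed.

(* Landau's trick: Cauchy's estimate for all powers of [f]. *)
Theorem maximum_principle (r rho : R) (f : C -> C) (a : C) (M : R) :
  holo r f -> (Cmod a < rho < r)%R -> (0 < M)%R ->
  (forall z, Cmod z = rho -> (Cmod (f z) <= M)%R) ->
  (Cmod (f a) <= M)%R.
Proof.
intros Hf Ha HM H. assert (Pa := Cmod_ge_0 a).
apply Rnot_lt_le. intros Hlt.
set (K := (rho / (rho - Cmod a))%R).
assert (HK : forall n, (Cmod (f a) ^ n <= M ^ n * K)%R).
{ intros n. rewrite <- Cmod_pow.
  apply (cauchy_bound r rho (fun z => f z ^ n)); auto.
  - now apply holo_Cpow.
  - intros z Hz. rewrite Cmod_pow. apply pow_incr. split; [apply Cmod_ge_0 | now apply H]. }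
set (q := (Cmod (f a) / M)%R).
assert (Hq : (1 < q)%R).
{ unfold q. apply Rmult_lt_reg_r with M; [exact HM |].
  unfold Rdiv. rewrite Rmult_assoc, Rinv_l; lra. }
destruct (Pow_x_infinity q ltac:(rewrite Rabs_pos_eq; lra) (K + 1)) as [N HN].
specialize (HN N (le_n N)). specialize (HK N).
rewrite Rabs_pos_eq in HN by (apply pow_le; lra).
replace (Cmod (f a)) with (q * M)%R in HK by (unfold q; field; lra).
rewrite Rpow_mult_distr in HK. assert (PM := pow_lt M N HM). nra.
Qed.

(** * Dieudonne's inequality *)

Lemma Cmod_sqr (z : C) : (Cmod z * Cmod z = Re z * Re z + Im z * Im z)%R.
Proof. assert (H := Cmod2_alt z). nra. Qed.

(** Shows that the Blaschke factor maps the disk into itself, and how fast its modulus tends to 1 at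
    the unit circle. *)
Lemma blaschke_identity (b z : C) :
  (Cmod (1 - Cconj b * z) * Cmod (1 - Cconj b * z) =
   Cmod (z - b) * Cmod (z - b) + (1 - Cmod b * Cmod b) * (1 - Cmod z * Cmod z))%R.
Proof.
rewrite !Cmod_sqr. destruct b as [b1 b2], z as [z1 z2].
unfold Re, Im, Cconj, Cminus, Cplus, Copp, Cmult, RtoC. cbn [fst snd]. ring.
Qed.

(** Nothing is known on the unit circle itself, so the maximum principle is applied on circles
    tending to it. The squared modulus and the linear error are what [blaschke_identity]
    delivers. *)
Lemma maximum_principle_boundary (g : C -> C) (a : C) (rho0 K : R) :
  holo 1 g -> (Cmod a < 1)%R -> (rho0 < 1)%R -> (0 <= K)%R ->
  (forall z, (rho0 < Cmod z < 1)%R -> (Cmod (g z) * Cmod (g z) <= 1 + K * (1 - Cmod z))%R) ->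
  (Cmod (g a) <= 1)%R.
Proof.
intros Hg Ha H0 HK H.
apply Rnot_lt_le. intros Hlt.
set (e := (Cmod (g a) * Cmod (g a) - 1)%R).
assert (He : (0 < e)%R) by (unfold e; nra).
(* On a circle within [d] of the unit circle the error K (1 - rho) is below [e]. *)
set (d := (e / (2 * (K + 1)))%R).
assert (Hd : (0 < d)%R) by (apply Rdiv_lt_0_compat; lra).
assert (Ed : (d * (2 * (K + 1)) = e)%R) by (unfold d; field; lra).
set (m := Rmax (Rmax (Cmod a) rho0) (1 - d)).
assert (Hm : (m < 1)%R) by (repeat apply Rmax_lub_lt; lra).
assert (Hm1 : (Cmod a <= m)%R) by (eapply Rle_trans; [| apply Rmax_l]; apply Rmax_l).
assert (Hm2 : (rho0 <= m)%R) by (eapply Rle_trans; [| apply Rmax_l]; apply Rmax_r).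
assert (Hm3 : (1 - d <= m)%R) by apply Rmax_r.
set (rho := ((m + 1) / 2)%R).
assert (Hr : (m < rho < 1)%R) by (unfold rho; lra).
assert (P0 : (0 <= 1 + K * (1 - rho))%R) by nra.
assert (B : (Cmod (g a) <= sqrt (1 + K * (1 - rho)))%R).
{ apply (maximum_principle 1 rho); auto; [lra | apply sqrt_lt_R0; nra |].
  intros z Hz. rewrite <- (sqrt_square (Cmod (g z))) by apply Cmod_ge_0.
  apply sqrt_le_1_alt. rewrite <- Hz. apply H. lra. }
assert (Q := sqrt_sqrt _ P0). assert (Q' := sqrt_pos (1 + K * (1 - rho))).
unfold e in *. nra.
Qed.

Lemma schwarz (w : C -> C) :
  analytic w -> (forall z, disk z -> disk (w z)) -> w 0 = 0 ->
  exists phi : C -> C, holo 1 phi /\ (forall z, disk z -> (Cmod (phi z) <= 1)%R) /\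
    forall z, w z = z * phi z.
Proof.
intros Hw Hd H0.
destruct (holo_slope 1 w 0 Hw ltac:(rewrite Cmod_0; lra)) as [phi [Hphi [_ E]]].
assert (E' : forall z, w z = z * phi z) by (intros z; rewrite E, H0; ring).
exists phi. split; [exact Hphi | split; [| exact E']].
(* For 1/2 < x < 1 one has 1/x^2 <= 1 + 8 (1 - x), because x^2 + 8 x^2 (1 - x) - 1 = (1 - x)(8 x^2 -
   x - 1). *)
intros a Ha. apply (maximum_principle_boundary phi a (1 / 2) 8); auto; try lra.
intros z Hz.
assert (Hwz : (Cmod (w z) < 1)%R) by (apply Hd; unfold disk; lra).
rewrite E', Cmod_mult in Hwz.
assert (P := Cmod_ge_0 (phi z)). set (x := Cmod z) in *. set (y := Cmod (phi z)) in *.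
assert (Hxy : (0 <= x * y)%R) by (apply Rmult_le_pos; lra).
assert (x * y * (x * y) <= 1)%R by nra.
assert (Hx : (0 <= (1 - x) * (8 * (x * x) - x - 1))%R) by (apply Rmult_le_pos; nra).
apply Rmult_le_reg_l with (x * x)%R; nra.
Qed.

(** The factor t < 1 keeps the Blaschke denominator away from 0, as [phi] may be a unimodular
    constant. [B] is t phi followed by the disk automorphism that sends t phi(a) to 0. Divided by
    the Blaschke factor of [a] it becomes S(z) (1 - conj(a) z), which is bounded by 1; its value at
    [a] is B'(a) (1 - |a|^2). *)
Lemma schwarz_pick_scaled (phi : C -> C) (a : C) (t : R) :
  holo 1 phi -> (forall z, disk z -> (Cmod (phi z) <= 1)%R) -> disk a -> (0 < t < 1)%R ->
  (t * Cmod (C_derive phi a) * (1 - Cmod a * Cmod a) <= 1 - t * t * (Cmod (phi a) * Cmod (phi a)))%R.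
Proof.
intros Hphi Hle Ha Ht. unfold disk in Ha.
assert (Pa := Cmod_ge_0 a). assert (Pf := Cmod_ge_0 (phi a)).
assert (Hle1 : forall z, (Cmod z < 1)%R -> (Cmod (t * phi z) <= t)%R).
{ intros z Hz. rewrite Cmod_mult, Cmod_R, Rabs_pos_eq by lra. specialize (Hle z Hz). nra. }
set (b := t * phi a).
assert (Hb : (Cmod b <= t)%R) by now apply Hle1.
assert (Pb := Cmod_ge_0 b).
assert (Hn : forall z, (Cmod z < 1)%R -> (0 < Cmod (1 - Cconj b * (t * phi z)))%R).
{ intros z Hz.
  assert (T := Cmod_triangle (1 - Cconj b * (t * phi z)) (Cconj b * (t * phi z))).
  replace (1 - Cconj b * (t * phi z) + Cconj b * (t * phi z)) with (RtoC 1) in T by ring.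
  rewrite Cmod_1, (Cmod_mult (Cconj b)), Cmod_conj in T.
  specialize (Hle1 z Hz). assert (P := Cmod_ge_0 (t * phi z)). nra. }
pose (B := fun z => (t * phi z - b) * / (1 - Cconj b * (t * phi z))).
assert (DB : forall z, (Cmod z < 1)%R -> exists l, is_Cderive B z l).
{ intros z Hz. eexists. apply is_Cderive_mult.
  - apply is_Cderive_minus; [| apply is_Cderive_const].
    apply is_Cderive_mult; [apply is_Cderive_const | apply (is_Cderive_C_derive 1); auto].
  - apply is_Cderive_inv; [apply Cmod_gt_0; auto |].
    apply is_Cderive_minus; [apply is_Cderive_const |].
    apply is_Cderive_mult; [apply is_Cderive_const |].
    apply is_Cderive_mult; [apply is_Cderive_const | apply (is_Cderive_C_derive 1); auto]. }
assert (Hna : 1 - Cconj b * b <> 0) by (apply Cmod_gt_0; now apply Hn).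
assert (DBa : C_derive B a = t * C_derive phi a / (1 - Cconj b * b)).
{ apply is_C_derive_unique. eapply is_Cderive_eq.
  - apply is_Cderive_mult.
    + apply is_Cderive_minus; [| apply is_Cderive_const].
      apply is_Cderive_mult; [apply is_Cderive_const | apply (is_Cderive_C_derive 1); auto].
    + apply is_Cderive_inv; [apply Cmod_gt_0; auto |].
      apply is_Cderive_minus; [apply is_Cderive_const |].
      apply is_Cderive_mult; [apply is_Cderive_const |].
      apply is_Cderive_mult; [apply is_Cderive_const | apply (is_Cderive_C_derive 1); auto].
  - cbv beta. fold b. Cfield. exact Hna. }
destruct (holo_slope 1 B a DB Ha) as [S [HS [ES FS]]].
assert (Ba : B a = 0) by (unfold B; fold b; ring).
assert (G : (Cmod (S a * (1 - Cconj a * a)) <= 1)%R).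
(* Beyond (1 + |a|)/2 one has |z - a| > (1 - |a|)/2, and |1 - conj(a) z|^2 / |z - a|^2 = 1 + (1 -
   |a|^2)(1 - |z|^2)/|z - a|^2 is at most 1 + 8 (1 - |z|)/(1 - |a|)^2. *)
{ apply (maximum_principle_boundary (fun z => S z * (1 - Cconj a * z)) a
    ((1 + Cmod a) / 2) (8 / ((1 - Cmod a) * (1 - Cmod a)))); auto.
  - apply holo_mult; [exact HS |]. intros z _. eexists.
    apply is_Cderive_minus; [apply is_Cderive_const |].
    apply is_Cderive_mult; [apply is_Cderive_const | apply is_Cderive_id].
  - lra.
  - left. apply Rdiv_lt_0_compat; [lra | nra].
  - intros z Hz.
    assert (T := Cmod_triangle (z - a) a). replace (z - a + a) with z in T by ring.
    assert (Hza : z - a <> 0) by (apply Cmod_gt_0; lra).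
    assert (ESz : S z = B z / (z - a)) by (rewrite (FS z), Ba; field; exact Hza).
    assert (HBz : (Cmod (B z) <= 1)%R).
    { unfold B. rewrite Cmod_mult, Cmod_inv by (apply Cmod_gt_0; apply Hn; lra).
      assert (N := Hn z ltac:(lra)).
      apply Rmult_le_reg_r with (Cmod (1 - Cconj b * (t * phi z))); [exact N |].
      rewrite Rmult_assoc, Rinv_l, Rmult_1_r, Rmult_1_l by lra.
      assert (I := blaschke_identity b (t * phi z)).
      assert (P := Cmod_ge_0 (t * phi z)). assert (L := Hle1 z ltac:(lra)).
      assert (P' := Cmod_ge_0 (t * phi z - b)).
      assert (0 <= (1 - Cmod b * Cmod b) * (1 - Cmod (t * phi z) * Cmod (t * phi z)))%R
        by (apply Rmult_le_pos; nra).
      nra. }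
    rewrite Cmod_mult, ESz, Cmod_div by exact Hza.
    assert (I := blaschke_identity a z).
    assert (P := Cmod_ge_0 (B z)).
    set (p := Cmod (1 - Cconj a * z)) in *. set (q := Cmod (z - a)) in *.
    set (x := Cmod z) in *. set (y := Cmod a) in *. set (m := Cmod (B z)) in *.
    assert (Hq : ((1 - y) / 2 < q)%R) by lra.
    replace (m / q * p * (m / q * p))%R with ((m * m) * (p * p) / (q * q))%R by (field; lra).
    assert (Hy : (0 < (1 - y) * (1 - y))%R) by nra.
    assert (Hqq : ((1 - y) * (1 - y) / 4 <= q * q)%R) by nra.
    assert (Hmm : (m * m <= 1)%R) by nra.
    apply Rle_trans with (p * p / (q * q))%R.
    { apply Rmult_le_compat_r; [left; apply Rinv_0_lt_compat; nra | nra]. }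
    rewrite I.
    replace ((q * q + (1 - y * y) * (1 - x * x)) / (q * q))%R
      with (1 + (1 - y * y) * (1 - x * x) / (q * q))%R by (field; lra).
    apply Rplus_le_compat_l.
    apply Rle_trans with (2 * (1 - x) / (q * q))%R.
    { apply Rmult_le_compat_r; [left; apply Rinv_0_lt_compat; nra |].
      assert (0 <= 1 - y * y <= 1)%R by nra. assert (0 <= 1 - x * x <= 2 * (1 - x))%R by nra. nra. }
    apply Rmult_le_reg_r with (q * q)%R; [nra |].
    unfold Rdiv at 1. rewrite Rmult_assoc, Rinv_l, Rmult_1_r by nra.
    replace (8 / ((1 - y) * (1 - y)) * (1 - x) * (q * q))%R
      with ((2 * (1 - x)) * (q * q / ((1 - y) * (1 - y) / 4)))%R by (field; lra).
    rewrite <- (Rmult_1_r (2 * (1 - x))) at 1. apply Rmult_le_compat_l; [lra |].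
    apply Rmult_le_reg_r with ((1 - y) * (1 - y) / 4)%R; [lra |].
    unfold Rdiv at 2. rewrite Rmult_assoc, Rinv_l; lra. }
rewrite ES, DBa in G.
assert (Eb : 1 - Cconj b * b = RtoC (1 - Cmod b * Cmod b)).
{ rewrite RtoC_minus, Cmod_sqr. destruct b as [b1 b2].
  unfold Re, Im, Cconj, Cminus, Cplus, Copp, Cmult, RtoC. cbn [fst snd]. f_equal; ring. }
assert (Ea : 1 - Cconj a * a = RtoC (1 - Cmod a * Cmod a)).
{ rewrite RtoC_minus, Cmod_sqr. destruct a as [b1 b2].
  unfold Re, Im, Cconj, Cminus, Cplus, Copp, Cmult, RtoC. cbn [fst snd]. f_equal; ring. }
rewrite Cmod_mult, Cmod_div, Cmod_mult in G by exact Hna.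
rewrite Eb, Ea, !Cmod_R, !Rabs_pos_eq in G by nra.
assert (Nb : (0 < 1 - Cmod b * Cmod b)%R) by nra.
replace (t * t * (Cmod (phi a) * Cmod (phi a)))%R with (Cmod b * Cmod b)%R.
2: { unfold b. rewrite Cmod_mult, Cmod_R, Rabs_pos_eq by lra. ring. }
apply (Rmult_le_compat_r _ _ _ (Rlt_le _ _ Nb)) in G.
rewrite Rmult_1_l in G.
replace (t * Cmod (C_derive phi a) / (1 - Cmod b * Cmod b) * (1 - Cmod a * Cmod a) * (1 - Cmod b * Cmod b))%R
  with (t * Cmod (C_derive phi a) * (1 - Cmod a * Cmod a))%R in G by (field; lra).
exact G.
Qed.

Theorem schwarz_pick (phi : C -> C) (a : C) :
  holo 1 phi -> (forall z, disk z -> (Cmod (phi z) <= 1)%R) -> disk a ->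
  (Cmod (C_derive phi a) * (1 - Cmod a * Cmod a) <= 1 - Cmod (phi a) * Cmod (phi a))%R.
Proof.
intros Hphi Hle Ha.
set (X := (Cmod (C_derive phi a) * (1 - Cmod a * Cmod a))%R).
set (Y := (X + Cmod (phi a) * Cmod (phi a))%R).
assert (PX : (0 <= X)%R).
{ unfold X. assert (P := Cmod_ge_0 a). unfold disk in Ha.
  apply Rmult_le_pos; [apply Cmod_ge_0 | nra]. }
cut (Y <= 1)%R; [unfold Y; lra |].
apply Rnot_lt_le. intros HY.
(* In place of the limit t -> 1: the scaled inequality gives t^2 Y <= 1, whereas t^2 Y = (Y +
   1)^2/(4 Y) > 1. *)
set (t := ((Y + 1) / (2 * Y))%R).
assert (Et : (t * (2 * Y) = Y + 1)%R) by (unfold t; field; lra).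
assert (Ht : (0 < t < 1)%R).
{ split; [apply Rdiv_lt_0_compat; lra |]. nra. }
assert (H := schwarz_pick_scaled phi a t Hphi Hle Ha Ht).
rewrite Rmult_assoc in H. fold X in H.
assert (t * t * Y <= 1)%R by (unfold Y in *; nra).
assert (4 * Y * (t * t * Y) = (Y + 1) * (Y + 1))%R by (rewrite <- Et; ring).
nra.
Qed.

(** With w = z phi one has z w' - w = z^2 phi', so this is the Schwarz-Pick inequality for [phi]
    multiplied by |z|^2. *)
Theorem dieudonne (w : C -> C) (z : C) :
  analytic w -> (forall z, disk z -> disk (w z)) -> w 0 = 0 -> disk z ->
  (Cmod (w z) <= Cmod z)%R /\
  (Cmod (z * C_derive w z - w z) * (1 - Cmod z * Cmod z) <= Cmod z * Cmod z - Cmod (w z) * Cmod (w z))%R.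
Proof.
intros Hw Hd H0 Hz.
destruct (schwarz w Hw Hd H0) as [phi [Hphi [Hle E]]].
assert (P := Cmod_ge_0 z). assert (L := Hle z Hz). assert (P' := Cmod_ge_0 (phi z)).
split.
{ rewrite E, Cmod_mult. nra. }
assert (D : C_derive w z = phi z + z * C_derive phi z).
{ apply is_C_derive_unique.
  apply (is_Cderive_ext_loc (fun y => y * phi y) w z _ 1); [lra | intros; now rewrite E |].
  eapply is_Cderive_eq.
  - apply is_Cderive_mult; [apply is_Cderive_id | apply (is_Cderive_C_derive 1); auto].
  - Cring. }
rewrite D, E.
replace (z * (phi z + z * C_derive phi z) - z * phi z) with (z * z * C_derive phi z) by ring.
assert (SP := schwarz_pick phi z Hphi Hle Hz).
rewrite !Cmod_mult.
assert (0 <= Cmod z * Cmod z)%R by nra.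
nra.
Qed.

(** * The exponential, the square root and the inverse of psi *)

Lemma Re_Csqrt_ge0 (z : C) : (0 <= Re (Csqrt z))%R.
Proof. destruct (Csqrt_principal z) as [_ H]. lra. Qed.

Lemma Csqrt_sqr (z : C) : Csqrt z * Csqrt z = z.
Proof. apply Csqrt_principal. Qed.

Lemma Csqrt_unique (z s : C) : s * s = z -> (0 < Re s)%R -> Csqrt z = s.
Proof.
intros E H. set (t := Csqrt z).
assert (F : (t - s) * (t + s) = 0).
{ replace ((t - s) * (t + s)) with (t * t - s * s) by ring.
  unfold t. rewrite Csqrt_sqr, E. ring. }
assert (N : t + s <> 0).
{ intros Q. apply (f_equal Re) in Q. change (Re t + Re s = 0)%R in Q.
  assert (P := Re_Csqrt_ge0 z). fold t in P. lra. }
replace t with (s + (t - s) * (t + s) / (t + s)) by (field; exact N).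
rewrite F. field. exact N.
Qed.

(** By (t - s)(t + s) = y - z the error is -(t - s)^2/(2 s). All values of [Csqrt] have Re >= 0,
    hence |t + s| >= Re s, and the bound holds for every [y], even across the cut. *)
Lemma is_Cderive_Csqrt (z : C) :
  (0 < Re (Csqrt z))%R -> is_Cderive Csqrt z (/ (2 * Csqrt z)).
Proof.
intros H. set (s := Csqrt z) in *. set (m := Re s) in *.
assert (Hsm : (m <= Cmod s)%R).
{ assert (Q := re_le_Cmod s). rewrite Rabs_pos_eq in Q by (fold m; lra). exact Q. }
assert (Hs : s <> 0) by (apply Cmod_gt_0; lra).
apply (is_Cderive_quadratic _ _ _ (/ (2 * m * m * m)) 1); [lra |].
intros y _. fold s. set (t := Csqrt y).
assert (Et : (t - s) * (t + s) = y - z).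
{ unfold t, s. rewrite <- (Csqrt_sqr y) at 3. rewrite <- (Csqrt_sqr z) at 3. ring. }
assert (Hts : (m <= Cmod (t + s))%R).
{ assert (Q := re_le_Cmod (t + s)). assert (P := Re_Csqrt_ge0 y). fold t in P.
  assert (E : Re (t + s) = (Re t + m)%R) by reflexivity.
  rewrite E, Rabs_pos_eq in Q by lra. lra. }
assert (N : t + s <> 0) by (apply Cmod_gt_0; lra).
rewrite <- Et.
replace (t - s - (t - s) * (t + s) * / (2 * s)) with (- ((t - s) * (t - s) / (2 * s)))
  by (field; exact Hs).
assert (N2 : 2 * s <> 0).
{ apply Cmult_neq_0; [intros Q; injection Q; lra | exact Hs]. }
rewrite Cmod_opp, Cmod_div, !Cmod_mult, Cmod_R, Rabs_pos_eq by (auto; lra).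
assert (P := Cmod_ge_0 (t - s)).
set (d := Cmod (t - s)) in *. set (p := Cmod (t + s)) in *. set (q := Cmod s) in *.
replace (/ (2 * m * m * m) * (d * p * (d * p)))%R
  with (d * d * (p * p * / (2 * m * m * m)))%R by ring.
unfold Rdiv. apply Rmult_le_compat_l; [nra |].
apply Rle_trans with (/ (2 * m))%R.
- apply Rinv_le_contravar; lra.
- replace (/ (2 * m))%R with (m * m * / (2 * m * m * m))%R by (field; lra).
  apply Rmult_le_compat_r; [| nra].
  left. apply Rinv_0_lt_compat. repeat apply Rmult_lt_0_compat; lra.
Qed.

Lemma Re_Csqrt_gt (z : C) (a : R) : (0 <= a)%R -> (a * a < Re z)%R -> (a < Re (Csqrt z))%R.
Proof.
intros Ha H. unfold Csqrt. cbn [Re fst].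
assert (Q := re_le_Cmod z). assert (Q' := Rle_abs (Re z)).
rewrite <- (sqrt_square a) by exact Ha.
apply sqrt_lt_1_alt. split; [nra | lra].
Qed.

Lemma derivable_pt_lim_0_bound (f : R -> R) (l : R) :
  derivable_pt_lim f 0 l -> forall eps, (0 < eps)%R -> exists d, (0 < d)%R /\
  forall h, (Rabs h < d)%R -> (Rabs (f h - f 0 - l * h) <= eps * Rabs h)%R.
Proof.
intros H eps He. destruct (H eps He) as [d Hd]. exists d. split; [apply cond_pos |].
intros h Hh. destruct (Req_EM_T h 0) as [-> | Hn].
- rewrite Rmult_0_r, Rminus_0_r, Rminus_diag, Rabs_R0. lra.
- specialize (Hd h Hn Hh). rewrite Rplus_0_l in Hd.
  replace (f h - f 0 - l * h)%R with (((f h - f 0) / h - l) * h)%R by (field; exact Hn).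
  rewrite Rabs_mult. apply Rmult_le_compat_r; [apply Rabs_pos | lra].
Qed.

Lemma Cexp_plus (z w : C) : Cexp (z + w) = Cexp z * Cexp w.
Proof.
destruct z as [a b], w as [c d]. unfold Cexp, Cplus, Cmult, Re, Im. cbn [fst snd].
rewrite exp_plus, cos_plus, sin_plus. f_equal; ring.
Qed.

Lemma Cexp_0 : Cexp 0 = 1.
Proof.
unfold Cexp, Re, Im, RtoC. cbn [fst snd]. rewrite exp_0, cos_0, sin_0. f_equal; ring.
Qed.

Lemma Cexp_neq0 (z : C) : Cexp z <> 0.
Proof.
intros E.
assert (H : Cexp (z + - z) = 0) by (rewrite Cexp_plus, E; ring).
replace (z + - z) with (RtoC 0) in H by ring. rewrite Cexp_0 in H. injection H. lra.
Qed.

Lemma Cmod_le_Rabs (z : C) : (Cmod z <= Rabs (Re z) + Rabs (Im z))%R.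
Proof.
destruct z as [x y].
replace ((x, y) : C) with (RtoC x + Ci * RtoC y).
2: { unfold RtoC, Ci, Cplus, Cmult. cbn [fst snd]. f_equal; ring. }
eapply Rle_trans; [apply Cmod_triangle |].
rewrite Cmod_mult, !Cmod_R.
replace (Cmod Ci) with 1%R.
2: { unfold Cmod, Ci. cbn [fst snd]. replace (0 ^ 2 + 1 ^ 2)%R with 1%R by ring. now rewrite sqrt_1. }
unfold Re, Im. rewrite Rmult_1_l.
right. f_equal; f_equal; unfold RtoC, Ci, Cplus, Cmult; cbn [fst snd]; ring.
Qed.

Lemma is_Cderive_Cexp_0 : is_Cderive Cexp 0 1.
Proof.
apply is_Cderive_eps. intros eps0 He0.
(* The real part contributes at most 3 eps |h|, the imaginary part 4 eps |h|. The cap 1/8 keeps exp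
   x below 2, and |h| < eps makes x y of order eps |h|. *)
set (eps := Rmin (eps0 / 8) (1 / 8)).
assert (He : (0 < eps)%R) by (apply Rmin_pos; lra).
assert (Hea : (eps <= eps0 / 8)%R) by apply Rmin_l.
assert (Heb : (eps <= 1 / 8)%R) by apply Rmin_r.
destruct (derivable_pt_lim_0_bound exp 1 derivable_pt_lim_exp_0 eps He) as [d1 [D1 B1]].
destruct (derivable_pt_lim_0_bound sin 1 derivable_pt_lim_sin_0 eps He) as [d2 [D2 B2]].
assert (Dc : derivable_pt_lim cos 0 0).
{ replace 0%R with (- sin 0)%R at 2 by (rewrite sin_0; ring). apply derivable_pt_lim_cos. }
destruct (derivable_pt_lim_0_bound cos 0 Dc eps He) as [d3 [D3 B3]].
exists (Rmin (Rmin d1 d2) (Rmin d3 eps)). split; [apply Rmin_pos; apply Rmin_pos; assumption |].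
intros h Hh. rewrite Cexp_0. replace (h - 0) with h in * by ring.
replace (Cexp h - 1 - h * 1) with (Cexp h - 1 - h) by ring.
assert (H1 := Rlt_le_trans _ _ _ Hh (Rle_trans _ _ _ (Rmin_l _ _) (Rmin_l _ _))).
assert (H2 := Rlt_le_trans _ _ _ Hh (Rle_trans _ _ _ (Rmin_l _ _) (Rmin_r _ _))).
assert (H3 := Rlt_le_trans _ _ _ Hh (Rle_trans _ _ _ (Rmin_r _ _) (Rmin_l _ _))).
assert (H4 := Rlt_le_trans _ _ _ Hh (Rle_trans _ _ _ (Rmin_r _ _) (Rmin_r _ _))).
assert (Hx := re_le_Cmod h).
assert (Hy : (Rabs (Im h) <= Cmod h)%R) by (eapply Rle_trans; [apply Rmax_r | apply Rmax_Cmod]).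
destruct h as [x y]. cbn [Re Im fst snd] in *.
set (m := Cmod (x, y)) in *.
specialize (B1 x ltac:(lra)). specialize (B2 y ltac:(lra)). specialize (B3 y ltac:(lra)).
rewrite exp_0 in B1. rewrite sin_0 in B2. rewrite cos_0 in B3.
assert (Px := Rabs_pos x). assert (Py := Rabs_pos y).
assert (E1 : (Rabs (exp x - 1) <= 2 * Rabs x)%R).
{ replace (exp x - 1)%R with ((exp x - 1 - 1 * x) + x)%R by ring.
  eapply Rle_trans; [apply Rabs_triang |]. nra. }
assert (E2 : (Rabs (exp x) <= 2)%R).
{ replace (exp x)%R with ((exp x - 1) + 1)%R by ring.
  eapply Rle_trans; [apply Rabs_triang |]. rewrite Rabs_R1. lra. }
eapply Rle_trans; [apply Cmod_le_Rabs |].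
assert (R1 : Re (Cexp (x, y) - 1 - (x, y)) = (exp x * (cos y - 1 - 0 * y) + (exp x - 1 - 1 * x))%R).
{ unfold Cexp, Re, Im, Cminus, Cplus, Copp, RtoC. cbn [fst snd]. ring. }
assert (R2 : Im (Cexp (x, y) - 1 - (x, y)) = (exp x * (sin y - 0 - 1 * y) + (exp x - 1) * y)%R).
{ unfold Cexp, Re, Im, Cminus, Cplus, Copp, RtoC. cbn [fst snd]. ring. }
rewrite R1, R2.
assert (S1 : (Rabs (exp x * (cos y - 1 - 0 * y) + (exp x - 1 - 1 * x)) <= 2 * (eps * m) + eps * m)%R).
{ eapply Rle_trans; [apply Rabs_triang |]. rewrite Rabs_mult. apply Rplus_le_compat.
  - apply Rmult_le_compat; try apply Rabs_pos; [exact E2 | nra].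
  - nra. }
assert (S2 : (Rabs (exp x * (sin y - 0 - 1 * y) + (exp x - 1) * y) <= 2 * (eps * m) + 2 * (eps * m))%R).
{ eapply Rle_trans; [apply Rabs_triang |]. rewrite !Rabs_mult. apply Rplus_le_compat.
  - apply Rmult_le_compat; try apply Rabs_pos; [exact E2 | nra].
  - apply Rle_trans with (2 * Rabs x * Rabs y)%R; [apply Rmult_le_compat_r; assumption |].
    assert (Rabs x * Rabs y <= eps * m)%R by (apply Rmult_le_compat; lra). lra. }
assert (Pm : (0 <= m)%R) by apply Cmod_ge_0.
assert (eps * m <= eps0 / 8 * m)%R by (apply Rmult_le_compat_r; assumption).
assert (0 <= eps0 * m)%R by (apply Rmult_le_pos; lra).
lra.
Qed.

Lemma is_Cderive_Cexp (z : C) : is_Cderive Cexp z (Cexp z).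
Proof.
apply (is_Cderive_ext_loc (fun y => Cexp z * Cexp (y - z)) _ _ _ 1); [lra | |].
- intros y _. rewrite <- Cexp_plus. f_equal. ring.
- eapply is_Cderive_eq.
  + apply is_Cderive_mult; [apply is_Cderive_const |].
    apply (is_Cderive_comp (fun y => y - z) Cexp).
    * apply is_Cderive_minus; [apply is_Cderive_id | apply is_Cderive_const].
    * replace (z - z) with (RtoC 0) by ring. apply is_Cderive_Cexp_0.
  + Cring.
Qed.

(** * The image of the disk under psi, and the inverse of psi *)

Lemma sqrt2_sqr : RtoC (sqrt 2) * RtoC (sqrt 2) = 2.
Proof. rewrite <- RtoC_mult, sqrt_sqrt by lra. reflexivity. Qed.

Lemma sqrt2_bounds : (sqrt 2 * sqrt 2 = 2 /\ 1.4142 < sqrt 2 < 1.4143)%R.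
Proof.
assert (E := sqrt_sqrt 2 ltac:(lra)). assert (P := sqrt_pos 2).
split; [exact E | split; nra].
Qed.

(* [psi] is [psi_min + (1+z)^2 / (k(k-z))], hence it covers [psi_min + v] iff
   [t = 1/(1+z)], which ranges over [Re t > 1/2], solves a quadratic equation with
   discriminant [psi_disc]. *)
Definition psi_min : C := 2 * RtoC (sqrt 2) - 2.

Definition psi_disc (om : C) : C := 1 + 4 * RtoC (sqrt 2) * / (om - psi_min).

(** With k = sqrt 2 + 1 and v = om - psi_min the quadratic is k (k + 1) t^2 - k t = 1/v. As (k +
    1)/k = sqrt 2, its roots are (1 + S)/(2 (k + 1)) and (1 - S)/(2 (k + 1)), S being the square
    root of [psi_disc]. Since Re S >= 0, only the first can have Re t > 1/2, and this says Re S >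
    k. *)
Definition psi_range (om : C) : Prop :=
  om - psi_min <> 0 /\ (sqrt 2 + 1 < Re (Csqrt (psi_disc om)))%R.

Definition psi_inv (om : C) : C :=
  2 * (RtoC (sqrt 2) + 2) * / (1 + Csqrt (psi_disc om)) - 1.

Lemma psi_alt (z : C) :
  RtoC (sqrt 2) + 1 - z <> 0 ->
  psi z = psi_min + (1 + z) * (1 + z) / ((RtoC (sqrt 2) + 1) * (RtoC (sqrt 2) + 1 - z)).
Proof.
intros H. unfold psi, psi_min. rewrite RtoC_plus.
assert (E := sqrt2_sqr). set (s := RtoC (sqrt 2)) in *.
assert (Hk : s + 1 <> 0).
{ intros Q. apply (f_equal Re) in Q. unfold s, Re, Cplus, RtoC in Q. cbn [fst] in Q.
  destruct sqrt2_bounds. lra. }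
replace ((s + 1) * (s + 1) - (s + 1) * z) with ((s + 1) * (s + 1 - z)) by ring.
set (D := (s + 1) * (s + 1 - z)).
assert (HD : D <> 0) by now apply Cmult_neq_0.
(* The claim cleared of denominators, as psi_min - 1 = 2 s - 3. *)
assert (ED : D * (2 * s - 3) = z * (s + 1) + z * z - (1 + z) * (1 + z)).
{ unfold D.
  replace ((s + 1) * (s + 1 - z) * (2 * s - 3)) with
    (z * (s + 1) + z * z - (1 + z) * (1 + z)
     + (s * s - 2) * (2 * s + 1 - 2 * z)) by ring. rewrite E. ring. }
replace (z * (s + 1) + z * z) with (D * (2 * s - 3) + (1 + z) * (1 + z)) by (rewrite ED; ring).
field. exact HD.
Qed.

Lemma disk_Re_plus1 (z : C) : disk z -> (0 < Re (1 + z))%R.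
Proof.
unfold disk. intros H. assert (Q := re_le_Cmod z). assert (Q' := Rle_abs (- Re z)).
rewrite Rabs_Ropp in Q'. unfold Re, Cplus, RtoC in *. cbn [fst] in *. lra.
Qed.

Lemma Re_pos_neq0 (z : C) : (0 < Re z)%R -> z <> 0.
Proof. intros H E. rewrite E in H. unfold Re, RtoC in H. simpl in H. lra. Qed.

Lemma sqrt2_plus1_sub_neq0 (z : C) : disk z -> RtoC (sqrt 2) + 1 - z <> 0.
Proof.
intros H. apply Re_pos_neq0. assert (Q := re_le_Cmod z). assert (Q' := Rle_abs (Re z)).
unfold disk, Re, Cminus, Cplus, Copp, RtoC in *. cbn [fst] in *. destruct sqrt2_bounds. lra.
Qed.

Lemma psi_range_psi (z : C) : disk z -> psi_range (psi z).
Proof.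
intros H. assert (Hkz := sqrt2_plus1_sub_neq0 z H).
assert (H1 := Re_pos_neq0 _ (disk_Re_plus1 z H)).
unfold psi_range, psi_disc. rewrite (psi_alt z Hkz).
assert (E := sqrt2_sqr). destruct sqrt2_bounds as [Es Bs].
set (s := RtoC (sqrt 2)) in *.
assert (Hk : s + 1 <> 0) by (apply Re_pos_neq0; unfold s, Re, Cplus, RtoC; simpl; lra).
replace (psi_min + (1 + z) * (1 + z) / ((s + 1) * (s + 1 - z)) - psi_min)
  with ((1 + z) * (1 + z) / ((s + 1) * (s + 1 - z))) by ring.
split.
{ unfold Cdiv. apply Cmult_neq_0; [now apply Cmult_neq_0 |].
  apply Cmod_gt_0. rewrite Cmod_inv by now apply Cmult_neq_0.
  apply Rinv_0_lt_compat. apply Cmod_gt_0. now apply Cmult_neq_0. }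
(* T = 2 (k + 1) t - 1 for t = 1/(1 + z); its square and the sign of its real part identify it as
   the principal root. *)
set (T := 2 * (s + 2) * / (1 + z) - 1).
assert (HT : (sqrt 2 + 1 < Re T)%R).
{ assert (P := disk_Re_plus1 z H). assert (Q := Cmod_sqr z). unfold disk in H. assert (Q0 := Cmod_ge_0 z).
  unfold T, s. destruct z as [x y]. unfold Re, Im, Cminus, Cplus, Copp, Cinv, Cmult, RtoC in *.
  cbn [fst snd] in *.
  set (c := sqrt 2) in *.
  replace ((2 * (c + 2) - 0 * (0 + 0)) * ((1 + x) / ((1 + x) ^ 2 + (0 + y) ^ 2))
    - (2 * (0 + 0) + 0 * (c + 2)) * (- (0 + y) / ((1 + x) ^ 2 + (0 + y) ^ 2)) + - (1))%R
    with ((c + 2) * (2 * (1 + x) / ((1 + x) ^ 2 + y ^ 2)) - 1)%R by (field; nra).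
  assert (1 < 2 * (1 + x) / ((1 + x) ^ 2 + y ^ 2))%R.
  { apply Rmult_lt_reg_r with ((1 + x) ^ 2 + y ^ 2)%R; [nra |].
    unfold Rdiv. rewrite Rmult_assoc, Rinv_l by nra. nra. }
  nra. }
rewrite (Csqrt_unique _ T); [exact HT | | lra].
unfold T.
replace ((2 * (s + 2) * / (1 + z) - 1) * (2 * (s + 2) * / (1 + z) - 1))
  with (1 + 4 * (s + 2) * (s + 1 - z) / ((1 + z) * (1 + z))) by (field; exact H1).
replace (s + 2) with (s * (s + 1)) by (replace (s * (s + 1)) with (s * s + s) by ring; rewrite E; ring).
field. repeat split; auto.
Qed.

Lemma psi_range_neq0 (om : C) : psi_range om -> 1 + Csqrt (psi_disc om) <> 0.
Proof.
intros [_ H]. apply Re_pos_neq0.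
unfold Re, Cplus, RtoC in *. cbn [fst] in *. destruct sqrt2_bounds. lra.
Qed.

(** psi_inv = (2 k + 1 - S)/(1 + S), and the line Re S = k is the perpendicular bisector of -1 and 2
    k + 1. *)
Lemma disk_psi_inv (om : C) : psi_range om -> disk (psi_inv om).
Proof.
intros H. assert (N := psi_range_neq0 om H). destruct H as [H0 H].
unfold psi_inv, disk. set (S := Csqrt (psi_disc om)) in *.
replace (2 * (RtoC (sqrt 2) + 2) * / (1 + S) - 1)
  with ((2 * RtoC (sqrt 2) + 3 - S) / (1 + S)) by (field; exact N).
rewrite Cmod_div by exact N. assert (P := proj1 (Cmod_gt_0 _) N).
apply Rmult_lt_reg_r with (Cmod (1 + S)); [exact P |].
unfold Rdiv. rewrite Rmult_assoc, Rinv_l, Rmult_1_r, Rmult_1_l by lra.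
assert (Q1 := Cmod_sqr (1 + S)). assert (Q2 := Cmod_sqr (2 * RtoC (sqrt 2) + 3 - S)).
assert (P2 := Cmod_ge_0 (2 * RtoC (sqrt 2) + 3 - S)).
destruct sqrt2_bounds as [Es Bs].
apply Rsqr_incrst_0; [| exact P2 | lra]. unfold Rsqr. rewrite Q1, Q2.
destruct S as [x y]. unfold Re, Im, Cminus, Cplus, Copp, Cmult, RtoC in *. cbn [fst snd] in *.
nra.
Qed.

Lemma psi_psi_inv (om : C) : psi_range om -> psi (psi_inv om) = om.
Proof.
intros H. assert (N := psi_range_neq0 om H).
rewrite psi_alt by (now apply sqrt2_plus1_sub_neq0, disk_psi_inv).
assert (Hz := sqrt2_plus1_sub_neq0 _ (disk_psi_inv om H)).
destruct H as [H0 H].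
assert (E := sqrt2_sqr). destruct sqrt2_bounds as [Es Bs].
assert (ES := Csqrt_sqr (psi_disc om)). unfold psi_disc at 3 in ES.
unfold psi_inv in *. set (S := Csqrt (psi_disc om)) in *.
set (s := RtoC (sqrt 2)) in *. set (v := om - psi_min) in *.
assert (Hk : s + 1 <> 0) by (apply Re_pos_neq0; unfold s, Re, Cplus, RtoC; simpl; lra).
assert (Hs : s <> 0) by (apply Re_pos_neq0; unfold s, Re, Cplus, RtoC; simpl; lra).
assert (Hk1 : s + 2 <> 0) by (apply Re_pos_neq0; unfold s, Re, Cplus, RtoC; simpl; lra).
assert (HS1 : S - 1 <> 0).
{ apply Re_pos_neq0. unfold Re, Cminus, Cplus, Copp, RtoC in *. cbn [fst] in *. lra. }
replace om with (psi_min + v) at 1 by (unfold v; ring).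
f_equal.
replace (s + 1 - (2 * (s + 2) * / (1 + S) - 1)) with ((s + 2) * (S - 1) / (1 + S)) by (field; exact N).
replace (1 + (2 * (s + 2) * / (1 + S) - 1)) with (2 * (s + 2) / (1 + S)) by (field; exact N).
assert (Ev : (S - 1) * (1 + S) * v = 4 * s).
{ replace ((S - 1) * (1 + S)) with (S * S - 1) by ring. rewrite ES. field. exact H0. }
assert (Ek : s * (s + 1) = s + 2) by (replace (s * (s + 1)) with (s * s + s) by ring; rewrite E; ring).
replace (2 * (s + 2) / (1 + S) * (2 * (s + 2) / (1 + S)) / ((s + 1) * ((s + 2) * (S - 1) / (1 + S))))
  with (4 * (s + 2) / ((s + 1) * ((S - 1) * (1 + S)))) by (field; repeat split; auto).
rewrite <- Ek.
replace (4 * (s * (s + 1)) / ((s + 1) * ((S - 1) * (1 + S))))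
  with (4 * s / ((S - 1) * (1 + S))) by (field; repeat split; auto).
rewrite <- Ev. field. split; auto.
Qed.

Lemma ex_derive_psi_inv (om : C) : psi_range om -> exists l, is_Cderive psi_inv om l.
Proof.
intros H. assert (N := psi_range_neq0 om H). destruct H as [H0 H].
eexists. unfold psi_inv. apply is_Cderive_minus; [| apply is_Cderive_const].
apply is_Cderive_mult; [apply is_Cderive_const |].
apply is_Cderive_inv; [exact N |].
apply is_Cderive_plus; [apply is_Cderive_const |].
apply (is_Cderive_comp psi_disc Csqrt).
- unfold psi_disc. apply is_Cderive_plus; [apply is_Cderive_const |].
  apply is_Cderive_mult; [apply is_Cderive_const |].
  apply is_Cderive_inv; [exact H0 |].
  apply is_Cderive_minus; [apply is_Cderive_id | apply is_Cderive_const].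
- apply is_Cderive_Csqrt. destruct sqrt2_bounds. lra.
Qed.

(** Makes the Schwarz function built from [psi_inv] vanish at 0. Here 1/(1 - psi_min) = 2 sqrt 2 + 3
    and psi_disc(1) = 17 + 12 sqrt 2 = (2 sqrt 2 + 3)^2. *)
Lemma psi_inv_1 : psi_inv 1 = 0.
Proof.
unfold psi_inv, psi_disc, psi_min.
assert (E := sqrt2_sqr). destruct sqrt2_bounds as [Es Bs].
rewrite (Csqrt_unique _ (2 * RtoC (sqrt 2) + 3)).
- set (s := RtoC (sqrt 2)) in *. field.
  apply Re_pos_neq0; unfold s, Re, Cplus, Cmult, RtoC; simpl; lra.
- set (s := RtoC (sqrt 2)) in *.
  assert (N : 1 - (2 * s - 2) <> 0).
  { apply Re_pos_neq0; unfold s, Re, Cminus, Cplus, Copp, Cmult, RtoC; simpl; lra. }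
  assert (I : / (1 - (2 * s - 2)) = 2 * s + 3).
  { replace (2 * s + 3) with ((1 - 4 * (s * s - 2)) / (1 - (2 * s - 2))) by (field; exact N).
    rewrite E. field. exact N. }
  rewrite I.
  replace ((2 * s + 3) * (2 * s + 3)) with (1 + 4 * s * (2 * s + 3) - 4 * (s * s - 2)) by ring.
  rewrite E. ring.
- unfold Re, Cplus, Cmult, RtoC; simpl; lra.
Qed.

(** The disc has psi_min on its boundary, so v -> 1/v maps it to the half-plane Re (1/v) > 1/(2 (2 -
    sqrt 2)), which is exactly Re psi_disc > k^2; [Re_Csqrt_gt] then gives Re S > k. *)
Lemma disc_psi_range (om : C) :
  (Cmod (om - RtoC (sqrt 2)) < 2 - sqrt 2)%R -> psi_range om.
Proof.
intros H. destruct sqrt2_bounds as [Es Bs].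
assert (Q := Cmod_sqr (om - RtoC (sqrt 2))). assert (P := Cmod_ge_0 (om - RtoC (sqrt 2))).
set (m := Cmod (om - RtoC (sqrt 2))) in *.
assert (Hm : (m * m < (2 - sqrt 2) * (2 - sqrt 2))%R) by nra.
rewrite Q in Hm. clear Q P H m.
destruct om as [x y].
set (c := sqrt 2) in *.
pose (v1 := (x - (2 * c - 2))%R).
assert (Hv : (v1 * v1 + y * y < 2 * (2 - c) * v1)%R).
{ unfold v1, Re, Im, Cminus, Cplus, Copp, RtoC in *. cbn [fst snd] in *. nra. }
assert (Hv1 : (0 < v1)%R) by nra.
assert (Ev : ((x, y) : C) - psi_min = (v1, y)).
{ unfold psi_min, v1. fold c. unfold Cminus, Cplus, Copp, Cmult, RtoC. cbn [fst snd]. f_equal; ring. }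
split.
{ rewrite Ev. now apply Re_pos_neq0. }
apply Re_Csqrt_gt; fold c; [lra |].
unfold psi_disc. rewrite Ev. fold c.
unfold Re, Cinv, Cminus, Cplus, Copp, Cmult, RtoC in *. cbn [fst snd] in *.
replace (1 + ((4 * c - 0 * 0) * (v1 / (v1 ^ 2 + y ^ 2)) - (4 * 0 + 0 * c) * (- y / (v1 ^ 2 + y ^ 2))))%R
  with (1 + 4 * c * v1 / (v1 * v1 + y * y))%R by (field; nra).
assert (Hd : (0 < v1 * v1 + y * y)%R) by nra.
cut (2 * c + 2 < 4 * c * v1 / (v1 * v1 + y * y))%R; [nra |].
apply Rmult_lt_reg_r with (v1 * v1 + y * y)%R; [exact Hd |].
unfold Rdiv. rewrite Rmult_assoc, Rinv_l, Rmult_1_r by lra.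
assert ((2 * c + 2) * (v1 * v1 + y * y) < (2 * c + 2) * (2 * (2 - c) * v1))%R
  by (apply Rmult_lt_compat_l; lra).
nra.
Qed.

Lemma subordinate_psi (q : C -> C) :
  analytic q -> q 0 = 1 -> (forall z, disk z -> psi_range (q z)) -> subordinate q psi.
Proof.
intros Hq H0 H. exists (fun z => psi_inv (q z)). repeat split.
- intros z Hz. destruct (Hq z Hz) as [l Hl].
  destruct (ex_derive_psi_inv (q z) (H z Hz)) as [m Hm].
  eexists. now apply (is_Cderive_comp q psi_inv z l m).
- intros z Hz. apply disk_psi_inv. now apply H.
- now rewrite H0, psi_inv_1.
- intros z Hz. symmetry. apply psi_psi_inv. now apply H.
Qed.

(** * Reduction to an estimate of the logarithmic derivative *)

Definition is_log_ratio (f Q : C -> C) : Prop :=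
  analytic Q /\ Q 0 = 1 /\
  forall z, disk z -> z <> 0 -> f z <> 0 /\ Q z = z * C_derive f z / f z.

Lemma disk_scal (r : R) (z : C) : (0 < r <= 1)%R -> disk z -> disk (r * z).
Proof.
unfold disk. intros Hr Hz. rewrite Cmod_mult, Cmod_R, Rabs_pos_eq by lra.
assert (P := Cmod_ge_0 z). nra.
Qed.

Lemma RtoC_neq0 (r : R) : (r <> 0)%R -> RtoC r <> 0.
Proof. intros H Q. apply H. now injection Q. Qed.

Lemma is_Cderive_dilate (f : C -> C) (r : R) (z : C) :
  analytic f -> (0 < r <= 1)%R -> disk z ->
  is_Cderive (fun y => f (r * y) / r) z (C_derive f (r * z)).
Proof.
intros Hf Hr Hz. eapply is_Cderive_eq.
- apply is_Cderive_mult; [| apply is_Cderive_const].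
  apply (is_Cderive_comp (fun y => r * y) f).
  + apply is_Cderive_mult; [apply is_Cderive_const | apply is_Cderive_id].
  + apply (is_Cderive_C_derive 1); [exact Hf | now apply disk_scal].
- Cfield. apply RtoC_neq0. lra.
Qed.

Lemma psi_0 : psi 0 = 1.
Proof.
unfold psi. rewrite RtoC_plus. field. repeat split.
apply Re_pos_neq0. destruct sqrt2_bounds. unfold Re, Cplus, RtoC; simpl; lra.
Qed.

(** The quotient belonging to f(r z)/r is Q(r z), so membership of all dilations becomes a condition
    on the values of the single function [Q]. The forward direction uses only r = s. *)
Lemma property_up_to_SR (f Q : C -> C) (s : R) :
  class_A f -> is_log_ratio f Q ->
  (property_up_to class_SR f s <->
   (0 < s <= 1)%R /\ forall z, (Cmod z < s)%R -> psi_range (Q z)).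
Proof.
intros [Af [f0 Df]] [AQ [Q0 HQ]].
assert (D : forall r z, (0 < r <= 1)%R -> disk z ->
  C_derive (fun y => f (r * y) / r) z = C_derive f (r * z)).
{ intros r z Hr Hz. apply is_C_derive_unique. now apply is_Cderive_dilate. }
split.
- intros [Hs H]. split; [exact Hs |].
  destruct (H s ltac:(lra)) as [_ [q [[_ Hq] [w [_ [Hw [_ Hqw]]]]]]].
  intros z Hz. destruct (Ceq_dec z 0) as [-> | Hz0].
  { rewrite Q0, <- psi_0. apply psi_range_psi. unfold disk. rewrite Cmod_0. lra. }
  assert (Hsn : RtoC s <> 0) by (apply RtoC_neq0; lra).
  assert (Hz1 : disk (z / s)).
  { unfold disk. rewrite Cmod_div, Cmod_R, Rabs_pos_eq by (assumption || lra).
    apply Rmult_lt_reg_r with s; [lra |]. unfold Rdiv. rewrite Rmult_assoc, Rinv_l; lra. }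
  assert (Ez : s * (z / s) = z) by (field; exact Hsn).
  assert (Hn : z / s <> 0).
  { intros E. apply Hz0. rewrite <- Ez, E. ring. }
  assert (E := proj2 (Hq _ Hz1 Hn)). rewrite Hqw in E by exact Hz1.
  rewrite (D s _ Hs Hz1), Ez in E.
  destruct (HQ z ltac:(unfold disk; lra) Hz0) as [Nf EQ].
  replace (Q z) with (psi (w (z / s))); [apply psi_range_psi; now apply Hw |].
  rewrite E, EQ. field. now split.
- intros [Hs H]. split; [exact Hs |]. intros r Hr.
  assert (Hr1 : (0 < r <= 1)%R) by lra.
  assert (Hrn : RtoC r <> 0) by (apply RtoC_neq0; lra).
  assert (E0 : r * 0 = (0 : C)) by ring.
  split; [split; [| split] |].
  + intros z Hz. eexists. now apply is_Cderive_dilate.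
  + rewrite E0, f0. field. exact Hrn.
  + rewrite D, E0 by (auto; unfold disk; rewrite Cmod_0; lra). exact Df.
  + assert (AQr : analytic (fun z => Q (r * z))).
    { intros z Hz. destruct (AQ (r * z) (disk_scal r z Hr1 Hz)) as [l Hl].
      eexists. apply (is_Cderive_comp (fun y => r * y) Q); [| exact Hl].
      apply is_Cderive_mult; [apply is_Cderive_const | apply is_Cderive_id]. }
    exists (fun z => Q (r * z)). split; [split; [exact AQr |] |].
    * intros z Hz Hz0.
      destruct (HQ (r * z) (disk_scal r z Hr1 Hz) (Cmult_neq_0 _ _ Hrn Hz0)) as [Nf EQ].
      split.
      -- unfold Cdiv. apply Cmult_neq_0; [exact Nf |].
         intros E. apply Hrn. rewrite <- (Cmult_1_r r).
         replace (RtoC 1) with (r * / r) by (field; exact Hrn). rewrite E. ring.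
      -- rewrite D, EQ by assumption. field. now split.
    * apply subordinate_psi; [exact AQr | now rewrite E0 |].
      intros z Hz. apply H. unfold disk in Hz.
      rewrite Cmod_mult, Cmod_R, Rabs_pos_eq by lra. assert (P := Cmod_ge_0 z). nra.
Qed.

(** The supremum is attained: the open disc of radius [m] is the union of the discs of admissible
    radius, and a condition on values of [Q] passes to unions. *)
Lemma largest_radius_exists (f Q : C -> C) (r0 : R) :
  class_A f -> is_log_ratio f Q -> property_up_to class_SR f r0 ->
  exists rho, is_largest_radius class_SR f rho.
Proof.
intros Af HQ H0.
destruct (completeness (property_up_to class_SR f)) as [m [Ub Lub]].
- exists 1%R. intros s [Hs _]. lra.
- now exists r0.
- exists m. split; [| exact Ub].
  apply (property_up_to_SR f Q m Af HQ). split.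
  + split.
    * destruct H0 as [H0 H0']. specialize (Ub r0 (conj H0 H0')). lra.
    * apply Lub. intros s [Hs _]. lra.
  + intros z Hz.
    destruct (classic (exists s, property_up_to class_SR f s /\ (Cmod z < s)%R)) as [[s [Hs Hzs]] | N].
    * apply (property_up_to_SR f Q s Af HQ) in Hs. now apply Hs.
    * exfalso. apply (Rlt_not_le _ _ Hz). apply Lub. intros s Hs.
      apply Rnot_lt_le. intros Hlt. apply N. now exists s.
Qed.

(** Every largest radius is at least [r0], and that of the extremal function equals it: a larger
    disc contains - r0, where [Q] takes the value psi_min, outside [psi_range]. The infimum is thus
    a minimum. *)
Lemma is_class_radius_SR (M : (C -> C) -> Prop) (r0 : R) :
  (0 < r0 <= 1)%R ->
  (forall f, M f -> class_A f /\ exists Q, is_log_ratio f Q /\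
     forall z, (Cmod z < r0)%R -> psi_range (Q z)) ->
  (exists f Q, M f /\ is_log_ratio f Q /\ Q (- r0) = psi_min) ->
  is_class_radius class_SR M r0.
Proof.
intros Hr0 HM [f0 [Q0 [Mf0 [HQ0 E0]]]].
assert (Prop0 : forall f, M f -> property_up_to class_SR f r0).
{ intros f Hf. destruct (HM f Hf) as [Af [Q [HQ H]]].
  now apply (property_up_to_SR f Q r0 Af HQ). }
split.
- intros f Hf. destruct (HM f Hf) as [Af [Q [HQ _]]].
  apply (largest_radius_exists f Q r0); auto.
- split.
  + intros rho [f [Hf [_ Hl]]]. apply Hl. now apply Prop0.
  + intros b Hb. apply Hb. exists f0. split; [exact Mf0 |].
    split; [now apply Prop0 |].
    intros s Hs. apply Rnot_lt_le. intros Hlt.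
    destruct (HM f0 Mf0) as [Af0 _].
    apply (property_up_to_SR f0 Q0 s Af0 HQ0) in Hs. destruct Hs as [_ Hs].
    destruct (Hs (- r0)) as [Hn _].
    { rewrite Cmod_opp, Cmod_R, Rabs_pos_eq; lra. }
    apply Hn. rewrite E0. ring.
Qed.

(** * Logarithmic derivatives of products of compositions with Schwarz functions *)

Definition schwarz_fun (w : C -> C) : Prop :=
  analytic w /\ (forall z, disk z -> disk (w z)) /\ w 0 = 0.

Definition log_derivative (h L : C -> C) : Prop :=
  analytic L /\ h 0 = 1 /\ forall z, disk z -> h z <> 0 /\ is_Cderive h z (L z * h z).

(** The contribution z (h o w)'/(h o w) of one factor to z f'/f. *)
Definition log_term (L w : C -> C) (z : C) : C := z * C_derive w z * L (w z).

Lemma analytic_log_term (h L w : C -> C) :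
  log_derivative h L -> schwarz_fun w -> analytic (log_term L w).
Proof.
intros [AL _] [Aw [Hw _]] z Hz.
destruct (holo_C_derive 1 w Aw z Hz) as [l Hl].
destruct (AL (w z) (Hw z Hz)) as [m Hm].
eexists. apply is_Cderive_mult.
- apply is_Cderive_mult; [apply is_Cderive_id | exact Hl].
- apply (is_Cderive_comp w L); [| exact Hm]. now apply (is_Cderive_C_derive 1).
Qed.

Lemma is_Cderive_log_comp (h L w : C -> C) (z : C) :
  log_derivative h L -> schwarz_fun w -> disk z ->
  is_Cderive (fun y => h (w y)) z (C_derive w z * L (w z) * h (w z)).
Proof.
intros [_ [_ Hh]] [Aw [Hw _]] Hz. eapply is_Cderive_eq.
- apply (is_Cderive_comp w h).
  + now apply (is_Cderive_C_derive 1).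
  + apply Hh. now apply Hw.
- Cring.
Qed.

Lemma analytic_log_comp (h L w : C -> C) :
  log_derivative h L -> schwarz_fun w -> analytic (fun z => h (w z)).
Proof. intros Hh Hw z Hz. eexists. now apply (is_Cderive_log_comp h L). Qed.

Definition product_log_ratio (Lh Lu w1 w2 w3 : C -> C) (z : C) : C :=
  1 + (log_term Lu w3 z + log_term Lh w1 z + log_term Lh w2 z).

Lemma is_Cderive_product (h u Lh Lu f w1 w2 w3 : C -> C) (z : C) :
  log_derivative h Lh -> log_derivative u Lu ->
  schwarz_fun w1 -> schwarz_fun w2 -> schwarz_fun w3 ->
  (forall z, disk z -> f z = z * u (w3 z) * h (w1 z) * h (w2 z)) -> disk z ->
  is_Cderive f z
    (product_log_ratio Lh Lu w1 w2 w3 z * (u (w3 z) * h (w1 z) * h (w2 z))).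
Proof.
intros Hh Hu H1 H2 H3 Ef Hz.
apply (is_Cderive_ext_loc (fun z => z * u (w3 z) * h (w1 z) * h (w2 z)) _ _ _ (1 - Cmod z)).
- unfold disk in Hz. lra.
- intros y Hy. symmetry. apply Ef. unfold disk.
  assert (T := Cmod_triangle (y - z) z). replace (y - z + z) with y in T by ring. lra.
- eapply is_Cderive_eq.
  + apply is_Cderive_mult; [| now apply (is_Cderive_log_comp h Lh w2)].
    apply is_Cderive_mult; [| now apply (is_Cderive_log_comp h Lh w1)].
    apply is_Cderive_mult; [| now apply (is_Cderive_log_comp u Lu w3)].
    apply is_Cderive_id.
  + unfold product_log_ratio, log_term. Cring.
Qed.

Lemma is_log_ratio_product (h u Lh Lu f w1 w2 w3 : C -> C) :
  log_derivative h Lh -> log_derivative u Lu ->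
  schwarz_fun w1 -> schwarz_fun w2 -> schwarz_fun w3 ->
  (forall z, disk z -> f z = z * u (w3 z) * h (w1 z) * h (w2 z)) ->
  is_log_ratio f (product_log_ratio Lh Lu w1 w2 w3).
Proof.
intros Hh Hu H1 H2 H3 Ef. split; [| split].
- intros z Hz.
  destruct (analytic_log_term h Lh w1 Hh H1 z Hz) as [l1 D1].
  destruct (analytic_log_term h Lh w2 Hh H2 z Hz) as [l2 D2].
  destruct (analytic_log_term u Lu w3 Hu H3 z Hz) as [l3 D3].
  eexists. apply is_Cderive_plus; [apply is_Cderive_const |].
  apply is_Cderive_plus; [| exact D2]. apply is_Cderive_plus; [exact D3 | exact D1].
- unfold product_log_ratio, log_term. ring.
- intros z Hz Hz0.
  rewrite (is_C_derive_unique _ _ _ (is_Cderive_product h u Lh Lu f w1 w2 w3 z Hh Hu H1 H2 H3 Ef Hz)).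
  rewrite (Ef z Hz).
  destruct Hh as [_ [_ Hh]]. destruct Hu as [_ [_ Hu]].
  destruct H1 as [_ [H1 _]]. destruct H2 as [_ [H2 _]]. destruct H3 as [_ [H3 _]].
  assert (N1 := proj1 (Hh _ (H1 z Hz))). assert (N2 := proj1 (Hh _ (H2 z Hz))).
  assert (N3 := proj1 (Hu _ (H3 z Hz))).
  split; [repeat apply Cmult_neq_0; assumption |]. field. repeat split; assumption.
Qed.

Lemma class_T_product (h u f : C -> C) :
  class_T h u f -> exists w1 w2 w3, schwarz_fun w1 /\ schwarz_fun w2 /\ schwarz_fun w3 /\
  forall z, disk z -> f z = z * u (w3 z) * h (w1 z) * h (w2 z).
Proof.
intros [[_ [f0 _]] [g [p [_ [_ [[w3 [A3 [D3 [Z3 E3]]]]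
  [[q1 [[_ Q1] [w1 [A1 [D1 [Z1 E1]]]]]] [q2 [[_ Q2] [w2 [A2 [D2 [Z2 E2]]]]]]]]]]]]].
exists w1, w2, w3. repeat (split; [now split |]).
(* The quotient relations say nothing at 0, but there both sides vanish. *)
intros z Hz. destruct (Ceq_dec z 0) as [-> | Hz0].
{ rewrite f0. ring. }
destruct (Q1 z Hz Hz0) as [Ng Eq1]. destruct (Q2 z Hz Hz0) as [Np Eq2].
rewrite <- E1, <- E2, <- E3, Eq1, Eq2 by exact Hz. field. repeat split.
- intros E. apply Np. rewrite E. ring.
- exact Hz0.
- exact Ng.
Qed.

Lemma schwarz_fun_id : schwarz_fun (fun z => z).
Proof.
split; [| now split]. intros z _. eexists. apply is_Cderive_id.
Qed.

(** The member of the class for which all three Schwarz functions are the identity. *)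
Definition extremal (h u : C -> C) (z : C) : C := z * u z * h z * h z.

Lemma class_T_extremal (h u Lh Lu : C -> C) :
  log_derivative h Lh -> log_derivative u Lu -> class_T h u (extremal h u).
Proof.
intros Hh Hu. assert (I := schwarz_fun_id).
assert (Ah : analytic h) by exact (analytic_log_comp h Lh _ Hh I).
assert (Au : analytic u) by exact (analytic_log_comp u Lu _ Hu I).
assert (Sub : forall v, subordinate v v).
{ intros v. exists (fun z => z). destruct I as [I1 [I2 I3]]. now repeat split. }
assert (Hh' := Hh). assert (Hu' := Hu).
destruct Hh' as [_ [h0 Nh]]. destruct Hu' as [_ [u0 Nu]].
assert (d0 : disk 0) by (unfold disk; rewrite Cmod_0; lra).
assert (Dg : forall z, disk z -> is_Cderive (fun z => z * u z * h z) z
   (u z * h z + z * (Lu z * u z) * h z + z * u z * (Lh z * h z))).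
{ intros z Hz. eapply is_Cderive_eq.
  - apply is_Cderive_mult; [| now apply Nh]. apply is_Cderive_mult; [| now apply Nu].
    apply is_Cderive_id.
  - Cring. }
split; [split; [| split] | exists (fun z => z * u z * h z), u; split; [split; [| split] |]].
- intros z Hz. eexists. apply is_Cderive_mult; [now apply Dg | now apply Nh].
- unfold extremal. ring.
- apply is_C_derive_unique. eapply is_Cderive_eq.
  + apply is_Cderive_mult; [now apply Dg | now apply Nh].
  + cbv beta. rewrite h0, u0. Cring.
- intros z Hz. eexists. now apply Dg.
- ring.
- apply is_C_derive_unique. eapply is_Cderive_eq; [now apply Dg |]. rewrite h0, u0. Cring.
- split; [exact Au |]. split; [apply Sub |]. split.
  + exists h. split; [split; [exact Ah |] | apply Sub].
    intros z Hz Hz0. assert (N1 := proj1 (Nh z Hz)). assert (N2 := proj1 (Nu z Hz)).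
    split; [repeat apply Cmult_neq_0; assumption |]. unfold extremal. field. now repeat split.
  + exists h. split; [split; [exact Ah |] | apply Sub].
    intros z Hz Hz0. assert (N1 := proj1 (Nh z Hz)). assert (N2 := proj1 (Nu z Hz)).
    split; [repeat apply Cmult_neq_0; assumption |]. field. now repeat split.
Qed.

(** Separates the two halves of each radius problem: a disc estimate, with the disc about sqrt 2
    shifted by the constant term 1 of z f'/f, and the equation by which [extremal] reaches psi_min
    at - r0. *)
Theorem class_T_radius (h u Lh Lu : C -> C) (r0 : R) :
  log_derivative h Lh -> log_derivative u Lu -> (0 < r0 <= 1)%R ->
  (forall w1 w2 w3 z, schwarz_fun w1 -> schwarz_fun w2 -> schwarz_fun w3 ->
    (Cmod z < r0)%R ->
    (Cmod (log_term Lu w3 z + log_term Lh w1 z + log_term Lh w2 z - (RtoC (sqrt 2) - 1))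
       < 2 - sqrt 2)%R) ->
  1 - r0 * (Lu (- r0) + 2 * Lh (- r0)) = psi_min ->
  is_class_radius class_SR (class_T h u) r0.
Proof.
intros Hh Hu Hr H E. apply is_class_radius_SR; [exact Hr | |].
- intros f Hf. split; [apply Hf |].
  destruct (class_T_product h u f Hf) as [w1 [w2 [w3 [H1 [H2 [H3 Ef]]]]]].
  exists (product_log_ratio Lh Lu w1 w2 w3). split; [now apply (is_log_ratio_product h u) |].
  intros z Hz. apply disc_psi_range. unfold product_log_ratio.
  specialize (H w1 w2 w3 z H1 H2 H3 Hz).
  replace (1 + (log_term Lu w3 z + log_term Lh w1 z + log_term Lh w2 z) - RtoC (sqrt 2))
    with (log_term Lu w3 z + log_term Lh w1 z + log_term Lh w2 z - (RtoC (sqrt 2) - 1)) by ring.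
  exact H.
- assert (I := schwarz_fun_id).
  exists (extremal h u), (product_log_ratio Lh Lu (fun z => z) (fun z => z) (fun z => z)).
  split; [now apply (class_T_extremal h u Lh Lu) |]. split.
  + apply (is_log_ratio_product h u); auto.
  + rewrite <- E. unfold product_log_ratio, log_term.
    rewrite (is_C_derive_unique (fun z => z) _ 1) by apply is_Cderive_id. ring.
Qed.

(** * The three radii *)

Definition Cexp_log (_ : C) : C := 1.

Definition sqrt_1p_log (z : C) : C := / (2 * (1 + z)).

Definition crescent_log (z : C) : C := / Csqrt (1 + z * z).

Lemma log_derivative_Cexp : log_derivative Cexp Cexp_log.
Proof.
split; [| split].
- intros z _. eexists. apply is_Cderive_const.
- apply Cexp_0.
- intros z _. split; [apply Cexp_neq0 |].
  eapply is_Cderive_eq; [apply is_Cderive_Cexp | unfold Cexp_log; Cring].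
Qed.

Lemma two_mult_neq0 (z : C) : z <> 0 -> 2 * z <> 0.
Proof. intros H. apply Cmult_neq_0; [apply RtoC_neq0; lra | exact H]. Qed.

Lemma Re_Csqrt_pos (z : C) : (0 < Re z)%R -> (0 < Re (Csqrt z))%R.
Proof. intros H. apply Re_Csqrt_gt; lra. Qed.

Lemma log_derivative_sqrt_1p : log_derivative sqrt_1p sqrt_1p_log.
Proof.
split; [| split].
- intros z Hz. eexists. apply is_Cderive_inv.
  + apply two_mult_neq0, Re_pos_neq0, disk_Re_plus1, Hz.
  + apply is_Cderive_mult; [apply is_Cderive_const |].
    apply is_Cderive_plus; [apply is_Cderive_const | apply is_Cderive_id].
- unfold sqrt_1p. apply Csqrt_unique; [ring | simpl; lra].
- intros z Hz. assert (P := Re_Csqrt_pos _ (disk_Re_plus1 z Hz)).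
  assert (N := Re_pos_neq0 _ P). assert (N1 := Re_pos_neq0 _ (disk_Re_plus1 z Hz)).
  split; [exact N |].
  eapply is_Cderive_eq.
  + apply (is_Cderive_comp (fun y => 1 + y) Csqrt); [| now apply is_Cderive_Csqrt].
    apply is_Cderive_plus; [apply is_Cderive_const | apply is_Cderive_id].
  + unfold sqrt_1p, sqrt_1p_log. assert (E := Csqrt_sqr (1 + z)).
    set (s := Csqrt (1 + z)) in *. rewrite <- E. Cfield. exact N.
Qed.

Lemma disk_Re_plus1_sqr (z : C) : disk z -> (0 < Re (1 + z * z))%R.
Proof.
intros H. apply disk_Re_plus1. unfold disk in *. rewrite Cmod_mult.
assert (P := Cmod_ge_0 z). nra.
Qed.

(** With S = sqrt(1 + z^2), (z + S)(S - z) = 1 excludes zeros, and the derivative 1 + z/S equals (z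
    + S)/S. *)
Lemma log_derivative_crescent : log_derivative crescent crescent_log.
Proof.
assert (D : forall z, disk z -> is_Cderive (fun y => Csqrt (1 + y * y)) z (z / Csqrt (1 + z * z))).
{ intros z Hz. assert (P := Re_Csqrt_pos _ (disk_Re_plus1_sqr z Hz)).
  assert (N := Re_pos_neq0 _ P). eapply is_Cderive_eq.
  - apply (is_Cderive_comp (fun y => 1 + y * y) Csqrt); [| now apply is_Cderive_Csqrt].
    apply is_Cderive_plus; [apply is_Cderive_const |].
    apply is_Cderive_mult; apply is_Cderive_id.
  - Cfield. exact N. }
split; [| split].
- intros z Hz. eexists. apply is_Cderive_inv; [| now apply D].
  apply Re_pos_neq0, Re_Csqrt_pos, disk_Re_plus1_sqr, Hz.
- unfold crescent. rewrite (Csqrt_unique _ 1); [ring | ring | simpl; lra].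
- intros z Hz. assert (P := Re_Csqrt_pos _ (disk_Re_plus1_sqr z Hz)).
  assert (N := Re_pos_neq0 _ P). split.
  + intros E. unfold crescent in E.
    assert (F : (z + Csqrt (1 + z * z)) * (Csqrt (1 + z * z) - z) = 1).
    { replace ((z + Csqrt (1 + z * z)) * (Csqrt (1 + z * z) - z))
        with (Csqrt (1 + z * z) * Csqrt (1 + z * z) - z * z) by ring.
      rewrite Csqrt_sqr. ring. }
    rewrite E in F. apply (RtoC_neq0 1 R1_neq_R0). rewrite <- F. ring.
  + unfold crescent, crescent_log. eapply is_Cderive_eq.
    * apply is_Cderive_plus; [apply is_Cderive_id | now apply D].
    * Cfield. exact N.
Qed.

(** With r = |z| and x = |w|, Dieudonne's inequality bounds |z w'| by x + (r^2 - x^2)/(1 - r^2), and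
    r minus this has the sign of (r - x)(1 - r^2 - r - x). For x <= r <= 2/5 the last factor is
    positive. *)
Lemma log_term_1_le (w : C -> C) (z : C) :
  schwarz_fun w -> (Cmod z <= 2 / 5)%R -> (Cmod (log_term Cexp_log w z) <= Cmod z)%R.
Proof.
intros [Aw [Dw w0]] Hz. unfold log_term, Cexp_log. rewrite Cmult_1_r.
destruct (dieudonne w z Aw Dw w0 ltac:(unfold disk; lra)) as [H1 H2].
assert (Pz := Cmod_ge_0 z). assert (Pw := Cmod_ge_0 (w z)).
assert (T := Cmod_triangle (z * C_derive w z - w z) (w z)).
replace (z * C_derive w z - w z + w z) with (z * C_derive w z) in T by ring.
set (r := Cmod z) in *. set (x := Cmod (w z)) in *.
set (d := Cmod (z * C_derive w z - w z)) in *.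
apply (Rle_trans _ _ _ T).
apply Rmult_le_reg_r with (1 - r * r)%R; [nra |].
assert (0 <= (r - x) * (1 - r * r - r - x))%R by (apply Rmult_le_pos; nra).
nra.
Qed.

(** The Dieudonne bound factors, x (1 - r^2) + r^2 - x^2 = (1 - x)(x + r^2). Here 1 - x <= |1 + w|
    cancels the denominator, and x + r^2 <= r (1 + r). *)
Lemma log_term_inv_1p_le (w : C -> C) (z : C) :
  schwarz_fun w -> disk z ->
  (Cmod (z * C_derive w z / (1 + w z)) * (1 - Cmod z) <= Cmod z)%R.
Proof.
intros [Aw [Dw w0]] Hz.
destruct (dieudonne w z Aw Dw w0 Hz) as [H1 H2].
assert (Hwz := Dw z Hz). unfold disk in *.
assert (N := Re_pos_neq0 _ (disk_Re_plus1 _ Hwz)).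
assert (Pz := Cmod_ge_0 z). assert (Pw := Cmod_ge_0 (w z)).
assert (T := Cmod_triangle (z * C_derive w z - w z) (w z)).
replace (z * C_derive w z - w z + w z) with (z * C_derive w z) in T by ring.
assert (T2 := Cmod_triangle (1 + w z) (- w z)).
replace (1 + w z + - w z) with (RtoC 1) in T2 by ring. rewrite Cmod_1, Cmod_opp in T2.
rewrite Cmod_div by exact N.
set (m := Cmod (1 + w z)) in *.
set (r := Cmod z) in *. set (x := Cmod (w z)) in *.
set (d := Cmod (z * C_derive w z - w z)) in *.
set (e := Cmod (z * C_derive w z)) in *.
assert (Hm : (0 < m)%R) by lra.
apply Rmult_le_reg_r with (m * (1 + r))%R; [nra |].
replace (e / m * (1 - r) * (m * (1 + r)))%R with (e * (1 - r * r))%R by (field; lra).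
assert (e * (1 - r * r) <= (d + x) * (1 - r * r))%R by (apply Rmult_le_compat_r; nra).
assert (e * (1 - r * r) <= (1 - x) * (x + r * r))%R by lra.
assert ((1 - x) * (x + r * r) <= (1 - x) * (r * (1 + r)))%R by (apply Rmult_le_compat_l; nra).
assert ((1 - x) * (r * (1 + r)) <= m * (r * (1 + r)))%R by (apply Rmult_le_compat_r; nra).
nra.
Qed.

(* Away from the direction of [-1], [|w / sqrt(1+w^2)|] may exceed its value at [-|w|]
   by a third-order term, which the shift by [b] absorbs. *)
Lemma Cmod_crescent_shift_le (y : C) (x2 Y b : R) :
  (0 <= Y <= 1 / 10)%R -> (1 / 10 <= b)%R -> (Y * Y * (1 + x2) = x2)%R -> (0 <= x2 <= 1 / 100)%R ->
  (Cmod y * Cmod y = x2 * Cmod (1 - y * y)%C)%R -> (Cmod y * Cmod y <= 1 / 10)%R ->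
  (Cmod (y - RtoC b) <= b + Y)%R.
Proof.
intros HY Hb EY Hx Ey Hy.
assert (E2 := Cmod_sqr y). assert (E3 := Cmod_sqr (1 - y * y)).
assert (P3 := Cmod_ge_0 (1 - y * y)).
set (n := Cmod (1 - y * y)) in *. set (R2 := (Cmod y * Cmod y)%R) in *.
apply Rsqr_incr_0; [| apply Cmod_ge_0 | lra]. unfold Rsqr. rewrite Cmod_sqr.
destruct y as [p q]. unfold Re, Im, Cminus, Cplus, Copp, Cmult, RtoC in *. cbn [fst snd] in *.
assert (En : (n * n = (1 - R2) * (1 - R2) + 4 * (q * q))%R) by (rewrite E3, E2; ring).
assert (Pq : (0 <= q * q)%R) by nra.
(* sqrt(A^2 + 4 q^2) <= A + (9/4) q^2 for A = 1 - R2 >= 9/10, since (9/2) A >= 4. *)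
assert (Hn : (n <= (1 - R2) + 9 / 4 * (q * q))%R).
{ assert (0 <= q * q * (9 / 2 * (1 - R2) - 4))%R by (apply Rmult_le_pos; lra).
  assert (0 <= (q * q) * (q * q))%R by (apply Rmult_le_pos; lra).
  apply Rsqr_incr_0; [| exact P3 | lra]. unfold Rsqr. rewrite En. lra. }
assert (K : (R2 - Y * Y <= 9 / 4 * (Y * Y) * (q * q))%R).
{ assert (x2 * n <= x2 * (1 - R2 + 9 / 4 * (q * q)))%R by (apply Rmult_le_compat_l; lra).
  apply Rmult_le_reg_r with (1 + x2)%R; [lra |].
  replace ((R2 - Y * Y) * (1 + x2))%R with (R2 * (1 + x2) - Y * Y * (1 + x2))%R by ring.
  replace (9 / 4 * (Y * Y) * (q * q) * (1 + x2))%R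
    with (9 / 4 * (q * q) * (Y * Y * (1 + x2)))%R by ring.
  rewrite EY. lra. }
assert (HYY : (0 <= Y * Y <= 1 / 100)%R) by (split; nra).
assert (E4 : (R2 = p * p + q * q)%R) by exact E2.
assert (Hp : (9 / 10 * (q * q) <= (Y - p) * (Y + p))%R).
{ assert (9 / 4 * (Y * Y) * (q * q) <= 9 / 4 * (1 / 100) * (q * q))%R
    by (apply Rmult_le_compat_r; lra). lra. }
assert (HpY : (- Y <= p <= Y)%R).
{ assert (p * p <= Y * Y)%R by lra. split; nra. }
(* The goal amounts to R2 - Y^2 <= 2 b (Y + p). The left side is at most (9/4) Y^2 q^2, and q^2 is
   at most (20/9) Y (Y + p), which together give 5 Y^3 (Y + p). *)
assert (L : (9 / 10 * (q * q) <= 2 * Y * (Y + p))%R).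
{ apply (Rle_trans _ _ _ Hp). apply Rmult_le_compat_r; lra. }
assert (L2 : (9 / 4 * (Y * Y) * (q * q) <= 9 / 4 * (Y * Y) * (20 / 9 * Y * (Y + p)))%R).
{ apply Rmult_le_compat_l; lra. }
assert (L3 : (5 * (Y * Y * Y) <= 2 * b)%R).
{ assert (Y * Y * Y <= 1 / 100 * (1 / 10))%R by (apply Rmult_le_compat; lra). lra. }
assert (L4 : (5 * (Y * Y * Y) * (Y + p) <= 2 * b * (Y + p))%R) by (apply Rmult_le_compat_r; lra).
nra.
Qed.

(** The term is w/S + (z w' - w)/S. With x = |w| and Y = x/sqrt(1 + x^2), the first part lies within
    b + Y of b and the second is at most (r - x)/2. Since Y0 - Y >= (9/10)(r0 - x), the slack of a
    smaller |w| pays for the second part. *)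
Lemma log_term_crescent_lt (w : C -> C) (z : C) (r0 Y0 b : R) :
  schwarz_fun w -> (Cmod z < r0)%R -> (r0 <= 1 / 10)%R -> (0 <= Y0)%R ->
  (Y0 * Y0 * (1 + r0 * r0) = r0 * r0)%R -> (1 / 10 <= b)%R ->
  (Cmod (log_term crescent_log w z - RtoC b) < b + Y0)%R.
Proof.
intros [Aw [Dw w0]] Hz Hr0 HY0 EY0 Hb.
assert (Hzd : disk z) by (unfold disk; lra).
destruct (dieudonne w z Aw Dw w0 Hzd) as [H1 H2].
assert (Pz := Cmod_ge_0 z). assert (Pw := Cmod_ge_0 (w z)).
unfold log_term, crescent_log. set (om := w z) in *.
assert (Hom : disk om) by (unfold disk; lra).
assert (P := Re_Csqrt_pos _ (disk_Re_plus1_sqr om Hom)).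
assert (N := Re_pos_neq0 _ P).
assert (ES := Csqrt_sqr (1 + om * om)). set (S := Csqrt (1 + om * om)) in *.
set (r := Cmod z) in *. set (x := Cmod om) in *.
set (Y := (x / sqrt (1 + x * x))%R).
assert (Q0 : (0 < sqrt (1 + x * x))%R) by (apply sqrt_lt_R0; nra).
assert (Q1 := sqrt_sqrt (1 + x * x) ltac:(nra)).
assert (EY : (Y * Y * (1 + x * x) = x * x)%R).
{ rewrite <- Q1 at 1. unfold Y. field. lra. }
assert (PY : (0 <= Y)%R) by (apply Rmult_le_pos; [exact Pw | left; now apply Rinv_0_lt_compat]).
assert (HYx : (Y <= x)%R) by (apply Rsqr_incr_0; unfold Rsqr; nra).
assert (HY0r : (Y0 <= r0)%R) by (apply Rsqr_incr_0; unfold Rsqr; nra).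
set (m := Cmod S).
assert (Em : (m * m = Cmod (1 + om * om))%R) by (unfold m; now rewrite <- Cmod_mult, ES).
assert (Hm2 : (1 - x * x <= m * m)%R).
{ rewrite Em. assert (T := Cmod_triangle (1 + om * om) (- (om * om))).
  replace (1 + om * om + - (om * om)) with (RtoC 1) in T by ring.
  rewrite Cmod_1, Cmod_opp, Cmod_mult in T. fold x in T. lra. }
assert (Pm : (0 < m)%R) by now apply Cmod_gt_0.
assert (Hm : (9 / 10 <= m)%R) by (apply Rsqr_incr_0; unfold Rsqr; nra).
replace (z * C_derive w z * / S - RtoC b) with ((om / S - RtoC b) + (z * C_derive w z - om) / S)
  by (field; exact N).
apply (Rle_lt_trans _ _ _ (Cmod_triangle _ _)).
assert (B1 : (Cmod (om / S - RtoC b) <= b + Y)%R).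
(* y = w/S satisfies 1 - y^2 = 1/S^2, hence |y|^2 = x^2 |1 - y^2|, as [Cmod_crescent_shift_le]
   requires. *)
{ assert (Ey1 : 1 - om / S * (om / S) = / (S * S)).
  { replace (1 - om / S * (om / S)) with ((S * S - om * om) / (S * S)) by (field; exact N).
    rewrite ES at 1. field. exact N. }
  assert (Ey2 : (Cmod (om / S) * Cmod (om / S) = x * x * / (m * m))%R).
  { rewrite Cmod_div by exact N. fold x m. field. lra. }
  apply (Cmod_crescent_shift_le _ (x * x) Y b); auto; try nra.
  - rewrite Ey2, Ey1, Cmod_inv, Cmod_mult by now apply Cmult_neq_0. reflexivity.
  - rewrite Ey2. apply Rmult_le_reg_r with (m * m)%R; [nra |].
    rewrite Rmult_assoc, Rinv_l by nra. nra. }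
rewrite Cmod_div by exact N. fold m.
set (d := Cmod (z * C_derive w z - om)) in *. assert (Pd : (0 <= d)%R) by apply Cmod_ge_0.
assert (B2 : (d / m <= 1 / 2 * (r - x))%R).
{ apply Rmult_le_reg_r with m; [exact Pm |].
  unfold Rdiv. rewrite Rmult_assoc, Rinv_l, Rmult_1_r by lra.
  assert (r * r <= 1 / 10 * (1 / 10))%R by (apply Rmult_le_compat; lra).
  assert (d * (99 / 100) <= d * (1 - r * r))%R by (apply Rmult_le_compat_l; lra).
  assert (d * (99 / 100) <= (r - x) * (r + x))%R by lra.
  assert ((r - x) * (r + x) <= (r - x) * (1 / 5))%R by (apply Rmult_le_compat_l; lra).
  assert ((r - x) * (9 / 10) <= (r - x) * m)%R by (apply Rmult_le_compat_l; lra).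
  lra. }
assert (B3 : (9 / 10 * (r0 - x) <= Y0 - Y)%R).
{ assert (D : ((Y0 * Y0 - Y * Y) * ((1 + r0 * r0) * (1 + x * x)) = r0 * r0 - x * x)%R).
  { replace ((Y0 * Y0 - Y * Y) * ((1 + r0 * r0) * (1 + x * x)))%R
      with ((Y0 * Y0 * (1 + r0 * r0)) * (1 + x * x) - (Y * Y * (1 + x * x)) * (1 + r0 * r0))%R by ring.
    rewrite EY0, EY. ring. }
  assert (Gr : (0 <= r0 * r0 <= 1 / 10 * (1 / 10))%R) by (split; [nra | apply Rmult_le_compat; lra]).
  assert (Gx : (0 <= x * x <= 1 / 10 * (1 / 10))%R) by (split; [nra | apply Rmult_le_compat; lra]).
  assert (G : ((1 + r0 * r0) * (1 + x * x) <= 101 / 100 * (101 / 100))%R) by (apply Rmult_le_compat; lra).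
  assert (G1 : (0 < (1 + r0 * r0) * (1 + x * x))%R) by (apply Rmult_lt_0_compat; lra).
  assert (D1 : (0 <= Y0 * Y0 - Y * Y)%R).
  { apply Rmult_le_reg_r with ((1 + r0 * r0) * (1 + x * x))%R; [exact G1 |].
    rewrite D, Rmult_0_l. assert (x * x <= r0 * r0)%R by (apply Rmult_le_compat; lra). lra. }
  assert (D2 : (9 / 10 * ((r0 - x) * (r0 + x)) <= (Y0 - Y) * (Y0 + Y))%R).
  { assert ((Y0 * Y0 - Y * Y) * ((1 + r0 * r0) * (1 + x * x))
      <= (Y0 * Y0 - Y * Y) * (101 / 100 * (101 / 100)))%R by (apply Rmult_le_compat_l; lra). lra. }
  assert (D3 : (0 <= Y0 - Y)%R).
  { cut (Y <= Y0)%R; [lra |]. apply Rsqr_incr_0; unfold Rsqr; lra. }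
  assert (D4 : ((Y0 - Y) * (Y0 + Y) <= (Y0 - Y) * (r0 + x))%R) by (apply Rmult_le_compat_l; lra).
  apply Rmult_le_reg_r with (r0 + x)%R; lra. }
lra.
Qed.

Lemma Cmod_sum3_le (a b c : C) : (Cmod (a + b + c) <= Cmod a + Cmod b + Cmod c)%R.
Proof.
eapply Rle_trans; [apply Cmod_triangle |]. apply Rplus_le_compat_r, Cmod_triangle.
Qed.

(** As 3 - 2 sqrt 2 = (2 - sqrt 2) - (sqrt 2 - 1), the disc about 0 is internally tangent to the
    other at psi_min - 1, so nothing is lost at the extreme point. *)
Lemma disc_shift (q : C) :
  (Cmod q < 3 - 2 * sqrt 2)%R -> (Cmod (q - (RtoC (sqrt 2) - 1)) < 2 - sqrt 2)%R.
Proof.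
intros H. destruct sqrt2_bounds as [Es Bs].
assert (T := Cmod_triangle q (- RtoC (sqrt 2 - 1))).
rewrite Cmod_opp, Cmod_R, Rabs_pos_eq, RtoC_minus in T by lra.
unfold Cminus at 1. lra.
Qed.

Lemma RtoC_eq_psi_min (x : R) : x = (2 * sqrt 2 - 2)%R -> RtoC x = psi_min.
Proof. intros ->. unfold psi_min. rewrite RtoC_minus, RtoC_mult. reflexivity. Qed.

Lemma radius_T1 :
  is_class_radius class_SR class_T1 ((11 - 4 * sqrt 2 - sqrt (57 - 24 * sqrt 2)) / 8)%R.
Proof.
destruct sqrt2_bounds as [Es Bs].
set (r0 := ((11 - 4 * sqrt 2 - sqrt (57 - 24 * sqrt 2)) / 8)%R).
assert (Q := sqrt_sqrt (57 - 24 * sqrt 2) ltac:(lra)). assert (Q0 := sqrt_pos (57 - 24 * sqrt 2)).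
set (t := sqrt (57 - 24 * sqrt 2)) in *. set (c := sqrt 2) in *.
assert (Bt : (4 < t < 5)%R) by nra.
assert (Br : (0 < r0 < 1 / 5)%R) by (unfold r0; split; nra).
(* [r0] is the smaller root of the quadratic equivalent to [Er2], by which the extreme values r0, r0
   and r0/(2 (1 - r0)) of the three terms add up to 1 - psi_min. *)
assert (Er : (4 * (r0 * r0) - (11 - 4 * c) * r0 + 2 * (3 - 2 * c) = 0)%R) by (unfold r0; nra).
assert (Er2 : (2 * r0 + r0 / (2 * (1 - r0)) = 3 - 2 * c)%R).
{ apply Rmult_eq_reg_r with (2 * (1 - r0))%R; [| lra].
  replace ((2 * r0 + r0 / (2 * (1 - r0))) * (2 * (1 - r0)))%R with (4 * r0 * (1 - r0) + r0)%R by (field; lra).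
  lra. }
apply (class_T_radius Cexp sqrt_1p Cexp_log sqrt_1p_log).
- apply log_derivative_Cexp.
- apply log_derivative_sqrt_1p.
- lra.
- intros w1 w2 w3 z H1 H2 H3 Hz. apply disc_shift.
  eapply Rle_lt_trans; [apply Cmod_sum3_le |].
  assert (B1 := log_term_1_le w1 z H1 ltac:(lra)). assert (B2 := log_term_1_le w2 z H2 ltac:(lra)).
  assert (B3 := log_term_inv_1p_le w3 z H3 ltac:(unfold disk; lra)).
  assert (B4 : (2 * Cmod (log_term sqrt_1p_log w3 z) = Cmod (z * C_derive w3 z / (1 + w3 z)))%R).
  { assert (N : 1 + w3 z <> 0).
    { apply Re_pos_neq0, disk_Re_plus1, H3. unfold disk; lra. }
    rewrite <- (Rabs_pos_eq 2), <- Cmod_R, <- Cmod_mult by lra. f_equal.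
    unfold log_term, sqrt_1p_log. field. exact N. }
  rewrite <- B4 in B3. clear B4.
  set (a := Cmod (log_term sqrt_1p_log w3 z)) in *.
  set (r := Cmod z) in *. fold c.
  assert (Pr : (0 <= r)%R) by apply Cmod_ge_0.
  assert (Ba : (a <= r0 / (2 * (1 - r0)))%R).
  { apply Rmult_le_reg_r with (2 * (1 - r0))%R; [lra |].
    unfold Rdiv. rewrite Rmult_assoc, Rinv_l, Rmult_1_r by lra.
    assert (0 <= a)%R by apply Cmod_ge_0. nra. }
  lra.
- unfold sqrt_1p_log, Cexp_log.
  replace (1 - r0 * (/ (2 * (1 + - r0)) + 2 * 1)) with (RtoC (1 - (2 * r0 + r0 / (2 * (1 - r0))))).
  + apply RtoC_eq_psi_min. rewrite Er2. fold c. ring.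
  + assert (N : RtoC (1 - r0) <> 0) by (apply RtoC_neq0; lra).
    rewrite !RtoC_minus, RtoC_plus, RtoC_div, !RtoC_mult, RtoC_minus by lra.
    rewrite RtoC_minus in N. field.
    replace (1 + - RtoC r0) with (1 - RtoC r0) by ring. exact N.
Qed.

Lemma radius_T2 :
  is_class_radius class_SR class_T2 ((5 - 2 * sqrt 2 - sqrt (21 - 12 * sqrt 2)) / 2)%R.
Proof.
destruct sqrt2_bounds as [Es Bs].
set (r0 := ((5 - 2 * sqrt 2 - sqrt (21 - 12 * sqrt 2)) / 2)%R).
assert (Q := sqrt_sqrt (21 - 12 * sqrt 2) ltac:(lra)). assert (Q0 := sqrt_pos (21 - 12 * sqrt 2)).
set (t := sqrt (21 - 12 * sqrt 2)) in *. set (c := sqrt 2) in *.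
assert (Bt : (2 < t < 2.1)%R) by nra.
assert (Br : (0 < r0 < 1 / 5)%R) by (unfold r0; split; nra).
assert (Er : (r0 * r0 - (5 - 2 * c) * r0 + (3 - 2 * c) = 0)%R) by (unfold r0; nra).
(* Again 1 - psi_min, now as one exponential term r0 plus two terms r0/(2 (1 - r0)). *)
assert (Er2 : (r0 + r0 / (1 - r0) = 3 - 2 * c)%R).
{ apply Rmult_eq_reg_r with (1 - r0)%R; [| lra].
  replace ((r0 + r0 / (1 - r0)) * (1 - r0))%R with (r0 * (1 - r0) + r0)%R by (field; lra).
  lra. }
apply (class_T_radius sqrt_1p Cexp sqrt_1p_log Cexp_log).
- apply log_derivative_sqrt_1p.
- apply log_derivative_Cexp.
- lra.
- intros w1 w2 w3 z H1 H2 H3 Hz. apply disc_shift.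
  eapply Rle_lt_trans; [apply Cmod_sum3_le |].
  assert (B3 := log_term_1_le w3 z H3 ltac:(lra)).
  set (r := Cmod z) in *. fold c.
  assert (Pr : (0 <= r)%R) by apply Cmod_ge_0.
  assert (Ba : forall w, schwarz_fun w ->
    (2 * Cmod (log_term sqrt_1p_log w z) <= r0 / (1 - r0))%R).
  { intros w H.
    assert (B := log_term_inv_1p_le w z H ltac:(unfold disk; unfold r in *; lra)).
    assert (B4 : (2 * Cmod (log_term sqrt_1p_log w z) = Cmod (z * C_derive w z / (1 + w z)))%R).
    { assert (N : 1 + w z <> 0).
      { apply Re_pos_neq0, disk_Re_plus1, H. unfold disk. unfold r in *. lra. }
      rewrite <- (Rabs_pos_eq 2), <- Cmod_R, <- Cmod_mult by lra. f_equal.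
      unfold log_term, sqrt_1p_log. field. exact N. }
    rewrite B4. fold r in B. assert (P := Cmod_ge_0 (z * C_derive w z / (1 + w z))).
    apply Rmult_le_reg_r with (1 - r0)%R; [lra |].
    unfold Rdiv. rewrite Rmult_assoc, Rinv_l, Rmult_1_r by lra. nra. }
  assert (Ba1 := Ba w1 H1). assert (Ba2 := Ba w2 H2). lra.
- unfold sqrt_1p_log, Cexp_log.
  replace (1 - r0 * (1 + 2 * / (2 * (1 + - r0)))) with (RtoC (1 - (r0 + r0 / (1 - r0)))).
  + apply RtoC_eq_psi_min. rewrite Er2. fold c. ring.
  + assert (N : RtoC (1 - r0) <> 0) by (apply RtoC_neq0; lra).
    rewrite !RtoC_minus, RtoC_plus, RtoC_div, RtoC_minus by lra.
    rewrite RtoC_minus in N. field.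
    replace (1 + - RtoC r0) with (1 - RtoC r0) by ring. exact N.
Qed.

Lemma radius_T3 :
  is_class_radius class_SR class_T3 (sqrt (-38 + 27 * sqrt 2) / (2 * sqrt 14))%R.
Proof.
destruct sqrt2_bounds as [Es Bs].
set (r0 := (sqrt (-38 + 27 * sqrt 2) / (2 * sqrt 14))%R).
assert (Q := sqrt_sqrt (-38 + 27 * sqrt 2) ltac:(lra)).
assert (Q0 := sqrt_lt_R0 (-38 + 27 * sqrt 2) ltac:(lra)).
assert (F := sqrt_sqrt 14 ltac:(lra)). assert (F0 := sqrt_lt_R0 14 ltac:(lra)).
assert (Er : (r0 * r0 = (-38 + 27 * sqrt 2) / 56)%R).
{ unfold r0. rewrite <- Q at 3. replace 56%R with (4 * 14)%R by ring. rewrite <- F at 3. field. lra. }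
assert (P0 : (0 < r0)%R) by (apply Rdiv_lt_0_compat; lra).
set (c := sqrt 2) in *.
assert (Br : (r0 <= 1 / 10)%R) by nra.
(* A third of 1 - psi_min; [r0] solves r0/sqrt(1 + r0^2) = Y0, that is r0^2 = Y0^2/(1 - Y0^2). *)
set (Y0 := ((3 - 2 * c) / 3)%R).
assert (EY0 : (Y0 * Y0 * (1 + r0 * r0) = r0 * r0)%R) by (rewrite Er; unfold Y0; nra).
assert (PY0 : (0 < Y0)%R) by (unfold Y0; lra).
apply (class_T_radius crescent crescent crescent_log crescent_log).
- apply log_derivative_crescent.
- apply log_derivative_crescent.
- lra.
- intros w1 w2 w3 z H1 H2 H3 Hz.
  (* Each term receives a third of the shift sqrt 2 - 1, and 3 (b + Y0) = 2 - sqrt 2. *)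
  set (b := ((c - 1) / 3)%R).
  assert (Hb : (1 / 10 <= b)%R) by (unfold b; lra).
  assert (B1 := log_term_crescent_lt w1 z r0 Y0 b H1 Hz Br ltac:(lra) EY0 Hb).
  assert (B2 := log_term_crescent_lt w2 z r0 Y0 b H2 Hz Br ltac:(lra) EY0 Hb).
  assert (B3 := log_term_crescent_lt w3 z r0 Y0 b H3 Hz Br ltac:(lra) EY0 Hb).
  set (L := crescent_log) in *.
  assert (Eb : RtoC c - 1 = RtoC b + RtoC b + RtoC b).
  { rewrite <- RtoC_minus, <- !RtoC_plus. f_equal. unfold b. field. }
  fold c. rewrite Eb.
  replace (log_term L w3 z + log_term L w1 z + log_term L w2 z - (RtoC b + RtoC b + RtoC b))
    with ((log_term L w3 z - RtoC b) + (log_term L w1 z - RtoC b) + (log_term L w2 z - RtoC b)) by ring.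
  eapply Rle_lt_trans; [apply Cmod_sum3_le |]. unfold Y0, b in *. lra.
- unfold crescent_log.
  assert (S0 := sqrt_lt_R0 (1 + r0 * r0) ltac:(nra)).
  assert (S1 := sqrt_sqrt (1 + r0 * r0) ltac:(nra)).
  set (s := sqrt (1 + r0 * r0)) in *.
  rewrite (Csqrt_unique (1 + - r0 * - r0) (RtoC s)); [| | exact S0].
  2: { rewrite <- RtoC_mult, S1, RtoC_plus, RtoC_mult. ring. }
  replace (1 - r0 * (/ s + 2 * / s)) with (RtoC (1 - 3 * (r0 / s))).
  2: { assert (N : RtoC s <> 0) by (apply RtoC_neq0; lra).
       rewrite RtoC_minus, RtoC_mult, RtoC_div by lra. field. exact N. }
  apply RtoC_eq_psi_min. fold c.
  assert (ES : (r0 / s = Y0)%R).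
  { apply Rsqr_inj; [left; now apply Rdiv_lt_0_compat | lra |]. unfold Rsqr.
    apply Rmult_eq_reg_r with (s * s)%R; [| nra].
    transitivity (r0 * r0)%R; [field; lra | now rewrite S1, EY0]. }
  rewrite ES. unfold Y0. field.
Qed.

Theorem corollary3p6 :
  (is_class_radius class_SR class_T1
    ((11 - 4 * sqrt 2 - sqrt (57 - 24 * sqrt 2)) / 8)%R) /\
  (is_class_radius class_SR class_T2
    ((5 - 2 * sqrt 2 - sqrt (21 - 12 * sqrt 2)) / 2)%R) /\
  (is_class_radius class_SR class_T3
    (sqrt (-38 + 27 * sqrt 2) / (2 * sqrt 14))%R).
Proof.
split; [exact radius_T1 | split; [exact radius_T2 | exact radius_T3]].
Qed.
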